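(* Let $\mathcal M=G\cdot x_c\subseteq\mathbb P(V)$, the special flow $\Phi=\Phi_X$ on $\mathcal M$, the groups $N$ and $\theta N$, and the fixed point set $\mathcal F_{\mathcal M}$ with the Bruhat order $\preceq_{\mathrm{Br}}$ be as in the context. Let $\mathcal L(\mathcal F_{\mathcal M})$ be the lattice of lower sets in $\mathcal F_{\mathcal M}$ and $\mathcal U(\mathcal F_{\mathcal M})$ the lattice of upper sets in $\mathcal F_{\mathcal M}$ with respect to $\preceq_{\mathrm{Br}}$. Then the maps $$\mathcal U(\mathcal F_{\mathcal M})\to\mathcal A(\mathcal M,\Phi),\quad U\mapsto\mathcal A_U:=\bigcup_{x\in U}(\theta N)\cdot x$$ and $$\mathcal L(\mathcal F_{\mathcal M})\to\mathcal A(\mathcal M,\Phi^{-1}),\quad L\mapsto\mathcal R_L:=\bigcup_{x\in L}N\cdot x$$ are (well-defined) lattice isomorphisms, and $\mathcal R_L$ is the dual repellor of $\mathcal A_{\mathcal F_{\mathcal M}\setminus L}$.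
   Context: Group setting. $V$ is a finite-dimensional complex vector space with a Hermitian inner product, and $\varphi^t$ denotes the adjoint of $\varphi\in\mathrm{End}_{\mathbb C}(V)$. The Cartan involution is $\theta(g)=(g^{-1})^t$ on $\mathrm{GL}(V)$, with derivative $\theta(Y)=-Y^t$ on $\mathfrak{gl}(V)=\mathrm{End}_{\mathbb C}(V)$. $G\subseteq\mathrm{GL}(V)$ is a closed connected $\theta$-invariant subgroup whose Lie algebra $\mathfrak g=\{Y\in\mathrm{End}_{\mathbb C}(V)\mid e^{\mathbb RY}\subseteq G\}$ is a complex subspace of $\mathfrak{gl}(V)$. Let $\mathfrak k,\mathfrak p$ be the $(+1)$- and $(-1)$-eigenspaces of $\theta$ on $\mathfrak g$, and let $\mathfrak a$ be a maximal abelian subspace of $\mathfrak p$. Let $\mathfrak a_{\mathbb C}=\mathfrak a+i\mathfrak a$ and $A_{\mathbb C}=\exp(\mathfrak a_{\mathbb C})$. Weights and roots. $V=\bigoplus_{\mu\in\mathcal P}V^\mu$, where $V^\mu=\{v\mid Yv=\mu(Y)v\ \forall Y\in\mathfrak a\}$ and $\mathcal P\subset\mathfrak a^*$ is the finite set of $\mu$ with $V^\mu\ne0$. For $\alpha\in\mathfrak a^*$ put $\mathfrak g^\alpha=\{Y\in\mathfrak g\mid [H,Y]=\alpha(H)Y\ \forall H\in\mathfrak a\}$; $\Delta$ is the set of $\alpha\neq0$ with $\mathfrak g^\alpha\ne0$. Fix $X_o\in\mathfrak a$ with $\alpha(X_o)\neq0$ for all $\alpha\in\Delta$ and put $\Delta^+=\{\alpha\in\Delta\mid\alpha(X_o)>0\}$.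 Let $\mathfrak n=\bigoplus_{\alpha\in\Delta^+}\mathfrak g^\alpha$, $N=\exp(\mathfrak n)$, $\theta N=\theta(N)=\exp(\theta\mathfrak n)$. Let $\mathfrak m=\{Y\in\mathfrak k\mid[H,Y]=0\ \forall H\in\mathfrak a\}$, $\mathfrak b=\mathfrak m+\mathfrak a+\mathfrak n$, and let $B$ be the closed subgroup of $G$ generated by $\exp\mathfrak b$. Flag manifold. $\mathcal M\subseteq\mathbb P(V)$ is a closed $G$-orbit and $x_c\in\mathcal M$ is a $B$-fixed point (one exists), so $\mathcal M=G\cdot x_c$. Special flow. $X\in\mathfrak a$ satisfies $\alpha(X)<0$ for all $\alpha\in\Delta^+$ and $\mu(X)\neq\nu(X)$ for all $\mu\ne\nu$ in $\mathcal P$; $\Phi=\Phi_X$ is the flow $\Phi(t,x)=e^{tX}\cdot x$ on $\mathcal M$. $\mathcal F_{\mathcal M}$ is the set of points of $\mathcal M$ fixed by $e^{\mathbb RX}$; equivalently the set of $A_{\mathbb C}$-fixed points in $\mathcal M$. Bruhat order. For $x,y\in\mathcal F_{\mathcal M}$: $x\preceq_{\mathrm{Br}}y$ iff $N\cdot x\subseteq\overline{N\cdot y}$ (closure in $\mathcal M$); this is a partial order. A subset $U\subseteq\mathcal F_{\mathcal M}$ is an upper set if $x\in U$, $x\preceq_{\mathrm{Br}}y$ imply $y\in U$; a lower set if $x\in U$, $y\preceq_{\mathrm{Br}}x$ imply $y\in U$. Upper and lower sets form lattices under union and intersection. Attractors. For a continuous flow $\Phi$ on a compact metrizable space $\mathcal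 M$, an attractor is a compact invariant set $\mathcal A\subseteq\mathcal M$ (possibly empty) having a neighborhood $U$ with $\Phi(t,\overline U)\subseteq\mathrm{int}\,U$ for all $t>0$ and $\mathcal A=\bigcap_{t\ge0}\Phi(t,U)$. A repellor is an attractor of the time-reversed flow $\Phi^{-1}$. $\mathcal A(\mathcal M,\Phi)$ and $\mathcal A(\mathcal M,\Phi^{-1})$ denote the sets of attractors and repellors of $\Phi$; they are lattices under union and intersection. For an attractor $\mathcal A$, with $\mathcal W^+(\mathcal A)=\{x\mid\lim_{t\to+\infty}d(\Phi(t,x),\mathcal A)=0\}$ ($d$ a metric on $\mathcal M$, and $\mathcal W^+(\emptyset)=\emptyset$), the dual repellor is $\mathcal A^*=\mathcal M\setminus\mathcal W^+(\mathcal A)$. *)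

(* Defs.v *)
From HB Require Import structures.
From mathcomp Require Import all_boot all_order all_algebra.
From mathcomp Require Import complex.
From mathcomp Require Import all_classical all_reals all_analysis.

Set Implicit Arguments.
Unset Strict Implicit.
Unset Printing Implicit Defensive.

Import Order.TTheory GRing.Theory Num.Theory.
Import numFieldNormedType.Exports.

Local Open Scope classical_set_scope.
Local Open Scope ring_scope.

(* Naming the structure makes the canonical topology of a numClosedFieldType
   available on R[i]. *)
Definition Cplx (R : realType) : numClosedFieldType := R[i].

Definition ofreal (R : realType) (s : R) : Cplx R := real_complex R s.

(* All linear isomorphisms W -> C^n induce the same topology on a
   finite-dimensional space W; [v2r] is the one carried by the vectType. *)
Definition vtop (R : realType) (W : vectType (Cplx R)) : Type :=
  initial_topology (@VectorInternalTheory.v2r (Cplx R) W).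

HB.instance Definition _ (R : realType) (W : vectType (Cplx R)) :=
  Topological.copy (vtop W)
    (initial_topology (@VectorInternalTheory.v2r (Cplx R) W)).
HB.instance Definition _ (R : realType) (W : vectType (Cplx R)) :=
  isPointed.Build (vtop W) (0 : W).

Section Projective.
Context {R : realType} (V : vectType (Cplx R)).

Definition projspace : Type := {L : {vspace V} | \dim L == 1%N}.

HB.instance Definition _ := Choice.on projspace.

Definition nonzero : set (vtop V) := [set v | v <> (0 : V)].

Fact line_subproof (v : nonzero) : \dim <[(set_val v : V)]> == 1%N.
Proof. by rewrite dim_vline; case: v => v /= /set_mem /eqP ->. Qed.

Definition line (v : nonzero) : projspace :=
  exist (fun L : {vspace V} => \dim L == 1%N) <[(set_val v : V)]>%VS
        (line_subproof v).

(* quotient topology of V \ {0} -> P(V) *)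
Definition proj_open : set (set projspace) := [set O | open (line @^-1` O)].

Fact proj_openT : proj_open setT.
Proof. by rewrite /proj_open /= preimage_setT; exact: openT. Qed.

Fact proj_openI : setI_closed proj_open.
Proof. by move=> A B oA oB; exact: openI. Qed.

Fact proj_open_bigU (I : Type) (f : I -> set projspace) :
  (forall i, proj_open (f i)) -> proj_open (\bigcup_i f i).
Proof. by move=> fo; apply: bigcup_open => i _; exact: fo. Qed.

HB.instance Definition _ :=
  isOpenTopological.Build projspace proj_openT proj_openI proj_open_bigU.

(* The default value [x] is only reached when [g] kills the line [x]. *)
Definition proj_act (g : 'End(V)) (x : projspace) : projspace :=
  insubd x (g @: val x)%VS.

Definition proj_orbit (S : set 'End(V)) (x : projspace) : set projspace :=
  [set proj_act g x | g in S].

End Projective.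

Section LieTheory.
Context {R : realType} {V : vectType (Cplx R)}.
Implicit Types (Y Z H : 'End(V)) (S G a : set 'End(V)).

Fixpoint endo_pow Y (k : nat) : 'End(V) :=
  if k is j.+1 then (Y \o endo_pow Y j)%VF else \1%VF.

Definition expm Y : 'End(V) :=
  limn (fun n => (\sum_(k < n) (k`!%:R : Cplx R)^-1 *: endo_pow Y k)
                 : vtop 'End(V)).

Definition bracket Y Z : 'End(V) := (Y \o Z)%VF - (Z \o Y)%VF.

Definition GL : set 'End(V) := [set g | lker g == 0%VS].

Definition subgroupGL S : Prop :=
  [/\ S `<=` GL, S \1%VF,
      (forall g h, S g -> S h -> S (g \o h)%VF)
    & (forall g, S g -> S (g^-1)%VF)].

Definition closed_subgroupGL S : Prop :=
  subgroupGL S /\ closure (S : set (vtop 'End(V))) `&` GL `<=` S.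

Definition complex_subspace S : Prop :=
  S 0 /\ forall (c : Cplx R) Y Z, S Y -> S Z -> S (c *: Y + Z).

Definition real_subspace S : Prop :=
  S 0 /\ forall (s : R) Y Z, S Y -> S Z -> S (ofreal s *: Y + Z).

Definition lie_algebra G : set 'End(V) :=
  [set Y | forall s : R, G (expm (ofreal s *: Y))].

Definition abelian_subset S : Prop :=
  forall Y Z, S Y -> S Z -> bracket Y Z = 0.

Variable dot : {dot V for Num.conj}.

Definition adjoint Y : 'End(V) :=
  xget 0 [set Z : 'End(V) | forall v w : V, dot (Y v) w = dot v (Z w)].

Definition theta_group (g : 'End(V)) : 'End(V) := adjoint (g^-1)%VF.
Definition theta_lie Y : 'End(V) := - adjoint Y.

Definition lie_k G : set 'End(V) :=
  [set Y | lie_algebra G Y /\ theta_lie Y = Y].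
Definition lie_p G : set 'End(V) :=
  [set Y | lie_algebra G Y /\ theta_lie Y = - Y].

Definition max_abelian_in_p G a : Prop :=
  [/\ real_subspace a, a `<=` lie_p G, abelian_subset a
    & forall a', real_subspace a' -> a' `<=` lie_p G -> abelian_subset a' ->
        a `<=` a' -> a' = a].

(* Elements of the dual of [a] are functions on the subtype of elements of [a],
   so that Leibniz equality of weights is equality in the dual. *)
Definition in_dual a (mu : a -> R) : Prop :=
  forall (s : R) (Y Z W : a), val W = ofreal s *: val Y + val Z ->
    mu W = s * mu Y + mu Z.

Definition weight_space a (mu : a -> R) : set V :=
  [set v | forall Y : a, val Y v = ofreal (mu Y) *: v].

Definition weight a (mu : a -> R) : Prop :=
  in_dual mu /\ exists2 v, v <> 0 & weight_space mu v.

Definition root_space G a (alpha : a -> R) : set 'End(V) :=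
  [set Y | lie_algebra G Y /\
           forall H : a, bracket (val H) Y = ofreal (alpha H) *: Y].

Definition is_root G a (alpha : a -> R) : Prop :=
  [/\ in_dual alpha, alpha <> (fun=> 0)
    & exists2 Y, Y <> 0 & root_space G alpha Y].

Definition pos_root G a (Xo : a) (alpha : a -> R) : Prop :=
  is_root G alpha /\ 0 < alpha Xo.

Definition lie_n G a (Xo : a) : set 'End(V) :=
  [set Y | exists (k : nat) (alpha : 'I_k -> (a -> R)) (Z : 'I_k -> 'End(V)),
     (forall i, pos_root G Xo (alpha i) /\ root_space G (alpha i) (Z i)) /\
     Y = \sum_i Z i].

Definition lie_m G a : set 'End(V) :=
  [set Y | lie_k G Y /\ forall H, a H -> bracket H Y = 0].

Definition lie_b G a (Xo : a) : set 'End(V) :=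
  [set Y | exists Ym Ya Yn, [/\ lie_m G a Ym, a Ya, lie_n G Xo Yn
                              & Y = Ym + Ya + Yn]].

Definition groupN G a (Xo : a) : set 'End(V) := expm @` lie_n G Xo.

Definition thetaN G a (Xo : a) : set 'End(V) := theta_group @` groupN G Xo.

Definition groupB G a (Xo : a) : set 'End(V) :=
  [set g | forall S, closed_subgroupGL S -> S `<=` G ->
             expm @` lie_b G Xo `<=` S -> S g].

End LieTheory.

Section FlagManifold.
Context {R : realType} {V : vectType (Cplx R)} (M : set (projspace V)).

Definition orbit_in (S : set 'End(V)) (x : M) : set M :=
  set_val @^-1` proj_orbit S (set_val x).

(* The default value [x] is only reached when exp(tX) does not preserve [M]. *)
Definition flow (X : 'End(V)) (t : R) (x : M) : M :=
  insubd x (proj_act (expm (ofreal t *: X)) (set_val x)).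

Definition fixed_points (X : 'End(V)) : set M :=
  [set x | forall t, flow X t x = x].

Definition bruhat (N : set 'End(V)) (x y : M) : Prop :=
  orbit_in N x `<=` closure (orbit_in N y).

Definition saturation (S : set 'End(V)) (U : set M) : set M :=
  \bigcup_(x in U) orbit_in S x.

End FlagManifold.

Section Orders.
Context {T : Type}.
Implicit Types (F U : set T) (le : T -> T -> Prop).

Definition upper_set F le U : Prop :=
  U `<=` F /\ forall x y, U x -> F y -> le x y -> U y.

Definition lower_set F le U : Prop :=
  U `<=` F /\ forall x y, U x -> F y -> le y x -> U y.

Definition set_lattice_iso {T' : Type} (P : set (set T)) (Q : set (set T'))
    (f : set T -> set T') : Prop :=
  set_bij P Q f /\
  forall A B, P A -> P B ->
    f (A `|` B) = f A `|` f B /\ f (A `&` B) = f A `&` f B.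

End Orders.

Section Attractors.
Context {R : realType} {T : topologicalType}.
Implicit Types (Phi : R -> T -> T) (A : set T) (d : T -> T -> R).

Definition attractor Phi A : Prop :=
  [/\ compact A, (forall t, Phi t @` A = A)
    & exists U : set T,
        [/\ A `<=` U°,
            (forall t, 0 < t -> Phi t @` closure U `<=` U°)
          & A = \bigcap_(t in [set t : R | 0 <= t]) (Phi t @` U)]].

Definition reversed Phi : R -> T -> T := fun t => Phi (- t).

Definition compatible_metric d : Prop :=
  [/\ (forall x y, d x y = 0 <-> x = y),
      (forall x y, d x y = d y x),
      (forall x y z, d x z <= d x y + d y z)
    & forall (x : T) (B : set T),
        nbhs x B <-> exists2 e : R, 0 < e & [set y | d x y < e] `<=` B].

Definition dist_to d A (x : T) : R := inf [set d x y | y in A].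

Definition basin d Phi A : set T :=
  [set x | A !=set0 /\ dist_to d A (Phi t x) @[t --> +oo] --> (0 : R)].

Definition dual_repellor d Phi A : set T := ~` basin d Phi A.

End Attractors.

(* Main.v *)
From HB Require Import structures.
Require Import Defs.
From mathcomp Require Import all_boot all_order all_algebra.
From mathcomp Require Import complex.
From mathcomp Require Import all_classical all_reals all_analysis.
From mathcomp Require Import ring lra.

Set Implicit Arguments.
Unset Strict Implicit.
Unset Printing Implicit Defensive.

Import Order.TTheory GRing.Theory Num.Theory.
Import numFieldNormedType.Exports.

Local Open Scope classical_set_scope.
Local Open Scope ring_scope.

(** The special flow is gradient-like, and every statement about attractors is a
    statement about which rest points are joined by trajectories.

    Dynamics. Let [phi] be a flow on a compact Hausdorff space with a strictly
    increasing Lyapunov function off the rest points, such that each trajectory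
    converges to a rest point in both time directions. Write [linked phi p q]
    when a trajectory runs from [p] to [q]. If each rest point has a
    neighbourhood in which points of stable sets produce links
    ([locally_linked]), then the attractors are exactly the unions of unstable
    sets over sets of rest points closed under links, and the dual repellor is
    the union of the remaining stable sets ([upper_set_attractor_iso],
    [stable_hull_dual_repellor]). The hard half, [unstable_hull_attractor],
    builds an attractor block out of a Urysohn function tilted by the Lyapunov
    function. Repellors are handled by reversing time.

    Local products. Suppose that the flow contracts a family of homeomorphisms
    and expands another one, and that their two products sweep out
    neighbourhoods of each rest point [p]. Then the orbits of [p] are its stable
    and unstable sets, [phi] is locally linked, and the closure order of the
    orbits is the relation [linked] ([stable_orb], [unstable_orb],
    [product_locally_linked], [orb_closure_linked]). Applied to [N] and
    [theta N], this identifies the Bruhat order with [linked].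

    Lie theory. In a basis of weight vectors [exp (t X)] is diagonal with
    positive entries, so the mean of the eigenvalues of [X], weighted by the
    squared coordinates, is a Lyapunov function, and rescaled trajectories
    converge ([flow_gradient_like]). The entries of an element of the Lie algebra
    on which [X] acts by a negative, a positive and a zero scalar lie in [n], in
    [theta n] and in the centralizer [a + i a] of [a] ([root_decomposition]); [X]
    contracts [n] since the positive roots are negative at [X]. Near the identity
    a closed group factors along such a decomposition ([local_factorization]),
    and a Baire category argument shows that elements near the identity move a
    point of the closed orbit onto a neighbourhood of it ([orbit_nbhs]). The
    factor in [exp (a + i a)] fixes the rest points, which gives the two
    neighbourhoods ([nbhs_orb2]). *)

(** * Complex moduli and a norm on vector spaces *)

Section Modulus.
Context {R : realType}.
Implicit Types z w : Cplx R.

(** The norm of [Cplx R] takes values in [Cplx R]; estimates are made in [R]. *)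
Definition cabs z : R := complex.Re `|z|.

Lemma normcE z : `|z| = ofreal (cabs z).
Proof. by rewrite /cabs /ofreal normc_def. Qed.

Lemma ler_ofreal (a b : R) : (ofreal a <= ofreal b) = (a <= b).
Proof. exact: lecR. Qed.

Lemma ltr_ofreal (a b : R) : (ofreal a < ofreal b) = (a < b).
Proof. exact: ltcR. Qed.

Lemma ofreal_inj : injective (@ofreal R).
Proof. exact: complexI. Qed.

Lemma ofrealD a b : ofreal (a + b) = ofreal a + ofreal b :> Cplx R.
Proof. by rewrite /ofreal -rmorphD. Qed.

Lemma ofrealN a : ofreal (- a) = - ofreal a :> Cplx R.
Proof. by rewrite /ofreal -rmorphN. Qed.

Lemma ofrealM a b : ofreal (a * b) = ofreal a * ofreal b :> Cplx R.
Proof. by rewrite /ofreal -rmorphM. Qed.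

Lemma ofreal0 : ofreal 0 = 0 :> Cplx R.
Proof. by rewrite /ofreal rmorph0. Qed.

Lemma ofreal1 : ofreal 1 = 1 :> Cplx R.
Proof. by rewrite /ofreal rmorph1. Qed.

Lemma ofreal_nat n : ofreal n%:R = n%:R :> Cplx R.
Proof. by rewrite /ofreal rmorph_nat. Qed.

Lemma ofrealX a n : ofreal (a ^+ n) = ofreal a ^+ n :> Cplx R.
Proof. by rewrite /ofreal rmorphXn. Qed.

Lemma ofrealV a : ofreal a^-1 = (ofreal a)^-1 :> Cplx R.
Proof. by rewrite /ofreal fmorphV. Qed.

Lemma ofreal_eq0 a : (ofreal a == 0 :> Cplx R) = (a == 0).
Proof. by rewrite -ofreal0 (inj_eq ofreal_inj). Qed.

Lemma cabs_ge0 z : 0 <= cabs z.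
Proof. by rewrite -ler_ofreal -normcE ofreal0. Qed.

Lemma cabs_ofreal a : cabs (ofreal a) = `|a|.
Proof.
by apply: ofreal_inj; rewrite -normcE /ofreal normc_def /= expr0n addr0 sqrtr_sqr.
Qed.

Lemma cabs0 : cabs 0 = 0.
Proof. by apply: ofreal_inj; rewrite -normcE normr0 ofreal0. Qed.

Lemma cabs1 : cabs 1 = 1.
Proof. by apply: ofreal_inj; rewrite -normcE normr1 ofreal1. Qed.

Lemma cabs_eq0 z : (cabs z == 0) = (z == 0).
Proof. by rewrite -(inj_eq ofreal_inj) -normcE ofreal0 normr_eq0. Qed.

Lemma cabs_gt0 z : (0 < cabs z) = (z != 0).
Proof. by rewrite lt_def cabs_ge0 andbT cabs_eq0. Qed.

Lemma cabsM z w : cabs (z * w) = cabs z * cabs w.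
Proof. by apply: ofreal_inj; rewrite ofrealM -!normcE normrM. Qed.

Lemma cabsN z : cabs (- z) = cabs z.
Proof. by apply: ofreal_inj; rewrite -!normcE normrN. Qed.

Lemma cabsV z : cabs z^-1 = (cabs z)^-1.
Proof. by apply: ofreal_inj; rewrite ofrealV -!normcE normfV. Qed.

Lemma cabsD z w : cabs (z + w) <= cabs z + cabs w.
Proof. by rewrite -ler_ofreal ofrealD -!normcE ler_normD. Qed.

Lemma cabsJ z : cabs (z^* : Cplx R) = cabs z.
Proof. by apply: ofreal_inj; rewrite -!normcE norm_conjC. Qed.

Lemma conj_ofreal a : ((ofreal a : Cplx R)^*)%R = ofreal a.
Proof.
apply/conj_Creal; rewrite /ofreal; apply/complex_realP; by exists a.
Qed.

Lemma nbhs_cabsP (z : Cplx R) (B : set (Cplx R)) :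
  nbhs z B <-> exists2 e : R, 0 < e & forall w, cabs (w - z) < e -> B w.
Proof.
split=> [/nbhs_ballP[e e0 eB]|[e e0 eB]].
  have er : e = ofreal (complex.Re e) by rewrite /ofreal RRe_real // gtr0_real.
  exists (complex.Re e); first by rewrite -ltr_ofreal ofreal0 -er.
  move=> w wz; apply: eB; rewrite -ball_normE /=.
  by rewrite distrC normcE er ltr_ofreal.
apply/nbhs_ballP; exists (ofreal e); first by rewrite /= -ofreal0 ltr_ofreal.
move=> w; rewrite -ball_normE /= distrC normcE ltr_ofreal; exact: eB.
Qed.

End Modulus.

Section Norm.
Import VectorInternalTheory.
Context {R : realType} {W : vectType (Cplx R)}.
Implicit Types (u v w : W) (c : Cplx R).

Definition coo w (i : 'I_(dim W)) : Cplx R := v2r w 0 i.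

Definition unitv (i : 'I_(dim W)) : W := r2v (delta_mx 0 i).

(** The topology of [vtop W] is that of the coordinates [v2r], so it is the
    topology of this norm; all limits below are expressed with it. *)
Definition nrm w : R := \sum_i cabs (coo w i).

Lemma cooD u v i : coo (u + v) i = coo u i + coo v i.
Proof. by rewrite /coo linearD mxE. Qed.

Lemma cooZ c u i : coo (c *: u) i = c * coo u i.
Proof. by rewrite /coo linearZ mxE. Qed.

Lemma cooB u v i : coo (u - v) i = coo u i - coo v i.
Proof. by rewrite /coo linearB !mxE. Qed.

Lemma coo_sum w : w = \sum_i coo w i *: unitv i.
Proof.
apply: (can_inj v2rK).
rewrite linear_sum [LHS]row_sum_delta; apply: eq_bigr => i _.
by rewrite linearZ /= /unitv r2vK.
Qed.

Lemma nrm_ge0 w : 0 <= nrm w.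
Proof. by apply: sumr_ge0 => i _; exact: cabs_ge0. Qed.

Lemma coo_le_nrm w i : cabs (coo w i) <= nrm w.
Proof.
rewrite /nrm (bigD1 i) //= lerDl; apply: sumr_ge0 => j _; exact: cabs_ge0.
Qed.

Lemma nrm_eq0 w : (nrm w == 0) = (w == 0).
Proof.
apply/idP/idP => [/eqP w0|/eqP->]; last first.
  by apply/eqP/big1 => i _; rewrite /coo linear0 mxE cabs0.
apply/eqP; rewrite (coo_sum w) big1 // => i _.
have : cabs (coo w i) == 0 by rewrite eq_le cabs_ge0 -w0 coo_le_nrm.
by rewrite cabs_eq0 => /eqP->; rewrite scale0r.
Qed.

Lemma nrm0 : nrm 0 = 0.
Proof. by apply/eqP; rewrite nrm_eq0. Qed.

Lemma nrm_gt0 w : (0 < nrm w) = (w != 0).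
Proof. by rewrite lt_def nrm_ge0 andbT nrm_eq0. Qed.

Lemma nrmD u v : nrm (u + v) <= nrm u + nrm v.
Proof.
rewrite /nrm -big_split; apply: ler_sum => i _; rewrite cooD; exact: cabsD.
Qed.

Lemma nrmZ c u : nrm (c *: u) = cabs c * nrm u.
Proof. by rewrite /nrm mulr_sumr; apply: eq_bigr => i _; rewrite cooZ cabsM. Qed.

Lemma nrmN u : nrm (- u) = nrm u.
Proof. by rewrite -scaleN1r nrmZ cabsN cabs1 mul1r. Qed.

Lemma nrmC u v : nrm (u - v) = nrm (v - u).
Proof. by rewrite -opprB nrmN. Qed.

Lemma nrm_tri u v w : nrm (u - w) <= nrm (u - v) + nrm (v - w).
Proof. by apply: le_trans (nrmD _ _); rewrite addrA subrK. Qed.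

Lemma nrm_sub_ge u v : nrm u - nrm v <= nrm (u - v).
Proof. by rewrite lerBlDr -{1}(subrK v u) nrmD. Qed.

Lemma nrm_sum (I : Type) (s : seq I) (P : pred I) (F : I -> W) :
  nrm (\sum_(i <- s | P i) F i) <= \sum_(i <- s | P i) nrm (F i).
Proof.
elim/big_rec2: _ => [|i y x _ le_xy]; first by rewrite nrm0.
by rewrite (le_trans (nrmD _ _)) // lerD2l.
Qed.

Lemma nbhs_nrmP (w : vtop W) (B : set (vtop W)) :
  nbhs w B <-> exists2 e : R, 0 < e & forall u : W, nrm (u - (w : W)) < e -> B u.
Proof.
split.
  case=> _ [[A oA <-] Aw AB].
  have [/= P Pnb PA] : nbhs (v2r (w : W)) A by exact: open_nbhs_nbhs.
  have /choice[e eP] : forall i, exists e : R,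
      0 < e /\ forall z, cabs (z - coo w i) < e -> P 0 i z.
    by move=> i; have /nbhs_cabsP[e e0 he] := Pnb 0 i; exists e.
  have e_gt0 i : 0 < e i by case: (eP i).
  exists (\big[Order.min/1]_i e i).
    by elim/big_ind: _ => // x y x0 y0; rewrite lt_min x0.
  move=> u uw; apply: AB; apply: PA => i j; rewrite ord1 {i}.
  apply: (eP j).2; rewrite -[v2r u 0 j]/(coo u j) -cooB.
  apply: le_lt_trans (coo_le_nrm _ _) (lt_le_trans uw _).
  exact: bigmin_le_cond.
case=> e e0 eB.
have n0 : (0 : R) < (dim W).+1%:R by rewrite ltr0n.
pose P (i : 'I_1) (j : 'I_(dim W)) : set (Cplx R) :=
  [set z | cabs (z - coo w j) < e / (dim W).+1%:R].
have nbP : nbhs (v2r (w : W))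
    [set M : 'rV[Cplx R]_(dim W) | forall i j, P i j (M i j)].
  exists P => // i j; rewrite ord1; apply/nbhs_cabsP.
  by exists (e / (dim W).+1%:R); rewrite ?divr_gt0.
have := @initial_continuous _ _ (@v2r _ W) w _ nbP.
apply: (@filterS (vtop W) (nbhs w)) => u /= uP; apply: eB.
apply: le_lt_trans (_ : \sum_(i < dim W) (e / (dim W).+1%:R) < e).
  apply: ler_sum => i _; rewrite cooB; exact: ltW (uP 0 i).
rewrite sumr_const card_ord -[ltLHS]mulr_natr -mulrA gtr_pMr //.
by rewrite ltr_pdivrMl // mulr1 ltr_nat.
Qed.

End Norm.

(** * Compactness and a submultiplicative norm on endomorphisms *)

Section Compactness.
Context {R : realType}.

Lemma cabs_rect (a b : R) : cabs (Complex a b : Cplx R) <= `|a| + `|b|.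
Proof.
have -> : (Complex a b : Cplx R) = ofreal a + (Complex 0 1 : Cplx R) * ofreal b.
  by rewrite /ofreal; exact: (complexE (Complex a b)).
rewrite (le_trans (cabsD _ _)) // cabsM !cabs_ofreal.
suff -> : cabs (Complex 0 1 : Cplx R) = 1 by rewrite mul1r.
by rewrite /cabs normc_def /= expr0n add0r expr1n sqrtr1.
Qed.

Lemma le_Re_cabs (z : Cplx R) : `|complex.Re z| <= cabs z.
Proof.
rewrite /cabs normc_def /= -[leLHS]sqrtr_sqr; apply: ler_wsqrtr.
by rewrite lerDl sqr_ge0.
Qed.

Lemma le_Im_cabs (z : Cplx R) : `|complex.Im z| <= cabs z.
Proof.
rewrite /cabs normc_def /= -[leLHS]sqrtr_sqr; apply: ler_wsqrtr.
by rewrite lerDr sqr_ge0.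
Qed.

Lemma disk_compact (r : R) : compact [set z : Cplx R | cabs z <= r].
Proof.
pose f (p : R * R) : Cplx R := Complex p.1 p.2.
have fc : continuous f.
  move=> p B /nbhs_cabsP[e e0 eB].
  have e20 : 0 < e / 2 by rewrite divr_gt0.
  exists (ball p.1 (e / 2), ball p.2 (e / 2)) => /=.
    by split; exact: nbhsx_ballx.
  move=> q [/= q1 q2]; apply: eB.
  have -> : f q - f p = Complex (q.1 - p.1) (q.2 - p.2) :> Cplx R by [].
  apply: le_lt_trans (cabs_rect _ _) _; rewrite (splitr e) ltrD // distrC //.
have K : compact (f @` (`[- r, r] `*` `[- r, r])).
  apply: continuous_compact; first exact: continuous_subspaceT.
  by apply: compact_setX; exact: segment_compact.
apply: (subclosed_compact _ K); last first.
  move=> z /= zr; exists (complex.Re z, complex.Im z); last by case: (z).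
  by split => /=; rewrite in_itv /= -ler_norml (le_trans _ zr) ?le_Re_cabs ?le_Im_cabs.
rewrite closedE => z /= nz; apply/negPn/negP; rewrite -ltNge => zr; apply: nz.
apply/nbhs_cabsP; exists (cabs z - r); first by rewrite subr_gt0.
move=> w wz /=; apply/negP; rewrite -ltNge.
have := cabsD w (z - w); rewrite addrC subrK -(cabsN (z - w)) opprB => h; lra.
Qed.

End Compactness.

Section NormTopology.
Import VectorInternalTheory.
Context {R : realType} {W : vectType (Cplx R)}.
Implicit Types (u v w : W).

Lemma closure_nrmP (A : set (vtop W)) (w : vtop W) :
  closure A w <-> forall e : R, 0 < e -> exists2 u : W, A u & nrm (u - (w : W)) < e.
Proof.
split=> [cAw e e0|h B /nbhs_nrmP[e e0 eB]]; last first.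
  by have [u Au /eB Bu] := h _ e0; exists u.
have /cAw[u [Au /= ue]] : nbhs w [set u : vtop W | nrm ((u : W) - (w : W)) < e].
  by apply/nbhs_nrmP; exists e.
by exists u.
Qed.

Lemma closed_nrmP (A : set (vtop W)) :
  (forall w : W, (forall e : R, 0 < e -> exists2 u : W, A u & nrm (u - w) < e) -> A w) ->
  closed A.
Proof. by move=> h w /closure_nrmP /h. Qed.

Lemma nrm_near (w : vtop W) (e : R) : 0 < e ->
  \forall u \near w, nrm ((u : W) - (w : W)) < e.
Proof. by move=> e0; apply/nbhs_nrmP; exists e. Qed.

(** Heine-Borel: [W] carries the topology of a finite power of the plane, where
    boxes are compact. *)
Lemma compact_nrm (A : set (vtop W)) (r : R) :
  closed A -> (forall w : W, A w -> nrm w <= r) -> compact A.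
Proof.
move=> cA Ar.
pose box := [set M : 'rV[Cplx R]_(dim W) | forall i, cabs (M 0 i) <= r].
have boxK : compact box by apply: (@rV_compact _ _ (fun=> [set z | cabs z <= r])) => _;
  exact: disk_compact.
have r2vc : continuous (r2v : 'rV[Cplx R]_(dim W) -> vtop W).
  move=> M B [_ [[P oP <-] /= OM OB]].
  rewrite r2vK in OM.
  have : nbhs M P by exact: open_nbhs_nbhs.
  apply: (@filterS _ (nbhs M)) => M' OM'; apply: OB; rewrite /= r2vK //.
have K : compact ((r2v : _ -> vtop W) @` box).
  by apply: continuous_compact boxK; exact: continuous_subspaceT.
apply: (subclosed_compact cA K) => w /Ar wr; exists (v2r (w : W)); last exact: v2rK.
by move=> i; exact: le_trans (coo_le_nrm w i) wr.
Qed.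

Lemma closed_nrm_le (w0 : W) (r : R) : closed [set w : vtop W | nrm ((w : W) - w0) <= r].
Proof.
apply: closed_nrmP => w h /=; apply/ler_addgt0Pr => e e0.
have [u /= ur uw] := h _ e0.
by rewrite (le_trans (nrm_tri _ u _)) // addrC lerD // nrmC ltW.
Qed.

Lemma hausdorff_vtop : hausdorff_space (vtop W).
Proof.
move=> u v uv; apply/eqP/negPn/negP => neq.
have d0 : 0 < nrm ((u : W) - (v : W)) / 2 by rewrite divr_gt0 ?nrm_gt0 ?subr_eq0.
have [w [/= wu wv]] := uv _ _ (nrm_near u d0) (nrm_near v d0).
have := nrm_tri (u : W) w v; rewrite (nrmC u w) => h.
by have := le_lt_trans h (ltrD wu wv); rewrite -splitr ltxx.
Qed.

(** Domination of one series of increments by another makes the first converge;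
    compactness of balls replaces an appeal to completeness. *)
Lemma nrm_cauchy (u : nat -> W) (s : nat -> R) (l : R) :
  (forall n m, (n <= m)%N -> nrm (u m - u n) <= s m - s n) ->
  (forall m, s m <= l) ->
  exists w : W, forall n, nrm (w - u n) <= l - s n.
Proof.
move=> us sl.
pose B n := [set w : vtop W | nrm ((w : W) - u n) <= l - s n].
have tail n : ((u : nat -> vtop W) @ \oo) (B n).
  exists n => //= m /= nm; rewrite /B /=; apply: le_trans (us _ _ nm) _.
  by rewrite lerD2r sl.
have K : compact (B 0).
  apply: (@compact_nrm _ (nrm (u 0%N) + (l - s 0%N))) => [|w wB]; first exact: closed_nrm_le.
  by rewrite -(subrK (u 0%N) w) (le_trans (nrmD _ _)) // addrC lerD2l.
have [w [_ wcl]] := K ((u : nat -> vtop W) @ \oo) _ (tail 0%N).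
exists w => n; have := @closed_nrm_le (u n) (l - s n) w; apply.
by move=> O nO; exact: wcl (tail n) nO.
Qed.

(** Expand [w] in the standard basis; the values of [p] at the basis vectors
    bound it. Linear maps, coordinates and the adjoint are all covered. *)
Lemma seminorm_bounded (p : W -> R) :
  (forall u v, p (u + v) <= p u + p v) ->
  (forall c u, p (c *: u) = cabs c * p u) ->
  exists2 C : R, 0 < C & forall w, p w <= C * nrm w.
Proof.
move=> pD pZ; have p0 : p 0 = 0 by rewrite -(scale0r 0) pZ cabs0 mul0r.
have p_ge0 w : 0 <= p w.
  have := pD w (- w); rewrite subrr p0 -scaleN1r pZ cabsN cabs1 mul1r => h; lra.
exists (1 + \sum_i p (unitv i)).
  by rewrite ltr_pwDl // sumr_ge0.
move=> w; rewrite {1}(coo_sum w).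
apply: (@le_trans _ _ (\sum_i cabs (coo w i) * p (unitv i))).
  elim/big_rec2: _ => [|i y x _ le_xy]; first by rewrite p0.
  by rewrite (le_trans (pD _ _)) // pZ lerD2l.
rewrite mulrDl mul1r mulr_suml ler_wpDl ?nrm_ge0 // ler_sum // => i _.
by rewrite mulrC ler_wpM2l // coo_le_nrm.
Qed.

Lemma seminorm_continuous (p : W -> R) :
  (forall u v, p (u + v) <= p u + p v) ->
  (forall c u, p (c *: u) = cabs c * p u) ->
  forall z (e : R), 0 < e -> exists2 d : R, 0 < d & forall u, nrm (u - z) < d ->
    `|p u - p z| < e.
Proof.
move=> pD pZ z e e0; have [C C0 pC] := seminorm_bounded pD pZ.
exists (e / C) => [|u]; first by rewrite divr_gt0.
rewrite ltr_pdivlMr // mulrC => /(le_lt_trans (pC _)) h; apply: le_lt_trans h.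
have pN : p (z - u) = p (u - z) by rewrite -opprB -scaleN1r pZ cabsN cabs1 mul1r.
by have := pD (u - z) z; have := pD (z - u) u; rewrite pN !subrK ler_norml; lra.
Qed.

Lemma linear_bounded (W' : vectType (Cplx R)) (f : {linear W -> W'}) :
  exists2 C : R, 0 < C & forall w, nrm (f w) <= C * nrm w.
Proof.
apply: seminorm_bounded => [u v|c u]; first by rewrite linearD nrmD.
by rewrite linearZ nrmZ.
Qed.

End NormTopology.

Section EndNorm.
Context {R : realType} {V : vectType (Cplx R)}.
Implicit Types (A B : 'End(V)).

Let opsum A := \sum_i nrm (A (unitv i)).

Let le_opsum A v : nrm (A v) <= opsum A * nrm v.
Proof.
rewrite {1}(coo_sum v) linear_sum (le_trans (nrm_sum _ _ _)) // /opsum mulr_suml.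
by apply: ler_sum => i _; rewrite linearZ nrmZ mulrC ler_wpM2l ?nrm_ge0 ?coo_le_nrm.
Qed.

(** The sum of the norms of the images of the basis vectors is submultiplicative
    and equivalent to [nrm], because it bounds the matrix entries. *)
Lemma submultiplicative_scale : exists K : R, 1 <= K /\
  (forall A v, nrm (A v) <= K * nrm A * nrm v) /\
  (forall A B, nrm (A \o B)%VF <= K * nrm A * nrm B).
Proof.
have [C C0 opC] : exists2 C : R, 0 < C & forall A, opsum A <= C * nrm A.
  apply: seminorm_bounded => [A B|c A].
    by rewrite /opsum -big_split ler_sum // => i _; rewrite add_lfunE nrmD.
  by rewrite /opsum mulr_sumr; apply: eq_bigr => i _; rewrite scale_lfunE nrmZ.
pose E i j : 'End(V) := linfun (fun v => coo v i *: unitv j : V).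
have Elin i j : linear (fun v : V => coo v i *: unitv j : V).
  by move=> c u v; rewrite cooD cooZ scalerDl scalerA.
have EE i j v : E i j v = coo v i *: unitv j.
  pose L := GRing.isLinear.Build _ _ _ _ _ (Elin i j).
  pose f : {linear V -> V} := HB.pack (fun v : V => coo v i *: unitv j : V) L.
  exact: (lfunE f).
have decA A : A = \sum_i \sum_j coo (A (unitv i)) j *: E i j.
  apply/lfunP => v; rewrite {1}(coo_sum v) linear_sum sum_lfunE.
  apply: eq_bigr => i _; rewrite linearZ /= [X in _ *: X](coo_sum (A (unitv i))) scaler_sumr.
  rewrite sum_lfunE; apply: eq_bigr => j _.
  by rewrite scale_lfunE EE !scalerA mulrC.
pose D := \sum_i \sum_j nrm (E i j).
have D0 : 0 <= D by apply: sumr_ge0 => i _; apply: sumr_ge0 => j _; exact: nrm_ge0.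
have opD A : nrm A <= D * opsum A.
  rewrite {1}(decA A) (le_trans (nrm_sum _ _ _)) // /D mulr_suml ler_sum // => i _.
  rewrite (le_trans (nrm_sum _ _ _)) // mulr_suml ler_sum // => j _.
  rewrite nrmZ mulrC ler_wpM2l ?nrm_ge0 // /opsum (bigD1 i) //=.
  by rewrite (le_trans (coo_le_nrm _ _)) // lerDl sumr_ge0 // => k _; exact: nrm_ge0.
have os0 A : 0 <= opsum A by apply: sumr_ge0 => i _; exact: nrm_ge0.
exists (1 + C + D * C * C).
have [p1 p2] : 0 <= D * C * C /\ 0 <= C by rewrite !mulr_ge0 // ltW.
split; first by rewrite -addrA lerDl addr_ge0.
split=> [A v|A B].
  apply: le_trans (le_opsum _ _) _; rewrite ler_wpM2r ?nrm_ge0 //.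
  by rewrite (le_trans (opC A)) // ler_wpM2r ?nrm_ge0 //; lra.
apply: le_trans (opD _) _.
have h : opsum (A \o B)%VF <= opsum A * opsum B.
  rewrite /opsum [leRHS]mulr_sumr ler_sum // => i _.
  by rewrite comp_lfunE le_opsum.
apply: le_trans (_ : D * (C * nrm A * (C * nrm B)) <= _).
  rewrite ler_wpM2l // (le_trans h) // ler_pM ?opC //.
rewrite (_ : D * _ = D * C * C * (nrm A * nrm B)); last by ring.
by rewrite -[leRHS]mulrA ler_wpM2r ?mulr_ge0 ?nrm_ge0 //; lra.
Qed.

Definition opscale : R := sval (cid submultiplicative_scale).

(** Locked, lest unification unfold the coordinates. *)
Definition mnrm A : R := locked (opscale * nrm A).

Lemma mnrmE A : mnrm A = opscale * nrm A.
Proof. by rewrite /mnrm -lock. Qed.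

Lemma opscale_ge1 : 1 <= opscale.
Proof. by rewrite /opscale; case: cid => K []. Qed.

Lemma opscale_gt0 : 0 < opscale.
Proof. exact: lt_le_trans opscale_ge1. Qed.

Lemma nrm_lfun A v : nrm (A v) <= mnrm A * nrm v.
Proof. by rewrite mnrmE /opscale; case: cid => K [] /= _ []. Qed.

Lemma mnrmM A B : mnrm (A \o B)%VF <= mnrm A * mnrm B.
Proof.
have : nrm (A \o B)%VF <= opscale * nrm A * nrm B.
  by rewrite /opscale; case: cid => K [] /= _ [].
move=> h; rewrite !mnrmE (_ : opscale * nrm A * _ = opscale * (opscale * nrm A * nrm B)).
  by rewrite ler_wpM2l // ltW // opscale_gt0.
by ring.
Qed.

Lemma mnrm_ge0 A : 0 <= mnrm A.
Proof. by rewrite mnrmE mulr_ge0 ?nrm_ge0 // ltW // opscale_gt0. Qed.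

Lemma mnrm0 : mnrm 0 = 0. Proof. by rewrite !mnrmE nrm0 mulr0. Qed.

Lemma nrm_le_mnrm A : nrm A <= mnrm A.
Proof. by rewrite !mnrmE ler_peMl ?nrm_ge0 // opscale_ge1. Qed.

Lemma mnrm_eq0 A : (mnrm A == 0) = (A == 0).
Proof. by rewrite mnrmE mulf_eq0 nrm_eq0 gt_eqF ?opscale_gt0. Qed.

Lemma mnrm_gt0 A : (0 < mnrm A) = (A != 0).
Proof. by rewrite lt_def mnrm_ge0 andbT mnrm_eq0. Qed.

Lemma mnrmD A B : mnrm (A + B) <= mnrm A + mnrm B.
Proof. by rewrite !mnrmE -mulrDr ler_wpM2l ?nrmD // ltW // opscale_gt0. Qed.

Lemma mnrmZ c A : mnrm (c *: A) = cabs c * mnrm A.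
Proof. by rewrite !mnrmE nrmZ mulrCA. Qed.

Lemma mnrmN A : mnrm (- A) = mnrm A.
Proof. by rewrite !mnrmE nrmN. Qed.

Lemma mnrmC A B : mnrm (A - B) = mnrm (B - A).
Proof. by rewrite !mnrmE nrmC. Qed.

Lemma mnrmB A B : mnrm (A - B) <= mnrm A + mnrm B.
Proof. by rewrite (le_trans (mnrmD _ _)) // mnrmN. Qed.

Lemma mnrm_tri A B D : mnrm (A - D) <= mnrm (A - B) + mnrm (B - D).
Proof. by apply: le_trans (mnrmD _ _); rewrite addrA subrK. Qed.

Lemma mnrm_sum (I : Type) (s : seq I) (P : pred I) (F : I -> 'End(V)) :
  mnrm (\sum_(i <- s | P i) F i) <= \sum_(i <- s | P i) mnrm (F i).
Proof.
elim/big_rec2: _ => [|i y x _ le_xy]; first by rewrite mnrm0.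
by rewrite (le_trans (mnrmD _ _)) // lerD2l.
Qed.

Lemma mnrm_lt A (e : R) : (mnrm A < e) = (nrm A < e / opscale).
Proof. by rewrite mnrmE ltr_pdivlMr ?opscale_gt0 // mulrC. Qed.

Lemma mnrm_le A (e : R) : (mnrm A <= e) = (nrm A <= e / opscale).
Proof. by rewrite mnrmE ler_pdivlMr ?opscale_gt0 // mulrC. Qed.

Lemma nbhs_mnrmP (A : vtop 'End(V)) (B : set (vtop 'End(V))) :
  nbhs A B <-> exists2 e : R, 0 < e &
    forall A' : 'End(V), mnrm (A' - (A : 'End(V))) < e -> B A'.
Proof.
split=> [/nbhs_nrmP[e e0 eB]|[e e0 eB]].
  by exists e => // A' h; apply: eB; apply: le_lt_trans h; exact: nrm_le_mnrm.
apply/nbhs_nrmP; exists (e / opscale); first by rewrite divr_gt0 ?opscale_gt0.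
by move=> A'; rewrite -mnrm_lt; exact: eB.
Qed.

Lemma closure_mnrmP (S : set (vtop 'End(V))) (A : vtop 'End(V)) :
  closure S A <-> forall e : R, 0 < e -> exists2 B : 'End(V), S B & mnrm (B - (A : 'End(V))) < e.
Proof.
rewrite closure_nrmP; split=> h e e0.
  have [|B SB] := h (e / opscale); first by rewrite divr_gt0 ?opscale_gt0.
  by rewrite -mnrm_lt; exists B.
by have [B SB BA] := h _ e0; exists B => //; apply: le_lt_trans (nrm_le_mnrm _) BA.
Qed.

Lemma closed_mnrmP (S : set (vtop 'End(V))) :
  (forall A : 'End(V),
    (forall e : R, 0 < e -> exists2 B : 'End(V), S B & mnrm (B - A) < e) -> S A) ->
  closed S.
Proof. by move=> h A /closure_mnrmP /h. Qed.

Lemma compact_mnrm (S : set (vtop 'End(V))) (r : R) :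
  closed S -> (forall A : 'End(V), S A -> mnrm A <= r) -> compact S.
Proof.
move=> cS h; apply: (@compact_nrm _ _ _ r) => // A /h; exact: le_trans (nrm_le_mnrm _).
Qed.

Lemma hom_bounded (f : 'Hom('End(V), 'End(V))) :
  exists2 C : R, 0 < C & forall A, mnrm (f A) <= C * mnrm A.
Proof.
have [C C0 h] := linear_bounded f; exists C => // A.
by rewrite !mnrmE mulrCA; exact: (ler_wpM2l (ltW opscale_gt0) (h A)).
Qed.

End EndNorm.

(** * Exponential sums *)

Section RealExpSum.
Context {R : realType}.
Implicit Types (x y : R) (n : nat).

Definition rexp x n : R := \sum_(k < n) k`!%:R^-1 * x ^+ k.

Lemma rexpE x : rexp x = series (exp_coeff x).
Proof.
rewrite seriesEord funeqE => n /=; apply: eq_bigr => k _.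
by rewrite exp_coeffE.
Qed.

Lemma rexp_cvg x : rexp x n @[n --> \oo] --> expR x.
Proof. by rewrite rexpE /expR; exact: is_cvg_series_exp_coeff. Qed.

Lemma rexp_near (x e : R) : 0 < e -> exists N, forall n, (N <= n)%N ->
  `|expR x - rexp x n| < e.
Proof.
move=> e0; have /cvgrPdist_lt/(_ _ e0)[N _ h] := @rexp_cvg x.
by exists N => n Nn; exact: h.
Qed.

Lemma rexp_mono x n m : 0 <= x -> (n <= m)%N -> rexp x n <= rexp x m.
Proof.
move=> x0 /subnK <-; elim: (m - n)%N => [|k ih] //; rewrite addSn.
apply: le_trans ih _; rewrite /rexp big_ord_recr /= lerDl.
by rewrite mulr_ge0 ?invr_ge0 ?exprn_ge0.
Qed.

Lemma rexp_le x n : 0 <= x -> rexp x n <= expR x.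
Proof.
move=> x0; rewrite leNgt; apply/negP => h.
have := h; rewrite -subr_gt0 => /(@rexp_near x)[N hN].
have h1 := rexp_mono x0 (leq_maxr N n).
have := hN _ (leq_maxl N n); rewrite ltr_norml => /andP[h2 _]; lra.
Qed.

End RealExpSum.

Lemma triangle_sum (W : nmodType) (n : nat) (G : nat -> nat -> W) :
  \sum_(i < n) \sum_(j < n | (i + j < n)%N) G i j =
  \sum_(k < n) \sum_(i < k.+1) G i (k - i)%N.
Proof.
transitivity (\sum_(0 <= i < n) \sum_(0 <= k < n | (i <= k)%N) G i (k - i)%N).
  rewrite big_mkord; apply: eq_bigr => i _.
  rewrite -(big_mkord (fun j => (i + j < n)%N) (G i)).
  transitivity (\sum_(i <= k < n) G i (k - i)%N); last first.
    by rewrite (big_nat_widenl i 0 n).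
  rewrite (_ : \sum_(i <= k < n) _ = \sum_(0 + i <= k < n) G i (k - i)%N) // big_addn.
  rewrite [RHS](big_nat_widen 0 (n - i)%N n) ?leq_subr //.
  by apply: eq_big => [j|j _]; rewrite ?addnK // ltn_subRL.
rewrite (exchange_big_dep_nat xpredT) //= big_mkord; apply: eq_bigr => k _.
rewrite -(big_mkord xpredT (fun i => G i (k - i)%N)).
by rewrite [RHS](big_nat_widen 0 k.+1 n) ?ltn_ord.
Qed.

(** Cut the square of pairs [(i, j)] along [i + j = n]: the binomial formula sums
    the lower triangle, and the upper one is the error. For the error only a bound
    by the same sum with real exponents is needed, hence the arbitrary [F]. *)
Lemma cauchy_exp_sum (K : numFieldType) (W : lmodType K) (n : nat) (s t : K)
    (F : nat -> W) :
  \sum_(i < n) \sum_(j < n) (i`!%:R^-1 * s ^+ i * (j`!%:R^-1 * t ^+ j)) *: F (i + j)%N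
  = \sum_(k < n) (k`!%:R^-1 * (s + t) ^+ k) *: F k
  + \sum_(i < n) \sum_(j < n | (n <= i + j)%N)
      (i`!%:R^-1 * s ^+ i * (j`!%:R^-1 * t ^+ j)) *: F (i + j)%N.
Proof.
have fact0 k : k`!%:R != 0 :> K by rewrite pnatr_eq0 -lt0n fact_gt0.
have -> : \sum_(k < n) (k`!%:R^-1 * (s + t) ^+ k) *: F k =
  \sum_(i < n) \sum_(j < n | (i + j < n)%N)
     (i`!%:R^-1 * s ^+ i * (j`!%:R^-1 * t ^+ j)) *: F (i + j)%N.
  rewrite (triangle_sum n (fun i j =>
    (i`!%:R^-1 * s ^+ i * (j`!%:R^-1 * t ^+ j)) *: F (i + j)%N)); apply: eq_bigr => k _.
  rewrite addrC exprDn mulr_sumr scaler_suml; apply: eq_bigr => i _.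
  have ik : (i <= k)%N by rewrite -ltnS.
  rewrite subnKC //; congr (_ *: _).
  rewrite -mulr_natr; have := bin_fact ik => /(congr1 (fun m => m%:R : K)).
  rewrite !natrM => h; rewrite -h !invfM.
  have c0 : 'C(k, i)%:R != 0 :> K by rewrite pnatr_eq0 -lt0n bin_gt0.
  by field; rewrite c0 !fact0.
rewrite -big_split; apply: eq_bigr => i _ /=.
rewrite (bigID (fun j : 'I_n => (i + j < n)%N)) /=; congr (_ + _).
by apply: eq_bigl => j; rewrite -leqNgt.
Qed.

(** * The exponential of an endomorphism *)

Lemma cauchy_exp_sumR (K : numFieldType) (n : nat) (s t : K) :
  (\sum_(i < n) i`!%:R^-1 * s ^+ i) * (\sum_(j < n) j`!%:R^-1 * t ^+ j)
  = \sum_(k < n) k`!%:R^-1 * (s + t) ^+ k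
  + \sum_(i < n) \sum_(j < n | (n <= i + j)%N)
      i`!%:R^-1 * s ^+ i * (j`!%:R^-1 * t ^+ j).
Proof.
have mA (x : K) : x *: (1 : K^o) = x by rewrite /GRing.scale /= mulr1.
have h := @cauchy_exp_sum K K^o n s t (fun=> 1).
transitivity (\sum_(i < n) \sum_(j < n)
   (i`!%:R^-1 * s ^+ i * (j`!%:R^-1 * t ^+ j)) *: (1 : K^o)).
  rewrite mulr_suml; apply: eq_bigr => i _; rewrite mulr_sumr.
  by apply: eq_bigr => j _; rewrite mA.
rewrite h; congr (_ + _); first by apply: eq_bigr => k _; rewrite mA.
by apply: eq_bigr => i _; apply: eq_bigr => j _; rewrite mA.
Qed.

Section MatrixExponential.
Context {R : realType} {V : vectType (Cplx R)}.
Implicit Types (A B Y : 'End(V)) (n k : nat).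

Definition expS Y n : 'End(V) := \sum_(k < n) (k`!%:R : Cplx R)^-1 *: endo_pow Y k.

Let kappa : R := mnrm (\1%VF : 'End(V)).
Let kappa_ge0 : 0 <= kappa. Proof. exact: mnrm_ge0. Qed.

Lemma cabs_fact k : cabs ((k`!%:R : Cplx R)^-1) = k`!%:R^-1.
Proof. by rewrite cabsV -ofreal_nat cabs_ofreal normr_nat. Qed.

Lemma endo_powD Y i j : endo_pow Y (i + j) = (endo_pow Y i \o endo_pow Y j)%VF.
Proof.
by elim: i => [|i ih] /=; [rewrite comp_lfun1l | rewrite ih comp_lfunA].
Qed.

Lemma endo_powZ c Y k : endo_pow (c *: Y) k = c ^+ k *: endo_pow Y k.
Proof.
elim: k => [|k ih] /=; first by rewrite expr0 scale1r.
by rewrite ih -comp_lfunZl -comp_lfunZr scalerA exprS.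
Qed.

Lemma endo_pow_fix (U : {vspace V}) Y k v :
  (forall u, u \in U -> Y u \in U) -> v \in U -> endo_pow Y k v \in U.
Proof.
move=> YU vU; elim: k => [|k ih] /=; first by rewrite id_lfunE.
by rewrite comp_lfunE YU.
Qed.

Lemma endo_pow_eigen c Y k v : Y v = c *: v -> endo_pow Y k v = c ^+ k *: v.
Proof.
move=> Yv; elim: k => [|k ih] /=; first by rewrite id_lfunE expr0 scale1r.
by rewrite comp_lfunE ih linearZ /= Yv scalerA exprSr.
Qed.

Lemma mnrm_pow Y k y : mnrm Y <= y -> mnrm (endo_pow Y k) <= kappa * y ^+ k.
Proof.
move=> Yy; have y0 : 0 <= y by exact: le_trans (mnrm_ge0 _) Yy.
elim: k => [|k ih] /=; first by rewrite expr0 mulr1.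
apply: le_trans (mnrmM _ _) _; rewrite exprS mulrCA.
by apply: ler_pM; rewrite ?mnrm_ge0.
Qed.

Lemma expS_dist Y n m y : mnrm Y <= y -> (n <= m)%N ->
  mnrm (expS Y m - expS Y n) <= kappa * (rexp y m - rexp y n).
Proof.
move=> Yy; have y0 : 0 <= y by exact: le_trans (mnrm_ge0 _) Yy.
move=> /subnK <-; elim: (m - n)%N => [|k ih]; first by rewrite !subrr mnrm0 mulr0.
rewrite addSn /expS /rexp !big_ord_recr /= -!/(expS _ _) -!/(rexp _ _).
rewrite addrAC (le_trans (mnrmD _ _)) // (addrAC (rexp _ _)) mulrDr lerD //.
by rewrite mnrmZ cabs_fact mulrCA ler_wpM2l ?invr_ge0 // mnrm_pow.
Qed.

Lemma rexp_gap y (e : R) : 0 <= y -> 0 < e ->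
  exists N, forall n, (N <= n)%N -> kappa * (expR y - rexp y n) < e.
Proof.
move=> y0 e0; have k1 : 0 < kappa + 1 by rewrite ltr_wpDl.
have [N hN] := rexp_near y (divr_gt0 e0 k1); exists N => n /hN.
rewrite ger0_norm ?subr_ge0 ?rexp_le // ltr_pdivlMr //; apply: le_lt_trans.
by rewrite mulrC ler_wpM2l ?subr_ge0 ?rexp_le // lerDl.
Qed.

Lemma expm_tail Y n y : mnrm Y <= y ->
  mnrm (expm Y - expS Y n) <= kappa * (expR y - rexp y n).
Proof.
move=> Yy; have y0 : 0 <= y by exact: le_trans (mnrm_ge0 _) Yy.
have [E hE] : exists E : 'End(V), forall n, mnrm (E - expS Y n) <= kappa * (expR y - rexp y n).
  pose s n := kappa * rexp y n / (@opscale _ V).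
  have [i j ij|i|E hE] := @nrm_cauchy _ _ (expS Y) s (kappa * expR y / (@opscale _ V)).
  - rewrite /s -mulrBl -mulrBr ler_pdivlMr ?opscale_gt0 // mulrC -mnrmE.
    exact: expS_dist.
  - rewrite /s ler_pM2r ?invr_gt0 ?opscale_gt0 //.
    by rewrite ler_wpM2l // rexp_le.
  exists E => k; move: (hE k); rewrite mnrmE /s -mulrBl -mulrBr ler_pdivlMr ?opscale_gt0 //.
  by rewrite mulrC.
suff -> : expm Y = E by [].
apply: (@cvg_lim (vtop 'End(V))); first exact: hausdorff_vtop.
move=> B /nbhs_mnrmP[e e0 eB].
have [N hN] := rexp_gap y0 e0; exists N => // k /= Nk; apply: eB.
by rewrite mnrmC; exact: le_lt_trans (hE k) (hN k Nk).
Qed.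

Lemma expm_near Y (e : R) : 0 < e -> exists N, forall n, (N <= n)%N ->
  mnrm (expm Y - expS Y n) < e.
Proof.
move=> e0; have [N hN] := rexp_gap (mnrm_ge0 Y) e0; exists N => n Nn.
exact: le_lt_trans (expm_tail n (lexx _)) (hN n Nn).
Qed.

Lemma expm_unique Y E :
  (forall e : R, 0 < e -> exists N, forall n, (N <= n)%N -> mnrm (E - expS Y n) < e) ->
  expm Y = E.
Proof.
move=> h; apply/eqP; rewrite -subr_eq0 -mnrm_eq0 eq_le mnrm_ge0 andbT.
apply/ler_addgt0Pr => e e0; rewrite add0r.
have e20 : 0 < e / 2 by rewrite divr_gt0.
have [N1 h1] := h _ e20; have [N2 h2] := expm_near Y e20.
apply: le_trans (mnrm_tri _ (expS Y (maxn N1 N2)) _) _.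
by rewrite (splitr e) lerD // ?(mnrmC _ E) ltW // ?h1 ?h2 ?leq_maxl ?leq_maxr.
Qed.

(** Boundedness passes the identity of partial sums to the limit. Conjugation and
    the adjoint commute with the exponential for this reason. *)
Lemma expm_transfer (f : 'End(V) -> 'End(V)) (C : R) Y Z :
  (forall A B, f (A - B) = f A - f B) -> (forall A, mnrm (f A) <= C * mnrm A) ->
  (forall n, f (expS Y n) = expS Z n) -> f (expm Y) = expm Z.
Proof.
move=> fB fC fS; apply/esym/expm_unique => e e0.
have C1 : 0 < `|C| + 1 by rewrite ltr_wpDl.
have [N hN] := expm_near Y (divr_gt0 e0 C1).
exists N => n /hN; rewrite -fS -fB ltr_pdivlMr // => h.
apply: le_lt_trans (fC _) _; apply: le_lt_trans h; rewrite mulrC ler_wpM2l ?mnrm_ge0 //.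
by apply: le_trans (ler_norm _) _; rewrite lerDl.
Qed.

Lemma comp_lfun_suml (I : Type) (r : seq I) (P : pred I) (F : I -> 'End(V)) (g : 'End(V)) :
  ((\sum_(i <- r | P i) F i) \o g)%VF = \sum_(i <- r | P i) (F i \o g)%VF.
Proof.
by apply/lfunP => v; rewrite comp_lfunE !sum_lfunE; apply: eq_bigr => i _; rewrite comp_lfunE.
Qed.

Lemma comp_lfun_sumr (I : Type) (r : seq I) (P : pred I) (F : I -> 'End(V)) (g : 'End(V)) :
  (g \o (\sum_(i <- r | P i) F i))%VF = \sum_(i <- r | P i) (g \o F i)%VF.
Proof.
apply/lfunP => v; rewrite comp_lfunE !sum_lfunE linear_sum.
by apply: eq_bigr => i _; rewrite comp_lfunE.
Qed.

Lemma endo_pow_conj (g h Y : 'End(V)) k : (h \o g)%VF = \1%VF -> (g \o h)%VF = \1%VF ->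
  (g \o endo_pow Y k \o h)%VF = endo_pow (g \o Y \o h)%VF k.
Proof.
move=> hg gh; elim: k => [|k ih] /=; first by rewrite comp_lfun1r.
rewrite -ih -!comp_lfunA; congr (_ \o (_ \o _))%VF.
by rewrite !comp_lfunA hg comp_lfun1l.
Qed.

Lemma expm_conj (g h Y : 'End(V)) : (h \o g)%VF = \1%VF -> (g \o h)%VF = \1%VF ->
  (g \o expm Y \o h)%VF = expm (g \o Y \o h)%VF.
Proof.
move=> hg gh; apply: (@expm_transfer (fun A => g \o A \o h)%VF (mnrm g * mnrm h)).
- by move=> A B; rewrite comp_lfunDr comp_lfunNr comp_lfunDl comp_lfunNl.
- move=> A; apply: le_trans (mnrmM _ _) _; rewrite mulrAC ler_wpM2r ?mnrm_ge0 //.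
  exact: mnrmM.
move=> n; rewrite /expS comp_lfun_sumr comp_lfun_suml; apply: eq_bigr => k _.
by rewrite -comp_lfunZr -comp_lfunZl endo_pow_conj.
Qed.

Lemma expm_apply_near Y v (e : R) : 0 < e -> exists N, forall n, (N <= n)%N ->
  nrm (expm Y v - expS Y n v) < e.
Proof.
move=> e0; have v1 : 0 < nrm v + 1 by rewrite ltr_wpDl ?nrm_ge0.
have [N hN] := expm_near Y (divr_gt0 e0 v1); exists N => n /hN.
rewrite ltr_pdivlMr // => h; apply: le_lt_trans h.
rewrite -[_ - _](_ : (expm Y - expS Y n) v = _); last by rewrite add_lfunE opp_lfunE.
by apply: le_trans (nrm_lfun _ _) _; rewrite ler_wpM2l ?mnrm_ge0 // lerDl.
Qed.

Lemma expS_apply Y n v :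
  expS Y n v = \sum_(k < n) (k`!%:R : Cplx R)^-1 *: endo_pow Y k v.
Proof. by rewrite /expS sum_lfunE; apply: eq_bigr => k _; rewrite scale_lfunE. Qed.

(** A subspace is the kernel of a bounded projection. *)
Lemma vspace_closed (U : {vspace V}) (w : V) :
  (forall e : R, 0 < e -> exists2 u, u \in U & nrm (w - u) < e) -> w \in U.
Proof.
move=> h; pose p : 'End(V) := \1%VF - projv U.
have pU u : u \in U -> p u = 0.
  by move=> uU; rewrite /p add_lfunE opp_lfunE id_lfunE projv_id // subrr.
suff : p w = 0.
  rewrite /p add_lfunE opp_lfunE id_lfunE => /eqP; rewrite subr_eq0 => /eqP ->.
  exact: memv_proj.
apply/eqP; rewrite -nrm_eq0 eq_le nrm_ge0 andbT; apply/ler_addgt0Pr => e e0.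
have C1 : 0 < mnrm p + 1 by rewrite ltr_wpDl ?mnrm_ge0.
have [u uU] := h _ (divr_gt0 e0 C1); rewrite ltr_pdivlMr // => wu.
rewrite add0r -(subr0 (p w)) -(pU u uU) -linearB /=.
apply: le_trans (nrm_lfun _ _) _; apply: ltW; apply: le_lt_trans wu.
by rewrite mulrC ler_wpM2l ?nrm_ge0 // lerDl.
Qed.

Lemma expm_stable (U : {vspace V}) Y v :
  (forall u, u \in U -> Y u \in U) -> v \in U -> expm Y v \in U.
Proof.
move=> YU vU; apply: vspace_closed => e e0.
have [N /(_ N (leqnn N)) hN] := expm_apply_near Y v e0.
exists (expS Y N v) => //; rewrite expS_apply rpred_sum // => k _.
by rewrite rpredZ // endo_pow_fix.
Qed.

Lemma expm_eigen (r : R) Y v : Y v = ofreal r *: v -> expm Y v = ofreal (expR r) *: v.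
Proof.
move=> Yv; apply/eqP; rewrite -subr_eq0 -nrm_eq0 eq_le nrm_ge0 andbT.
apply/ler_addgt0Pr => e e0; rewrite add0r.
have v1 : 0 < nrm v + 1 by rewrite ltr_wpDl ?nrm_ge0.
have e20 : 0 < e / 2 by rewrite divr_gt0.
have [N1 h1] := expm_apply_near Y v e20.
have [N2 h2] := rexp_near r (divr_gt0 e20 v1).
pose n := maxn N1 N2; have eS : expS Y n v = ofreal (rexp r n) *: v.
  rewrite expS_apply /rexp /ofreal rmorph_sum scaler_suml; apply: eq_bigr => k _ /=.
  by rewrite (endo_pow_eigen _ Yv) scalerA -/(ofreal _) ofrealM ofrealV ofreal_nat ofrealX.
apply: le_trans (nrm_tri _ (expS Y n v) _) _; rewrite (splitr e) lerD //.
  by rewrite ltW // h1 // leq_maxl.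
have := h2 n (leq_maxr _ _); rewrite ltr_pdivlMr // => h.
rewrite eS -scalerBl -ofrealN -ofrealD nrmZ cabs_ofreal distrC.
by apply: ltW; apply: le_lt_trans h; rewrite ler_wpM2l // lerDl.
Qed.

Lemma expm_dominated Y E (r : nat -> R) :
  (forall n, mnrm (E - expS Y n) <= r n) -> r n @[n --> \oo] --> (0 : R) -> expm Y = E.
Proof.
move=> h r0; apply: expm_unique => e e0.
have /cvgrPdist_lt/(_ _ e0)[N _ hN] := r0.
exists N => n Nn; apply: le_lt_trans (h n) _; have := hN n Nn.
by rewrite sub0r normrN => /=; exact: le_lt_trans (ler_norm _).
Qed.

Lemma expm0 : expm (0 : 'End(V)) = \1%VF.
Proof.
apply/lfunP => v; rewrite (@expm_eigen 0) ?zero_lfunE ?ofreal0 ?scale0r //.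
by rewrite expR0 ofreal1 scale1r id_lfunE.
Qed.

Lemma mnrm_expS Y n y : mnrm Y <= y -> mnrm (expS Y n) <= kappa * expR y.
Proof.
move=> Yy; have y0 : 0 <= y by exact: le_trans (mnrm_ge0 _) Yy.
have := expS_dist Yy (leq0n n).
rewrite /expS big_ord0 -/(expS _ _) subr0 /rexp big_ord0 subr0 -/(rexp _ _) => h.
by apply: le_trans h _; rewrite ler_wpM2l // rexp_le.
Qed.

(** The remainder of the product of partial sums is dominated, term by term, by
    the remainder for the scalars [a] and [b] below, which vanishes in the limit
    since the real exponential is multiplicative. *)
Lemma expm_scaleD (s t : R) Y :
  expm (ofreal (s + t) *: Y) = (expm (ofreal s *: Y) \o expm (ofreal t *: Y))%VF.
Proof.
pose y := mnrm Y; pose a := `|s| * y; pose b := `|t| * y.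
have y0 : 0 <= y by exact: mnrm_ge0.
have na : mnrm (ofreal s *: Y) <= a by rewrite mnrmZ cabs_ofreal.
have nb : mnrm (ofreal t *: Y) <= b by rewrite mnrmZ cabs_ofreal.
set E := expm (ofreal s *: Y); set F := expm (ofreal t *: Y).
pose r n := kappa * (expR a - rexp a n) * mnrm F +
  kappa * expR a * (kappa * (expR b - rexp b n)) +
  kappa * (rexp a n * rexp b n - rexp (a + b) n).
apply: (@expm_dominated _ _ r); last first.
  rewrite (_ : 0 = kappa * (expR a - expR a) * mnrm F +
    kappa * expR a * (kappa * (expR b - expR b)) +
    kappa * (expR a * expR b - expR (a + b))); last first.
    by rewrite expRD; ring.
  apply: cvgD; first apply: cvgD.
  - apply: cvgM; last exact: cvg_cst.
    by apply: cvgM; [exact: cvg_cst|apply: cvgB; [exact: cvg_cst|exact: rexp_cvg]].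
  - apply: cvgM; first exact: cvg_cst.
    by apply: cvgM; [exact: cvg_cst|apply: cvgB; [exact: cvg_cst|exact: rexp_cvg]].
  - apply: cvgM; first exact: cvg_cst.
    by apply: cvgB; [apply: cvgM|]; exact: rexp_cvg.
move=> n; set S := expS (ofreal s *: Y) n; set T := expS (ofreal t *: Y) n.
set P := expS _ n.
have -> : (E \o F)%VF - P = ((E - S) \o F)%VF + (S \o (F - T))%VF + ((S \o T)%VF - P).
  rewrite comp_lfunDl comp_lfunNl comp_lfunDr comp_lfunNr.
  by rewrite !addrA !subrK.
apply: le_trans (mnrmD _ _) _; apply: lerD.
  apply: le_trans (mnrmD _ _) _; apply: lerD; apply: le_trans (mnrmM _ _) _.
    by rewrite ler_wpM2r ?mnrm_ge0 // expm_tail.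
  by apply: ler_pM; rewrite ?mnrm_ge0 ?mnrm_expS ?expm_tail.
have -> : (S \o T)%VF = \sum_(i < n) \sum_(j < n)
    (i`!%:R^-1 * (ofreal s) ^+ i * (j`!%:R^-1 * (ofreal t) ^+ j)) *: endo_pow Y (i + j)%N.
  rewrite /S /expS comp_lfun_suml; apply: eq_bigr => i _.
  rewrite /T /expS comp_lfun_sumr; apply: eq_bigr => j _.
  by rewrite !endo_powZ !scalerA -comp_lfunZl -comp_lfunZr scalerA endo_powD.
rewrite cauchy_exp_sum addrAC -ofrealD.
have -> : \sum_(k < n) (k`!%:R^-1 * ofreal (s + t) ^+ k) *: endo_pow Y k = P.
  by apply: eq_bigr => k _; rewrite endo_powZ scalerA.
rewrite subrr add0r.
have -> : rexp a n * rexp b n - rexp (a + b) n =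
  \sum_(i < n) \sum_(j < n | (n <= i + j)%N)
    (i`!%:R^-1 * a ^+ i * (j`!%:R^-1 * b ^+ j)).
  by rewrite cauchy_exp_sumR addrAC subrr add0r.
rewrite mulr_sumr; apply: le_trans (mnrm_sum _ _ _) _; apply: ler_sum => i _.
rewrite mulr_sumr; apply: le_trans (mnrm_sum _ _ _) _; apply: ler_sum => j _.
rewrite mnrmZ !cabsM !cabs_fact -!ofrealX !cabs_ofreal !normrX.
rewrite (_ : kappa * _ = i`!%:R^-1 * `|s| ^+ i * (j`!%:R^-1 * `|t| ^+ j) * (kappa * y ^+ (i + j))).
  by rewrite ler_wpM2l ?mulr_ge0 ?invr_ge0 ?exprn_ge0 // mnrm_pow.
by rewrite /a /b !exprMn exprD; ring.
Qed.

Lemma expmVl Y : (expm (- Y) \o expm Y)%VF = \1%VF.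
Proof.
have := expm_scaleD (- 1) 1 Y.
by rewrite ofrealN ofreal1 scaleN1r scale1r addNr ofreal0 scale0r expm0.
Qed.

Lemma expmVr Y : (expm Y \o expm (- Y))%VF = \1%VF.
Proof. by have := expmVl (- Y); rewrite opprK. Qed.

Lemma expm_GL Y : GL (expm Y).
Proof.
apply/lker0P => u v /(congr1 (expm (- Y))).
by rewrite -!comp_lfunE expmVl !id_lfunE.
Qed.

Lemma expm_inv Y : (expm Y)^-1%VF = expm (- Y).
Proof.
rewrite -[LHS]comp_lfun1r -(expmVr Y) comp_lfunA lker0_compVf ?comp_lfun1l //.
exact: expm_GL.
Qed.

Lemma expm_natmul Y k : expm (ofreal k%:R *: Y) = endo_pow (expm Y) k.
Proof.
elim: k => [|k ih] /=; first by rewrite ofreal0 scale0r expm0.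
by rewrite -[k.+1]addn1 natrD addrC expm_scaleD ih ofreal1 scale1r.
Qed.

(** The terms of degrees 0 and 1 cancel, and the difference of the [k]-th powers
    is at most [k * y ^ (k - 1)] times [mnrm (A - B)]. The factor [expR y - 1] is
    small with [y], so the exponential has a strict derivative at [0]. *)
Lemma expm_lipschitz A B y : mnrm A <= y -> mnrm B <= y ->
  mnrm (expm A - expm B - (A - B)) <= kappa * (expR y - 1) * mnrm (A - B).
Proof.
move=> Ay By; have y0 : 0 <= y by exact: le_trans (mnrm_ge0 _) Ay.
set d := mnrm (A - B); have d0 : 0 <= d by exact: mnrm_ge0.
have powB k : mnrm (endo_pow A k.+1 - endo_pow B k.+1) <= kappa * k.+1%:R * y ^+ k * d.
  elim: k => [|k ih].
    rewrite /= !comp_lfun1r expr0 !mulr1 -/d.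
    have : mnrm ((A - B) \o \1)%VF <= d * kappa by exact: mnrmM.
    by rewrite comp_lfun1r mulrC.
  rewrite [endo_pow A _]/= [endo_pow B _]/= -/(endo_pow A k.+1) -/(endo_pow B k.+1).
  have -> : (A \o endo_pow A k.+1)%VF - (B \o endo_pow B k.+1)%VF =
    (A \o (endo_pow A k.+1 - endo_pow B k.+1))%VF + ((A - B) \o endo_pow B k.+1)%VF.
    by rewrite comp_lfunDr comp_lfunNr comp_lfunDl comp_lfunNl addrA subrK.
  apply: le_trans (mnrmD _ _) _.
  rewrite [leRHS](_ : _ = y * (kappa * k.+1%:R * y ^+ k * d) + d * (kappa * y ^+ k.+1)).
    apply: lerD; apply: le_trans (mnrmM _ _) _.
      by apply: ler_pM; rewrite ?mnrm_ge0.
    by rewrite ler_wpM2l // mnrm_pow.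
  by rewrite -[k.+2]addn1 natrD !exprS; ring.
have tail n : mnrm (expS A n.+2 - expS B n.+2 - (A - B)) <= kappa * (expR y - 1) * d.
  have -> : expS A n.+2 - expS B n.+2 - (A - B) =
    \sum_(k < n) (k.+2`!%:R : Cplx R)^-1 *: (endo_pow A k.+2 - endo_pow B k.+2).
    rewrite /expS !big_ord_recl /= !comp_lfun1r !invr1 !scale1r.
    under [RHS]eq_bigr do rewrite scalerBr.
    rewrite sumrB (addrC \1%VF) (addrC \1%VF) opprD addrACA subrr addr0.
    by apply/eqP; rewrite subr_eq [eqbRHS]addrACA -opprD (addrC A) (addrC B).
  apply: le_trans (mnrm_sum _ _ _) _.
  apply: (@le_trans _ _ (kappa * (rexp y n.+1 - 1) * d)); last first.
    by rewrite ler_wpM2r // ler_wpM2l // lerB // rexp_le.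
  rewrite /rexp big_ord_recl expr0 mulr1 invr1 addrAC subrr add0r mulr_sumr mulr_suml.
  apply: ler_sum => k _; rewrite mnrmZ cabs_fact /= /bump leq0n add1n.
  rewrite [leRHS](_ : _ = k.+2`!%:R^-1 * (kappa * k.+2%:R * y ^+ k.+1 * d)).
    by rewrite ler_wpM2l ?invr_ge0 //; exact: (powB k.+1).
  rewrite [in RHS]factS natrM; field.
  by rewrite -natrD !pnatr_eq0 -lt0n fact_gt0.
apply/ler_addgt0Pr => e e0; have e20 : 0 < e / 2 by rewrite divr_gt0.
have [N1 h1] := expm_near A e20; have [N2 h2] := expm_near B e20.
pose n := maxn N1 N2; have l1 : (N1 <= n.+2)%N by rewrite !leqW // leq_maxl.
have l2 : (N2 <= n.+2)%N by rewrite !leqW // leq_maxr.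
have -> : expm A - expm B - (A - B) = (expm A - expS A n.+2) - (expm B - expS B n.+2)
   + (expS A n.+2 - expS B n.+2 - (A - B)).
  rewrite [RHS]addrA; congr (_ - _); rewrite opprB [RHS]addrAC.
  by rewrite [RHS]addrA [X in _ = X + _ - _]addrA !subrK.
apply: le_trans (mnrmD _ _) _; rewrite [leRHS]addrC; apply: lerD; last exact: tail.
rewrite (splitr e); apply: le_trans (mnrmB _ _) _.
by apply: lerD; apply: ltW; [exact: h1|exact: h2].
Qed.

End MatrixExponential.

(** * Gradient-like flows *)

Section GradientLikeFlows.
Context {R : realType} {T : topologicalType}.
Implicit Types (phi : R -> T -> T) (f : T -> R) (U L C : set T) (p q x z : T).

Definition restset phi : set T := [set x | forall t, phi t x = x].

Definition stable phi p : set T := [set x | phi t x @[t --> +oo] --> p].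

Definition unstable phi p : set T := stable (reversed phi) p.

Definition linked phi p q : Prop := exists z, unstable phi p z /\ stable phi q z.

Record gradient_like phi f : Prop := GradientLike {
  gl_compact : compact [set: T];
  gl_hausdorff : hausdorff_space T;
  gl_0 : forall x, phi 0 x = x;
  gl_D : forall s t x, phi (s + t) x = phi s (phi t x);
  gl_continuous : continuous (fun u : R * T => phi u.1 u.2);
  gl_lyapunov_continuous : continuous f;
  gl_lyapunov : forall x t, 0 < t -> ~ restset phi x -> f x < f (phi t x);
  gl_forward : forall x, exists2 p, restset phi p & stable phi p x;
  gl_backward : forall x, exists2 p, restset phi p & unstable phi p x }.

Arguments gl_continuous [phi f] _ _ _ _.
Arguments gl_lyapunov_continuous [phi f] _ _ _ _.
Arguments gl_lyapunov [phi f] _ [x t] _ _.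

(** The two implications hold when [p] has a neighbourhood that the stable and
    unstable sets of [p] cut as a product. One neighbourhood serves all [q]: this
    uniformity lets links survive limits of trajectories. *)
Definition locally_linked phi : Prop := forall p, restset phi p ->
  exists2 W, nbhs p W & forall q z, restset phi q -> W z ->
    (stable phi q z -> linked phi p q) /\ (unstable phi q z -> linked phi q p).

Lemma reversedK phi : reversed (reversed phi) = phi.
Proof. by apply/funext => t; rewrite /reversed opprK. Qed.

Lemma restset_reversed phi : restset (reversed phi) = restset phi.
Proof.
by apply/seteqP; split => x h t; [rewrite -(opprK t)|]; exact: h.
Qed.

Lemma linked_reversed phi p q : linked (reversed phi) p q <-> linked phi q p.
Proof.
rewrite /linked /unstable reversedK.
by split => -[z [? ?]]; exists z.
Qed.

Lemma gradient_like_reversed phi f :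
  gradient_like phi f -> gradient_like (reversed phi) (fun x => - f x).
Proof.
case=> co ha p0 pD pc fc fl fw bw; split => //.
- by move=> x; rewrite /reversed oppr0.
- by move=> s t x; rewrite /reversed opprD pD.
- move=> u; apply: (@continuous2_cvg _ _ _ _ (nbhs u) _ (fun v => - v.1) snd phi (- u.1) u.2);
    first exact: (pc (- u.1, u.2)).
    by apply: cvgN; exact: cvg_fst.
  exact: cvg_snd.
- by move=> x; apply: cvgN; exact: fc.
- move=> x t t0; rewrite restset_reversed => nx; rewrite ltrN2 /reversed.
  rewrite -[X in _ < f X](p0 x) -(subrr t) pD; apply: fl => // fx; apply: nx.
  suff -> : x = phi (- t) x by [].
  by rewrite -[LHS](p0 x) -(subrr t) pD fx.
- by rewrite restset_reversed.
- by rewrite restset_reversed /unstable reversedK.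
Qed.

Lemma locally_linked_reversed phi : locally_linked phi -> locally_linked (reversed phi).
Proof.
move=> h p; rewrite restset_reversed => /h[W pW hW]; exists W => // q z fq Wz.
have [h1 h2] := hW q z fq Wz; rewrite /unstable reversedK; split => s.
  by apply/linked_reversed; exact: h2.
by apply/linked_reversed; exact: h1.
Qed.

Section Fixed.
Variables (phi : R -> T -> T) (f : T -> R).
Hypothesis glf : gradient_like phi f.

Let phi0 := gl_0 glf.
Let phiD := gl_D glf.

Lemma flowK t : cancel (phi t) (phi (- t)).
Proof. by move=> x; rewrite -phiD addNr phi0. Qed.

Lemma flowNK t : cancel (phi (- t)) (phi t).
Proof. by move=> x; rewrite -phiD subrr phi0. Qed.

Lemma flow_continuous t : continuous (phi t).
Proof.
move=> x; apply: (@continuous2_cvg _ _ _ _ (nbhs x) _ (fun=> t) id phi t x).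
- exact: (gl_continuous glf (t, x)).
- exact: cvg_cst.
- exact: cvg_id.
Qed.

Lemma stable_near p x (B : set T) : stable phi p x -> nbhs p B ->
  exists2 t0 : R, 0 <= t0 & forall t : R, t0 <= t -> B (phi t x).
Proof.
move=> px /px [M [_ hM]]; exists (Num.max 0 (M + 1)); first by rewrite le_max lexx.
move=> t; rewrite ge_max => /andP[_ Mt]; apply: hM; lra.
Qed.

Lemma stable_fix p : restset phi p -> stable phi p p.
Proof.
move=> fp; rewrite /stable /= (_ : phi ^~ p = fun=> p); first exact: cvg_cst.
by apply/funext => t; exact: fp.
Qed.

Lemma stable_shift p s x : stable phi p x -> stable phi p (phi s x).
Proof.
move=> px B /(stable_near px)[t0 t00 h]; exists (t0 - s); split; first exact: num_real.
by move=> t ts; rewrite /= -phiD; apply: h; lra.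
Qed.

Lemma stable_uniq p q x : stable phi p x -> stable phi q x -> p = q.
Proof. by move=> px qx; apply: (cvg_unique (gl_hausdorff glf) px qx). Qed.

Lemma stable_closed C p x : closed C -> (forall t : R, 0 <= t -> C (phi t x)) ->
  stable phi p x -> C p.
Proof.
move=> cC h px; apply: cC => B /(stable_near px)[t0 t00 ht].
by exists (phi t0 x); split; [exact: h|exact: ht].
Qed.

Lemma compact_of_closed C : closed C -> compact C.
Proof. by move=> cC; apply: (subclosed_compact cC (gl_compact glf)). Qed.

(** The tube lemma for a compact piece of trajectory. *)
Lemma tube x (a b : R) (B : set T) :
  (forall s, a <= s <= b -> nbhs (phi s x) B) ->
  \forall y \near x, forall s, a <= s <= b -> B (phi s y).
Proof.
move=> h; have /compact_near_coveringP cov := @segment_compact R a b.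
have := cov T (nbhs x) (fun y s => B (phi s y)) (nbhs_filter x).
have h' : forall s, `[a, b]%classic s -> \forall s' \near s & y \near x, B (phi s' y).
  move=> s; rewrite /= in_itv /= => /h; exact: (gl_continuous glf (s, x)).
move=> /(_ h'); apply: filterS => y hy s sab; apply: hy; rewrite /= in_itv; exact: sab.
Qed.

Lemma lyapunov_bounded : exists2 C : R, 0 < C & forall x, `|f x| <= C.
Proof.
have /compact_near_coveringP cov := gl_compact glf.
have := cov R +oo%R (fun t x => `|f x| <= t) (@proper_pinfty_nbhs R).
have h : forall x, [set: T] x -> \forall x' \near x & t \near +oo, `|f x'| <= t.
  move=> x _; have /cvgr_dist_lt/(_ _ ltr01) fx := gl_lyapunov_continuous glf x.
  exists ([set x' | `|f x - f x'| < 1], [set t | `|f x| + 1 < t]) => /=.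
    by split; [exact: fx|exists (`|f x| + 1); split; [exact: num_real|]].
  move=> [x' t] /= [h1 h2]; rewrite -[f x'](subKr (f x)).
  by apply: le_trans (ler_normB _ _) _; lra.
move=> /(_ h) [M [_ hM]]; exists (Num.max 1 (M + 1)); first by rewrite lt_max ltr01.
by move=> x; apply: (hM (Num.max 1 (M + 1))) => //; rewrite lt_max; apply/orP; right; lra.
Qed.

End Fixed.

Lemma unstable_near phi f p x (B : set T) : gradient_like phi f ->
  unstable phi p x -> nbhs p B ->
  exists2 t0 : R, 0 <= t0 & forall t : R, t0 <= t -> B (phi (- t) x).
Proof. by move=> _; exact: stable_near. Qed.

(** A homoclinic trajectory would start and end near the same value of [f], along
    which it gains at least [f (phi 1 x) - f x > 0]. *)
Lemma stable_unstable_fix phi f p x : gradient_like phi f -> restset phi p ->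
  stable phi p x -> unstable phi p x -> x = p.
Proof.
move=> glf fp sx ux.
have [fx|nfx] := pselect (restset phi x).
  by apply: (stable_uniq glf) sx; exact: stable_fix.
have fphi t : 0 < t -> f x < f (phi t x) by move=> t0; exact: (gl_lyapunov glf t0 nfx).
have mono y t : 0 <= t -> f y <= f (phi t y).
  rewrite le_eqVlt => /predU1P[<-|t0]; first by rewrite (gl_0 glf).
  have [fy|nfy] := pselect (restset phi y); first by rewrite fy.
  exact: ltW (gl_lyapunov glf t0 nfy).
pose d := f (phi 1 x) - f x; have d0 : 0 < d by rewrite subr_gt0 fphi.
have nb : nbhs p [set y | `|f p - f y| < d / 2].
  have /cvgr_dist_lt/(_ (d / 2)) := gl_lyapunov_continuous glf p.
  by apply; rewrite divr_gt0.
have [t1 t10 /(_ (t1 + 1))] := stable_near sx nb.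
have [t2 t20 /(_ t2 (lexx _))] := unstable_near glf ux nb.
move=> /= h2 h1; have {h1} := h1 ltac:(by rewrite lerDl).
rewrite (gl_D glf) => h1.
have m1 : f (phi 1 x) <= f (phi t1 (phi 1 x)) by exact: mono.
have m2 : f (phi (- t2) x) <= f x by rewrite -{2}(flowNK glf t2 x); exact: mono.
by exfalso; move: h1 h2; rewrite !ltr_norml /d => /andP[? ?] /andP[? ?]; lra.
Qed.

End GradientLikeFlows.

Arguments gl_continuous {R T phi f} _ _ _ _.
Arguments gl_lyapunov_continuous {R T phi f} _ _ _ _.
Arguments gl_lyapunov {R T phi f} _ {x t} _ _.

(** * Attractors of a gradient-like flow *)

Section AttractorLattice.
Context {R : realType} {T : topologicalType}.
Implicit Types (phi : R -> T -> T) (f : T -> R) (U L C : set T) (p q x z : T).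

Definition unstable_hull phi U : set T := \bigcup_(p in U) unstable phi p.

Definition stable_hull phi U : set T := \bigcup_(p in U) stable phi p.

Lemma unstable_hull_reversed phi U : unstable_hull (reversed phi) U = stable_hull phi U.
Proof. by rewrite /unstable_hull /unstable reversedK. Qed.

Section Hulls.
Variables (phi : R -> T -> T) (f : T -> R).
Hypothesis glf : gradient_like phi f.
Hypothesis loc : locally_linked phi.
Let F := restset phi.
Let phi0 := gl_0 glf.
Let phiD := gl_D glf.

Lemma unstable_shift p s x : unstable phi p x -> unstable phi p (phi s x).
Proof.
by move=> ux; rewrite -(opprK s); exact: (stable_shift (gradient_like_reversed glf) _ ux).
Qed.

Lemma unstable_fix p : F p -> unstable phi p p.
Proof. by move=> fp; apply: stable_fix; rewrite restset_reversed. Qed.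

Lemma unstable_uniq p q x : unstable phi p x -> unstable phi q x -> p = q.
Proof. exact: (stable_uniq (gradient_like_reversed glf)). Qed.

Lemma unstable_closed C p x : closed C -> (forall t : R, 0 <= t -> C (phi (- t) x)) ->
  unstable phi p x -> C p.
Proof. exact: stable_closed. Qed.

Section UpperSet.
Variable (U : set T).
Hypothesis upU : upper_set F (linked phi) U.
Let A := unstable_hull phi U.
Let L := F `\` U.
Let Rp := stable_hull phi L.
Let UF : U `<=` F := proj1 upU.

Lemma sub_unstable_hull : U `<=` A.
Proof. by move=> p Up; exists p => //; apply: unstable_fix; exact: UF. Qed.

(** A limit point [z] lies in the unstable set of some rest point [y]. Near [y],
    backward images of nearby points of the hull give a link from [U] to [y]. *)
Lemma closed_unstable_hull : closed A.
Proof.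
move=> z clz; have [y fy uy] := gl_backward glf z; exists y => //.
have [W yW hW] := loc fy.
have [t t0 /(_ t (lexx _)) Wt] := unstable_near glf uy (nbhs_interior yW).
have : nbhs z (phi (- t) @^-1` W) by exact: (flow_continuous glf (x := z) Wt).
move=> /clz[z' [[x Ux ux] Wz']].
have [_ lk] := hW x _ (UF Ux) Wz'.
by apply: upU.2 Ux fy (lk _); exact: unstable_shift.
Qed.

Lemma hull_disjoint x : A x -> ~ Rp x.
Proof.
move=> [p Up up] [q [Fq nUq] sq]; apply: nUq; apply: upU.2 Up Fq _.
by exists x.
Qed.

Lemma unstable_hull_flow s x : A x -> A (phi s x).
Proof. by move=> [p Up up]; exists p => //; exact: unstable_shift. Qed.

Lemma backward_in_closed C z : closed C -> (forall x, C x -> ~ Rp x) ->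
  (forall t : R, 0 <= t -> C (phi (- t) z)) -> A z.
Proof.
move=> cC CR h; have [q Fq uq] := gl_backward glf z; exists q => //.
apply: contrapT => nUq; apply: (CR q); first exact: (unstable_closed cC h).
by exists q; [split|exact: stable_fix].
Qed.

Lemma forward_in_upper x : ~ Rp x -> exists2 p, U p & stable phi p x.
Proof.
move=> nRx; have [p Fp sp] := gl_forward glf x; exists p => //.
by apply: contrapT => nUp; apply: nRx; exists p.
Qed.

Section Block.
Variable V0 : set T.
Hypothesis V0_closed : closed V0.
Hypothesis V0_nbhs : forall x, A x -> nbhs x V0.
Hypothesis V0_disj : forall x, V0 x -> ~ Rp x.

Let K (t : R) := [set x | forall s : R, 0 <= s <= t -> V0 (phi (- s) x)].

Let K_sub t : 0 <= t -> K t `<=` V0.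
Proof. by move=> t0 x /(_ 0); rewrite oppr0 phi0; apply; rewrite lexx. Qed.

Let K_closed t : closed (K t).
Proof.
move=> x clx s st; apply: V0_closed => B nB.
have /clx[y [Ky By]] : nbhs x (phi (- s) @^-1` B).
  exact: (flow_continuous glf (x := x) nB).
by exists (phi (- s) y); split => //; exact: Ky.
Qed.

Let K_nbhs t x : A x -> nbhs x (K t).
Proof.
move=> Ax; have := @tube R T phi f glf x (- t) 0 V0.
move=> /(_ (fun s _ => V0_nbhs (unstable_hull_flow s Ax))).
by apply: filterS => y hy s /andP[s0 st]; apply: hy; rewrite lerN2 st oppr_le0.
Qed.

(* A point outside the hull leaves [V0] in backward time, for otherwise its
   backward limit would be a rest point of [V0] outside [U]. By compactness one
   time [t] works for all points outside the interior of [V0]. *)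
Let K_interior : exists2 t : R, 0 <= t & K t `<=` V0°.
Proof.
have /compact_near_coveringP cov := gl_compact glf.
have := cov R +oo%R (fun t x => K t x -> V0° x) (@proper_pinfty_nbhs R).
have h x : [set: T] x -> \forall x' \near x & t \near +oo%R, (K t x' -> V0° x').
  move=> _; have [Ax|nAx] := pselect (A x).
    have nV : nbhs x V0° by apply: nbhs_interior; exact: V0_nbhs.
    exists (V0°, setT); first by split => //; exact: filterT.
    by move=> [x' t] [].
  have [s s0 nV] : exists2 s : R, 0 <= s & ~ V0 (phi (- s) x).
    apply: contrapT => h; apply: nAx.
    apply: (backward_in_closed V0_closed V0_disj) => t t0.
    by apply: contrapT => nV; apply: h; exists t.
  have oV : nbhs (phi (- s) x) (~` V0).
    by apply: open_nbhs_nbhs; split; [exact: closed_openC|].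
  exists (phi (- s) @^-1` (~` V0), [set t | s < t]).
    split; first exact: (flow_continuous glf (x := x) oV).
    by exists s; split => //; exact: num_real.
  move=> [x' t] /= [nVx' st] /(_ s); rewrite s0 ltW // => /(_ isT) Vx'.
  by case: nVx'.
move=> /(_ h)[M [_ hM]]; exists (Num.max 0 (M + 1)); first by rewrite le_max lexx.
move=> x Kx; apply: (hM (Num.max 0 (M + 1))) => //.
by rewrite lt_max; apply/orP; right; lra.
Qed.

(** Every neighbourhood of the hull missing the dual hull contains a closed
    forward invariant one: points whose backward orbit stays in [V0] for a long
    time are interior to [V0], so trajectories cannot leave. *)
Lemma forward_invariant_nbhs : exists P : set T,
  [/\ closed P, P `<=` V0, forall x, A x -> nbhs x P &
      forall (t : R) x, 0 <= t -> P x -> P (phi t x)].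
Proof.
have [t t0 Kt] := K_interior; exists (K t); split=> //; [exact: K_sub|exact: K_nbhs|].
have /compact_near_coveringP cov := compact_of_closed glf (@K_closed t).
have := cov R (nbhs (0 : R)) (fun s x => V0 (phi s x)) (nbhs_filter (0 : R)).
have h x : K t x -> \forall x' \near x & s \near (0 : R), V0 (phi s x').
  move=> /Kt Vx; have nV : nbhs (phi 0 x) V0 by rewrite phi0.
  have [[B1 B2] /= [n1 n2] B] := gl_continuous glf (0, x) _ nV.
  by exists (B2, B1) => // -[x' s] [/= ? ?]; exact: (B (s, x')).
move=> /(_ h) /nbhs_ballP[d /= d0 hd].
have small s x : 0 <= s < d -> K t x -> K t (phi s x).
  move=> /andP[s0 sd] Kx r /andP[r0 rt]; rewrite -phiD.
  have [sr|sr] := leP r s.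
    have B : ball (0 : R) d (- r + s).
      by rewrite -ball_normE /= sub0r normrN ger0_norm; lra.
    exact: hd B x Kx.
  by rewrite -(opprK (- r + s)); apply: Kx; apply/andP; split; lra.
move=> s x s0 Kx.
have [n hn] : exists n : nat, s / n.+1%:R < d.
  have /= := archi_boundP (divr_ge0 s0 (ltW d0)); set n := Num.bound _ => h2.
  exists n; rewrite ltr_pdivrMr ?ltr0n // mulrC -ltr_pdivrMr //.
  by apply: lt_trans h2 _; rewrite ltr_nat.
have s'0 : 0 <= s / n.+1%:R by rewrite divr_ge0.
suff iterK k : K t (phi (k%:R * (s / n.+1%:R)) x).
  by have := iterK n.+1; rewrite mulrC divfK // pnatr_eq0.
elim: k => [|k ih]; first by rewrite mul0r phi0.
by rewrite -addn1 natrD mulrDl mul1r addrC phiD; apply: small; rewrite ?s'0.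
Qed.

End Block.

End UpperSet.
End Hulls.

Lemma upper_set_compl phi U : upper_set (restset phi) (linked phi) U ->
  upper_set (restset (reversed phi)) (linked (reversed phi)) (restset phi `\` U).
Proof.
rewrite restset_reversed => -[UF h]; split; first by move=> x [].
move=> x y [Fx nUx] Fy /linked_reversed yx; split => // Uy; apply: nUx.
exact: h Uy Fx yx.
Qed.

Section Attractors.
Variables (phi : R -> T -> T) (f : T -> R).
Hypothesis glf : gradient_like phi f.
Hypothesis loc : locally_linked phi.
Let F := restset phi.
Let phi0 := gl_0 glf.
Let phiD := gl_D glf.

Lemma closed_stable_hull U : upper_set F (linked phi) U ->
  closed (stable_hull phi (F `\` U)).
Proof.
move=> /upper_set_compl up; rewrite -unstable_hull_reversed.
exact: (closed_unstable_hull (gradient_like_reversed glf) (locally_linked_reversed loc) up).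
Qed.

(** The attractor block is cut out by [u < 1/2 + eps * f], with [u] a Urysohn
    function evaluated along whole forward orbits. The first term makes it
    forward invariant; the strictly increasing [f] makes this invariance strict,
    because no rest point can lie on the boundary. *)
Theorem unstable_hull_attractor U : upper_set F (linked phi) U ->
  attractor phi (unstable_hull phi U).
Proof.
move=> upU; set A := unstable_hull phi U; set Rp := stable_hull phi (F `\` U).
have cA : closed A by exact: (closed_unstable_hull glf loc upU).
have cR : closed Rp by exact: closed_stable_hull.
have AR x : A x -> ~ Rp x by exact: (hull_disjoint upU).
have AP s x : A x -> A (phi s x) by exact: (unstable_hull_flow glf).
have norm : normal_space T := compact_normal (gl_hausdorff glf) (gl_compact glf).
have [V1 [V2 [oV1 oV2 AV1 RV2 V12]]] : exists V1 V2 : set T,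
    [/\ open V1, open V2, A `<=` V1, Rp `<=` V2 & V1 `&` V2 = set0].
  have [h _] := @normal_openP R T; apply: (h norm _ _ cA cR).
  by apply/disjoints_subset => x; exact: AR.
have V12' : V1 `<=` ~` V2 by apply/disjoints_subset.
have [P [cP PV nP fP]] := @forward_invariant_nbhs phi f glf U (~` V2)
  (open_closedC oV2)
  (fun x Ax => filterS V12' (open_nbhs_nbhs (conj oV1 (AV1 _ Ax))))
  (fun x nx Rx => nx (RV2 _ Rx)).
have PR : P `&` Rp = set0.
  by apply/disjoints_subset => x /PV nV2 Rx; apply: nV2; exact: RV2.
have sep := (@normal_separatorP R T).1 norm _ _ cP cR PR.
pose u : T -> R := Urysohn P Rp.
have uc : continuous u by exact: Urysohn_continuous.
have u0 x : P x -> u x = 0 by move=> Px; apply: (Urysohn_sub0 sep); exists x.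
have u1 x : Rp x -> u x = 1 by move=> Rx; apply: (Urysohn_sub1 sep); exists x.
have [C C0 fC] := lyapunov_bounded glf.
(* small enough for the thresholds [1 / 2 + eps * f] to stay in [1/4, 3/4] *)
pose eps : R := (4 * C)^-1.
have eps0 : 0 < eps by rewrite invr_gt0 mulr_gt0.
have feps x : `|eps * f x| <= 1 / 4.
  rewrite normrM gtr0_norm // /eps invfM -mulrA div1r -[leRHS]mulr1 ler_wpM2l ?invr_ge0 //.
  by rewrite ler_pdivrMl // mulr1.
have fl x : - (1 / 4) <= eps * f x by have := feps x; rewrite ler_norml => /andP[].
have fu x : eps * f x <= 1 / 4 by have := feps x; rewrite ler_norml => /andP[].
pose D := [set x | forall t : R, 0 <= t -> u (phi t x) <= 1 / 2 + eps * f x].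
pose B := [set x | exists2 eta : R, 0 < eta &
  forall t : R, 0 <= t -> u (phi t x) <= 1 / 2 + eps * f x - eta].
have BD : B `<=` D.
  move=> x [eta eta0 h] t t0; apply: le_trans (h t t0) _; rewrite gerBl; exact: ltW.
have DR x : D x -> ~ Rp x.
  by move=> /(_ 0 (lexx _)); rewrite phi0 => ux /u1 u1x; move: ux (fu x); rewrite u1x; lra.
have fx x : eps * f y @[y --> x] --> eps * f x.
  by apply: cvgM; [exact: cvg_cst|exact: (gl_lyapunov_continuous glf x)].
have cD : closed D.
  move=> x clx t t0; rewrite leNgt; apply/negP => h.
  have nb : nbhs x [set y | 1 / 2 + eps * f y < u (phi t y)].
    pose g y := u (phi t y) - eps * f y.
    have gx : g y @[y --> x] --> g x.
      apply: cvgB; last exact: fx.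
      exact: (continuous_comp (flow_continuous glf (x := x)) (uc _)).
    have gx' : 1 / 2 < g x by rewrite /g ltrBrDr.
    by apply: filterS (cvgr_gt _ gx _ gx') => y; rewrite /g ltrBrDr.
  have [y [/(_ t t0) Dy /= ny]] := clx _ nb.
  by move: (lt_le_trans ny Dy); rewrite ltxx.
have AB : A `<=` B.
  move=> x Ax; exists (1 / 4); first by [].
  move=> t t0; rewrite (u0 (phi t x)); first by move: (fl x); lra.
  exact: (nbhs_singleton (nP _ (AP t x Ax))).
have oB : open B.
  rewrite openE => x [eta eta0 hx].
  have nRx : ~ Rp x by apply: DR; apply: BD; exists eta.
  have [p Up sp] := forward_in_upper glf nRx.
  have Ap : A p by exact: sub_unstable_hull.
  have [t0 t00 /(_ t0 (lexx _)) Pt] := stable_near sp (nbhs_interior (nP _ Ap)).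
  have n1 : nbhs x (phi t0 @^-1` P) by exact: (flow_continuous glf (x := x) Pt).
  have n2 : \forall y \near x, forall s, 0 <= s <= t0 ->
      u (phi s y) < 1 / 2 + eps * f x - eta / 2.
    apply: (@tube R T phi f glf x 0 t0 [set y | u y < 1 / 2 + eps * f x - eta / 2]).
    move=> s /andP[s0 _]; apply: (cvgr_lt _ (uc (phi s x))).
    by apply: le_lt_trans (hx s s0) _; lra.
  have n3 : \forall y \near x, eps * f x - eta / 4 < eps * f y.
    by apply: (cvgr_gt _ (fx x)); lra.
  apply: filterS (filterI n1 (filterI n2 n3)) => y [/= Py [hy fy]].
  have [m m0 [m1 m2]] : exists2 m : R, 0 < m & m <= eta / 4 /\ m <= 1 / 4.
    exists (Num.min (eta / 4) (1 / 4)); last by rewrite !ge_min !lexx orbT.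
    by rewrite lt_min; apply/andP; split; lra.
  exists m => //.
  move=> t tge0; have [tt0|t0t] := leP t t0.
    by have := hy t; rewrite tge0 tt0 => /(_ isT) hyt; lra.
  rewrite (u0 (phi t y)); last first.
    rewrite -(subrK t0 t) phiD; apply: fP => //; lra.
  by have := fl y; lra.
have clB : closure B `<=` D by rewrite [D](closure_id _).1 //; exact: closureS.
split.
- exact: (compact_of_closed glf).
- move=> t; apply/seteqP; split => [_ [x Ax <-]|x Ax]; first exact: AP.
  by exists (phi (- t) x); [exact: AP|exact: (flowNK glf)].
exists B; have intB : B° = B by apply/interior_id.
split; rewrite ?intB //.
- move=> s s0 _ [x /clB Dx <-].
  have [Fx|nFx] := pselect (F x).
    rewrite Fx; apply: AB; apply: sub_unstable_hull => //.
    have [p Up sp] := forward_in_upper glf (DR _ Dx).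
    by rewrite (stable_uniq glf (stable_fix Fx) sp).
  exists (eps * (f (phi s x) - f x)).
    by rewrite mulr_gt0 // subr_gt0; exact: (gl_lyapunov glf s0 nFx).
  move=> t t0; rewrite -phiD.
  have := Dx (t + s); rewrite addr_ge0 ?(ltW s0) // => /(_ isT) h.
  by apply: le_trans h _; rewrite le_eqVlt; apply/orP; left; apply/eqP; ring.
- apply/seteqP; split => [x Ax t t0|x hx].
    by exists (phi (- t) x); [apply: AB; exact: AP|exact: (flowNK glf)].
  apply: (backward_in_closed glf cD DR) => t t0.
  have [y By <-] := hx t t0; rewrite (flowK glf); exact: BD.
Qed.

(** The block of an attractor is forward invariant, so trajectories that leave a
    point of the attractor never escape the block; they stay in the attractor. *)
Lemma attractor_unstable_hull A : attractor phi A ->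
  upper_set F (linked phi) (F `&` A) /\ A = unstable_hull phi (F `&` A).
Proof.
case=> coA invA [W [AW strictW AE]].
have cA : closed A by exact: compact_closed (gl_hausdorff glf) coA.
have inv t x : A x -> A (phi t x) by move=> Ax; rewrite -(invA t); exists x.
have unsA p x : A p -> unstable phi p x -> A x.
  move=> Ap ux; rewrite AE => t t0.
  have [s s0 Ws] := unstable_near glf ux (nbhs_interior (AW _ Ap)).
  exists (phi (- t) x); last exact: (flowNK glf).
  have [ts|st] := ltP t s; last by apply: interior_subset; exact: Ws.
  rewrite (_ : phi (- t) x = phi (s - t) (phi (- s) x)); last first.
    by rewrite -phiD; congr (phi _ x); ring.
  apply: interior_subset; apply: (strictW (s - t)); first by rewrite subr_gt0.
  exists (phi (- s) x) => //; apply: subset_closure.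
  by apply: interior_subset; exact: Ws.
split; last first.
  apply/seteqP; split => x.
    move=> Ax; have [p Fp up] := gl_backward glf x; exists p => //; split => //.
    by apply: (unstable_closed cA _ up) => t _; exact: inv.
  by move=> [p [Fp Ap] up]; exact: unsA Ap up.
split=> [x []//|p q [Fp Ap] Fq [z [up sq]]]; split => //.
by apply: (stable_closed cA _ sq) => t _; apply: inv; exact: unsA Ap up.
Qed.

Lemma rest_unstable_hull U : U `<=` F -> F `&` unstable_hull phi U = U.
Proof.
move=> UF; apply/seteqP; split => x; last first.
  by move=> Ux; split; [exact: UF|exists x => //; apply: unstable_fix; exact: UF].
move=> [Fx [p Up up]].
by rewrite (unstable_uniq glf (unstable_fix Fx) up).
Qed.

Theorem upper_set_attractor_iso :
  set_lattice_iso (upper_set F (linked phi)) (attractor phi) (unstable_hull phi).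
Proof.
split; first split.
- by move=> U; exact: unstable_hull_attractor.
- move=> U U' /set_mem[UF _] /set_mem[UF' _] e.
  by rewrite -(rest_unstable_hull UF) e rest_unstable_hull.
- by move=> A /attractor_unstable_hull[up AE]; exists (F `&` A).
move=> A B [AF _] [BF _]; split; first exact: bigcup_setU.
apply/seteqP; split=> [x [p [Ap Bp] up]|x [[p Ap up] [q Bq uq]]].
  by split; exists p.
exists p => //; split => //.
by rewrite (unstable_uniq glf up uq).
Qed.

(** Every trajectory converges to a rest point: of the closed hull, whence its
    distance to the hull tends to zero, or of its complement, whence that distance
    is bounded below. *)
Theorem stable_hull_dual_repellor (d : T -> T -> R) U :
  compatible_metric d -> upper_set F (linked phi) U ->
  stable_hull phi (F `\` U) = dual_repellor d phi (unstable_hull phi U).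
Proof.
move=> [d0 dC dtri dnbhs] upU; set A := unstable_hull phi U.
have d_ge0 x y : 0 <= d x y.
  have := dtri x y x; rewrite (dC y x) ((d0 x x).2 erefl) => h; lra.
have cA : closed A by exact: (closed_unstable_hull glf loc upU).
have lbA x : has_lbound [set d x y | y in A].
  by exists 0 => _ [y _ <-]; exact: d_ge0.
have dist_ge0 x : 0 <= dist_to d A x.
  have [->|/set0P[y Ay]] := eqVneq A set0; first by rewrite /dist_to image_set0 inf0.
  by apply: lb_le_inf; [exists (d x y); exists y|move=> _ [z _ <-]; exact: d_ge0].
apply/seteqP; split=> x.
  move=> [q [Fq nUq] sq] [[y Ay] dA].
  have nAq : ~ A q.
    by move=> Aq; apply: nUq; rewrite -(rest_unstable_hull upU.1).
  have /dnbhs[e e0 he] : nbhs q (~` A).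
    by apply: open_nbhs_nbhs; split; [exact: closed_openC|].
  have e20 : 0 < e / 2 by rewrite divr_gt0.
  have nq : nbhs q [set z | d q z < e / 2] by apply/dnbhs; exists (e / 2).
  have [t0 _ near_q] := stable_near sq nq.
  have far t : t0 <= t -> e / 2 <= dist_to d A (phi t x).
    move=> /near_q /= h; apply: lb_le_inf; first by exists (d (phi t x) y); exists y.
    move=> _ [z Az <-]; rewrite leNgt; apply/negP => dz; apply: (he z) => //=.
    by apply: le_lt_trans (dtri _ (phi t x) _) _; rewrite (splitr e) ltrD.
  have /cvgrPdist_lt/(_ _ e20)[M [_ hM]] := dA.
  have := hM (Num.max (M + 1) t0); rewrite lt_max ltrDl ltr01 => /(_ isT) /=.
  rewrite sub0r normrN ger0_norm // ltNge far //.
  by rewrite le_max lexx orbT.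
move=> nb; apply: contrapT => nR; apply: nb.
have [p Up sp] := forward_in_upper glf nR.
have Ap : A p by exact: (sub_unstable_hull upU).
split; first by exists p.
apply/cvgrPdist_lt => e e0.
have nq : nbhs p [set z | d p z < e] by apply/dnbhs; exists e.
have [M [_ hM]] := sp _ nq; exists M; split; first exact: num_real.
move=> t /hM /= dt.
rewrite sub0r normrN ger0_norm //; apply: le_lt_trans dt.
by apply: ge_inf => //; exists p => //; exact: dC.
Qed.

End Attractors.
End AttractorLattice.

(** * Stable and unstable sets as orbits of contracted families *)

Section LocalProducts.
Context {R : realType} {T : topologicalType}.
Implicit Types (phi : R -> T -> T) (f : T -> R) (N : set (T -> T)) (p q x z : T).

(** An abstraction of the action of [N]: conjugation by the flow shrinks the
    elements of the family, so they move points only inside stable sets. *)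
Record contracting phi N : Prop := Contracting {
  ctr_inverse : forall n, N n -> exists2 n', N n' & cancel n n' /\ cancel n' n;
  ctr_continuous : forall n, N n -> continuous n;
  ctr_stable : forall n p z, N n -> restset phi p -> stable phi p z -> stable phi p (n z);
  ctr_conj : forall n t, N n -> exists2 n', N n' & forall x, n' x = phi t (n (phi (- t) x)) }.

Definition orb N p : set T := [set n p | n in N].

Definition orb2 N N' p : set T := [set z | exists2 n, N n & exists2 m, N' m & z = n (m p)].

Section LocalProduct.
Variables (phi : R -> T -> T) (f : T -> R) (N N' : set (T -> T)).
Hypothesis glf : gradient_like phi f.
Hypothesis ctrN : contracting phi N.
Hypothesis ctrN' : contracting (reversed phi) N'.
Hypothesis nbhs_NN' : forall p, restset phi p -> nbhs p (orb2 N N' p).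

(** Late on its trajectory, a point [z] of the stable set is [n (m p)]. Then
    [m p] is both stable and unstable at [p], so it is [p]; conjugate [n] back to
    time zero. *)
Lemma stable_orb p : restset phi p -> stable phi p = orb N p.
Proof.
move=> Fp; apply/seteqP; split => z; last first.
  by move=> [n Nn <-]; apply: (ctr_stable ctrN) => //; exact: stable_fix.
move=> sz; have [t0 _ /(_ t0 (lexx _))[n Nn [m N'm e]]] := stable_near sz (nbhs_NN' Fp).
have [n' Nn' [nK _]] := ctr_inverse ctrN Nn.
have smp : stable phi p (m p).
  rewrite -(nK (m p)) -e; apply: (ctr_stable ctrN) => //.
  exact: (stable_shift glf).
have ump : unstable phi p (m p).
  apply: (ctr_stable ctrN') => //; first by rewrite restset_reversed.
  by apply: stable_fix; rewrite restset_reversed.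
have mp := stable_unstable_fix glf Fp smp ump.
have [n2 Nn2 h] := ctr_conj ctrN (- t0) Nn.
exists n2 => //; rewrite h opprK Fp -{1}mp -e; exact: (flowK glf).
Qed.

End LocalProduct.

Section Bruhat.
Variables (phi : R -> T -> T) (f : T -> R) (N N' : set (T -> T)).
Hypothesis glf : gradient_like phi f.
Hypothesis ctrN : contracting phi N.
Hypothesis ctrN' : contracting (reversed phi) N'.
Hypothesis nbhs_NN' : forall p, restset phi p -> nbhs p (orb2 N N' p).
Hypothesis nbhs_N'N : forall p, restset phi p -> nbhs p (orb2 N' N p).

Lemma unstable_orb p : restset phi p -> unstable phi p = orb N' p.
Proof.
move=> Fp; apply: (stable_orb (N' := N) (gradient_like_reversed glf)) => //.
- by rewrite reversedK.
- by move=> q; rewrite restset_reversed; exact: nbhs_N'N.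
- by rewrite restset_reversed.
Qed.

Lemma product_locally_linked : locally_linked phi.
Proof.
move=> p Fp; exists (orb2 N N' p `&` orb2 N' N p).
  by apply: filterI; [exact: nbhs_NN'|exact: nbhs_N'N].
move=> q z Fq [[n Nn [m N'm e]] [m2 N'm2 [n2 Nn2 e2]]]; split => sz.
  have [n' Nn' [nK _]] := ctr_inverse ctrN Nn; exists (m p); split.
    by rewrite unstable_orb //; exists m.
  by rewrite -(nK (m p)) -e; exact: (ctr_stable ctrN).
have [m' N'm' [mK _]] := ctr_inverse ctrN' N'm2; exists (n2 p); split.
  rewrite -(mK (n2 p)) -e2; apply: (ctr_stable ctrN') => //.
  by rewrite restset_reversed.
by rewrite (stable_orb glf ctrN ctrN') //; exists n2.
Qed.

(** If [p] lies in the closure of the orbit of [q], points of that orbit near [p]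
    give links. Conversely the orbit of a link stays in the orbit of [q] and
    comes from near [p]. *)
Lemma orb_closure_linked p q : restset phi p -> restset phi q ->
  (orb N p `<=` closure (orb N q) <-> linked phi p q).
Proof.
move=> Fp Fq; have so r : restset phi r -> stable phi r = orb N r.
  exact: (stable_orb glf ctrN ctrN').
rewrite -!so //; split => [h|[z [up sq]]].
  have [W nW hW] := product_locally_linked Fp.
  have [z [sz Wz]] := h p (stable_fix Fp) W nW.
  exact: (hW q z Fq Wz).1.
rewrite so // => _ [n Nn <-] B nB.
have nB' : nbhs p (n @^-1` B) by exact: (ctr_continuous ctrN Nn (x := p) nB).
have [t0 t00 /(_ t0 (lexx _)) Bt] := unstable_near glf up nB'.
exists (n (phi (- t0) z)); split => //.
by apply: (ctr_stable ctrN) => //; exact: (stable_shift glf).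
Qed.

End Bruhat.
End LocalProducts.

(** * Projective space *)

Lemma nbhs_setval {X : topologicalType} (A : set X) (x : A) (B : set A) :
  nbhs x B <-> exists2 W, nbhs (\val x) W & forall y : A, W (\val y) -> B y.
Proof.
split.
  case=> _ [[U oU <-] /= Ux UB]; exists U; first exact: open_nbhs_nbhs.
  by move=> y Uy; exact: UB.
case=> W nW WB; have : nbhs x (\val @^-1` W).
  exact: (@initial_continuous _ _ (\val : A -> X) x _ nW).
by apply: filterS => y; exact: WB.
Qed.

Section ProjectiveSpace.
Context {R : realType} {V : vectType (Cplx R)}.
Implicit Types (x y : projspace V) (u v w : V) (g h : 'End(V)).

Definition rep x v : Prop := v != 0 /\ v \in (val x).

Lemma rep_ex x : exists v, rep x v.
Proof.
exists (vpick (val x)); split; last exact: memv_pick.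
rewrite vpick0 -dimv_eq0; case: x => L /= /eqP -> //.
Qed.

Lemma rep_val x v : rep x v -> val x = <[v]>%VS.
Proof.
move=> [v0 vx]; apply/eqP; rewrite eq_sym eqEdim -memvE vx /= dim_vline v0.
by rewrite (eqP (valP x)).
Qed.

Lemma rep_inj x y v : rep x v -> rep y v -> x = y.
Proof. by move=> /rep_val ex /rep_val ey; apply: val_inj; rewrite ex ey. Qed.

Lemma rep_colinear x v w : rep x v -> rep x w -> exists2 c, c != 0 & w = c *: v.
Proof.
move=> xv [w0]; rewrite (rep_val xv) => /vlineP[c wE]; exists c => //.
by apply: contraNneq w0 => c0; rewrite wE c0 scale0r.
Qed.

Lemma rep_scale x v c : rep x v -> c != 0 -> rep x (c *: v).
Proof. by move=> [v0 vx] c0; split; [rewrite scaler_eq0 negb_or c0|exact: memvZ]. Qed.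

Lemma point_ex v : v != 0 -> exists x : projspace V, rep x v.
Proof.
move=> v0; have dv : \dim <[v]> == 1%N by rewrite dim_vline v0.
by exists (exist _ <[v]>%VS dv); split => //=; exact: memv_line.
Qed.

Lemma rep_unit x : exists2 v, rep x v & nrm v = 1.
Proof.
have [v xv] := rep_ex x; have v0 : nrm v != 0 by rewrite nrm_eq0 xv.1.
exists (ofreal (nrm v)^-1 *: v).
  by apply: rep_scale => //; rewrite ofreal_eq0 invr_eq0.
by rewrite nrmZ cabs_ofreal ger0_norm ?invr_ge0 ?nrm_ge0 // mulVf.
Qed.

(** The quotient map is open: rescaling a representative of a nearby line brings
    it close to [v]. *)
Lemma nbhs_projP x v (B : set (projspace V)) : rep x v ->
  (nbhs x B <-> exists2 e : R, 0 < e &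
    forall w y, nrm (w - v) < e -> rep y w -> B y).
Proof.
move=> xv; have v0 := xv.1.
have nz w : w != 0 -> @nonzero R V w by move=> /eqP.
have lineE (u : @nonzero R V) y : rep y (set_val u) -> line u = y.
  by move=> yu; apply: val_inj; rewrite /= (rep_val yu).
split.
  rewrite nbhsE => -[U [oU Ux] UB].
  pose v' : @nonzero R V := exist _ (v : vtop V) (mem_set (nz _ v0)).
  have nU : nbhs v' (@line R V @^-1` U).
    by apply: open_nbhs_nbhs; split => //=; rewrite (lineE v' x).
  have [W /nbhs_nrmP[e e0 eW] WU] := (nbhs_setval _ _).1 nU.
  exists e => // w y wv yw; apply: UB.
  pose w' : @nonzero R V := exist _ (w : vtop V) (mem_set (nz _ yw.1)).
  by rewrite -(lineE w' y yw); apply: WU; exact: eW.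
case=> e e0 eB; rewrite nbhsE.
exists [set y | exists2 w, rep y w & nrm (w - v) < e]; last first.
  by move=> y [w yw wv]; exact: eB wv yw.
split; last by exists v => //; rewrite subrr nrm0.
suff : open (@line R V @^-1` [set y | exists2 w, rep y w & nrm (w - v) < e]) by [].
rewrite openE => u [w yw wv].
have ru : rep (line u) (set_val u).
  split; last by rewrite /= memv_line.
  by apply/eqP; exact: (set_valP u).
have [c c0 wE] := rep_colinear ru yw.
apply/nbhs_setval; exists [set u' : vtop V | nrm (c *: (u' : V) - v) < e].
  apply/nbhs_nrmP; exists ((e - nrm (w - v)) / cabs c).
    by rewrite divr_gt0 ?subr_gt0 ?cabs_gt0.
  move=> u'; rewrite ltr_pdivlMr ?cabs_gt0 // mulrC -nrmZ scalerBr -wE => h /=.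
  by apply: le_lt_trans (nrm_tri _ w _) _; rewrite -ltrBrDr.
move=> u' /= h; exists (c *: (set_val u' : V)) => //.
apply: rep_scale => //; split; last by rewrite /= memv_line.
by apply/eqP; exact: (set_valP u').
Qed.

Lemma rep_act g x v : GL g -> rep x v -> rep (proj_act g x) (g v).
Proof.
move=> /lker0P gI xv; have gv0 : g v != 0.
  by apply: contraNneq xv.1 => gv; apply/eqP/gI; rewrite gv linear0.
have gE : (g @: val x)%VS = <[g v]>%VS by rewrite (rep_val xv) limg_line.
split => //; rewrite /proj_act val_insubd gE dim_vline gv0 /=.
exact: memv_line.
Qed.

(** Two linear forms separate the lines of independent vectors, and comparing
    their moduli is insensitive to the choice of representatives. *)
Lemma hausdorff_projspace : hausdorff_space (projspace V).
Proof.
move=> x y xy; apply: contrapT => neq.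
have [v xv] := rep_ex x; have [w yw] := rep_ex y.
have fvw : free [:: v; w].
  rewrite free_cons seq1_free yw.1 andbT span_seq1; apply/negP => vw.
  by apply: neq; apply: (rep_inj xv); split; [exact: xv.1|rewrite (rep_val yw)].
pose X := [tuple v; w].
pose l (i : 'I_2) u := cabs (coord X i u).
have lc i (z : V) (e : R) : 0 < e -> exists2 d : R, 0 < d & forall u, nrm (u - z) < d ->
    `|l i u - l i z| < e.
  by apply: seminorm_continuous => [u1 u2|c u]; rewrite /l;
    [rewrite linearD cabsD|rewrite linearZ cabsM].
have cX i j : coord X j X`_(nat_of_ord i) = (i == j)%:R by exact: coord_free.
have lv0 : l 0 v = 1 by rewrite /l (cX 0 0) cabs1.
have lv1 : l 1 v = 0 by rewrite /l (cX 0 1) cabs0.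
have lw0 : l 0 w = 0 by rewrite /l (cX 1 0) cabs0.
have lw1 : l 1 w = 1 by rewrite /l (cX 1 1) cabs1.
have half : 0 < (1 / 2 : R) by [].
have [d0 d00 h0] := lc 0 v _ half; have [d1 d10 h1] := lc 1 v _ half.
have [d2 d20 h2] := lc 0 w _ half; have [d3 d30 h3] := lc 1 w _ half.
have n1 : nbhs x [set z | forall u, rep z u -> l 1 u < l 0 u].
  apply/(nbhs_projP _ xv); exists (Num.min d0 d1); first by rewrite lt_min d00.
  move=> u z; rewrite lt_min => /andP[/h0 + /h1]; rewrite lv0 lv1 => a b zu u' zu'.
  have [c c0 ->] := rep_colinear zu zu'.
  rewrite /l !linearZ !cabsM ltr_pM2l ?cabs_gt0 // -!/(l _ _).
  by move: a b; rewrite !ltr_norml => /andP[? ?] /andP[? ?]; lra.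
have n2 : nbhs y [set z | forall u, rep z u -> l 0 u < l 1 u].
  apply/(nbhs_projP _ yw); exists (Num.min d2 d3); first by rewrite lt_min d20.
  move=> u z; rewrite lt_min => /andP[/h2 + /h3]; rewrite lw0 lw1 => a b zu u' zu'.
  have [c c0 ->] := rep_colinear zu zu'.
  rewrite /l !linearZ !cabsM ltr_pM2l ?cabs_gt0 // -!/(l _ _).
  by move: a b; rewrite !ltr_norml => /andP[? ?] /andP[? ?]; lra.
have [z [/= z1 z2]] := xy _ _ n1 n2; have [u zu] := rep_ex z.
by have := lt_trans (z1 u zu) (z2 u zu); rewrite ltxx.
Qed.

(** The unit sphere surjects onto the projective space. *)
Lemma compact_projspace : compact [set: projspace V].
Proof.
move=> F PF _; have /choice[r rP] : forall x, exists v, rep x v /\ nrm v = 1.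
  by move=> x; have [v xv v1] := rep_unit x; exists v.
pose S := [set v : vtop V | nrm (v : V) = 1].
have SK : compact S.
  apply: (@compact_nrm _ _ _ 1) => [|w ->//]; apply: closed_nrmP => w h.
  apply/eqP; rewrite -subr_eq0 -normr_eq0 eq_le normr_ge0 andbT.
  apply/ler_addgt0Pr => e e0; rewrite add0r.
  have [u u1 uw] := h _ e0; rewrite -u1 ler_norml.
  have := nrm_sub_ge u w; have := nrm_sub_ge w u; rewrite (nrmC w u).
  by move=> h1 h2; apply/andP; split; lra.
have [|v [v1 vcl]] := SK ((r : projspace V -> vtop V) @ F) (fmap_proper_filter _ PF).
  by apply: (@filterS _ F _ setT) filterT => x _; exact: (rP x).2.
have v0 : v != 0 :> V by rewrite -nrm_gt0 v1.
have [x xv] := point_ex v0; exists x; split => // A B FA /(nbhs_projP _ xv)[e e0 eB].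
have n1 : ((r : projspace V -> vtop V) @ F) ((r : projspace V -> vtop V) @` A).
  by apply: (@filterS _ F _ A _ _ FA) => y Ay; exists y.
have [_ [[y Ay <-] ryv]] := vcl _ _ n1 (nrm_near v e0).
by exists y; split => //; exact: eB ryv (rP y).1.
Qed.

End ProjectiveSpace.

(** * Adjoints and the Cartan involution *)

Lemma lfun_of_linear (K : fieldType) (U W : vectType K) (f : U -> W) :
  linear f -> exists F : 'Hom(U, W), forall u, F u = f u.
Proof.
move=> lf; pose L := GRing.isLinear.Build _ _ _ _ _ lf.
by pose g : {linear U -> W} := HB.pack f L; exists (linfun g) => u; rewrite lfunE.
Qed.

Section Adjoint.
Import VectorInternalTheory.
Context {R : realType} {V : vectType (Cplx R)} (dot : {dot V for Num.conj}).
Implicit Types (u v w : V) (Y Z : 'End(V)).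

Lemma dotDl u v w : dot (u + v) w = dot u w + dot v w.
Proof. by rewrite linearDl. Qed.

Lemma dotZl c u w : dot (c *: u) w = c * dot u w.
Proof. by rewrite linearZl_LR. Qed.

Lemma dotC u v : dot u v = (dot v u)^*.
Proof. by rewrite hermC expr0 mul1r. Qed.

Lemma dotDr u v w : dot u (v + w) = dot u v + dot u w.
Proof. by rewrite linearDr. Qed.

Lemma dotZr c u v : dot u (c *: v) = c^* * dot u v.
Proof. by rewrite dotC dotZl rmorphM /= -dotC. Qed.

Lemma dot_suml (I : Type) (r : seq I) (F : I -> V) w :
  dot (\sum_(i <- r) F i) w = \sum_(i <- r) dot (F i) w.
Proof. exact: linear_sumlz. Qed.

Lemma dot_sumr (I : Type) (r : seq I) (F : I -> V) w :
  dot w (\sum_(i <- r) F i) = \sum_(i <- r) dot w (F i).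
Proof. by rewrite dotC dot_suml rmorph_sum; apply: eq_bigr => i _; rewrite /= -dotC. Qed.

Lemma dot_nondegenerate u v : (forall w, dot w u = dot w v) -> u = v.
Proof.
move=> h; apply/eqP; rewrite -subr_eq0 -(dnorm_eq0 dot) linearBr /= h subrr //.
Qed.

Lemma coo_unitv i j : coo (unitv i : V) j = (i == j)%:R.
Proof. by rewrite /coo /unitv r2vK mxE eqxx /= eq_sym. Qed.

Lemma coo_sum_unitv (c : 'I_(dim V) -> Cplx R) j :
  coo (\sum_i c i *: (unitv i : V)) j = c j.
Proof.
have -> : coo (\sum_i c i *: (unitv i : V)) j = \sum_i c i * coo (unitv i : V) j.
  by rewrite /coo linear_sum summxE; apply: eq_bigr => i _; rewrite linearZ mxE.
rewrite (bigD1 j) //= coo_unitv eqxx mulr1 big1 ?addr0 // => i ij.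
by rewrite coo_unitv (negbTE ij) mulr0.
Qed.

(** With [J w = \sum_i dot w e_i *: e_i] for a basis [e], which is injective, the
    adjoint of [Y] is [J^-1] after [w |-> \sum_i dot w (Y e_i) *: e_i]. *)
Lemma adjoint_exists Y : exists Z : 'End(V), forall v w, dot (Y v) w = dot v (Z w).
Proof.
have lin (F : 'I_(dim V) -> V) : linear (fun w => \sum_i dot w (F i) *: (unitv i : V)).
  move=> c u v; rewrite scaler_sumr -big_split; apply: eq_bigr => i _.
  by rewrite dotDl dotZl scalerDl scalerA.
have [J JE] := lfun_of_linear (lin unitv).
have [K KE] := lfun_of_linear (lin (fun i => Y (unitv i))).
have J0 : lker J == 0%VS.
  rewrite -subv0; apply/subvP => w; rewrite memv_ker memv0 => /eqP Jw; rewrite -(dnorm_eq0 dot).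
  rewrite [X in dot _ X](coo_sum w) dot_sumr big1 // => i _.
  have := congr1 (fun u => coo u i) Jw; rewrite JE coo_sum_unitv dotZr => ->.
  by rewrite /coo linear0 mxE mulr0.
exists (J^-1 \o K)%VF => v w; set z := (J^-1 \o K)%VF w.
have zw i : dot z (unitv i) = dot w (Y (unitv i)).
  have Jz : J z = K w by rewrite /z comp_lfunE; exact: lker0_lfunVK.
  by have := congr1 (fun u => coo u i) Jz; rewrite JE KE !coo_sum_unitv.
rewrite [X in dot (Y X) _](coo_sum v) linear_sum dot_suml [X in dot X (_ w)](coo_sum v) dot_suml.
apply: eq_bigr => i _; rewrite linearZ !dotZl; congr (_ * _).
by rewrite [RHS]dotC zw -dotC.
Qed.

Lemma adjointP Y v w : dot (Y v) w = dot v (adjoint dot Y w).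
Proof.
have [Z hZ] := adjoint_exists Y.
by have := @xgetPex _ 0 [set Z : 'End(V) | forall v w, dot (Y v) w = dot v (Z w)]
  (ex_intro _ Z hZ).
Qed.

Lemma adjoint_unique Y Z : (forall v w, dot (Y v) w = dot v (Z w)) -> adjoint dot Y = Z.
Proof.
by move=> h; apply/lfunP => w; apply: dot_nondegenerate => v; rewrite -h -adjointP.
Qed.

Lemma adjointP2 Y v w : dot (adjoint dot Y v) w = dot v (Y w).
Proof. by rewrite dotC -adjointP -dotC. Qed.

Lemma adjointK Y : adjoint dot (adjoint dot Y) = Y.
Proof. by apply: adjoint_unique => v w; exact: adjointP2. Qed.

Lemma adjointD Y Z : adjoint dot (Y + Z) = adjoint dot Y + adjoint dot Z.
Proof.
by apply: adjoint_unique => v w; rewrite !add_lfunE dotDl dotDr -!adjointP.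
Qed.

Lemma adjointZ c Y : adjoint dot (c *: Y) = c^* *: adjoint dot Y.
Proof.
apply: adjoint_unique => v w.
by rewrite !scale_lfunE dotZl dotZr conjCK -adjointP.
Qed.

Lemma adjointN Y : adjoint dot (- Y) = - adjoint dot Y.
Proof. by rewrite -scaleN1r adjointZ rmorphN1 scaleN1r. Qed.

Lemma adjoint_sum (I : Type) (r : seq I) (P : pred I) (F : I -> 'End(V)) :
  adjoint dot (\sum_(i <- r | P i) F i) = \sum_(i <- r | P i) adjoint dot (F i).
Proof.
elim/big_rec2: _ => [|i y x _ <-]; last by rewrite adjointD.
by rewrite -(scale0r 0) adjointZ conjC0 !scale0r.
Qed.

Lemma adjoint_comp Y Z : adjoint dot (Y \o Z)%VF = (adjoint dot Z \o adjoint dot Y)%VF.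
Proof.
by apply: adjoint_unique => v w; rewrite !comp_lfunE -!adjointP.
Qed.

Lemma adjoint1 : adjoint dot \1%VF = \1%VF.
Proof. by apply: adjoint_unique => v w; rewrite !id_lfunE. Qed.

Lemma adjoint_pow Y k : adjoint dot (endo_pow Y k) = endo_pow (adjoint dot Y) k.
Proof.
elim: k => [|k ih]; first exact: adjoint1.
rewrite [endo_pow Y _]/= adjoint_comp ih -[k.+1]addn1 endo_powD.
by rewrite [endo_pow _ 1]/= comp_lfun1r.
Qed.

Lemma adjoint_bounded : exists2 C : R, 0 < C & forall Y, mnrm (adjoint dot Y) <= C * mnrm Y.
Proof.
have [A B|c A|C C0 hC] := @seminorm_bounded _ _ (fun Y : 'End(V) => mnrm (adjoint dot Y)).
- by rewrite adjointD mnrmD.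
- by rewrite adjointZ mnrmZ cabsJ.
by exists C => // Y; apply: le_trans (hC Y) _; rewrite ler_wpM2l ?(ltW C0) // nrm_le_mnrm.
Qed.

Lemma adjoint_expm Y : adjoint dot (expm Y) = expm (adjoint dot Y).
Proof.
have [C _ hC] := adjoint_bounded; apply: (@expm_transfer _ _ (adjoint dot) C) => //.
- by move=> A B; rewrite adjointD adjointN.
move=> n; rewrite /expS adjoint_sum; apply: eq_bigr => k _.
by rewrite adjointZ adjoint_pow fmorphV rmorph_nat.
Qed.

Lemma theta_group_expm Y : theta_group dot (expm Y) = expm (theta_lie dot Y).
Proof. by rewrite /theta_group expm_inv adjoint_expm adjointN. Qed.

Lemma theta_lieK Y : theta_lie dot (theta_lie dot Y) = Y.
Proof. by rewrite /theta_lie adjointN opprK adjointK. Qed.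

Lemma theta_lieD Y Z : theta_lie dot (Y + Z) = theta_lie dot Y + theta_lie dot Z.
Proof. by rewrite /theta_lie adjointD opprD. Qed.

Lemma theta_lieZ c Y : theta_lie dot (c *: Y) = c^* *: theta_lie dot Y.
Proof. by rewrite /theta_lie adjointZ scalerN. Qed.

End Adjoint.

(** * Bases of weight vectors *)

Section WeightBasis.
Import VectorInternalTheory.
Context {R : realType} {V : vectType (Cplx R)} (dot : {dot V for Num.conj}).
Implicit Types (u v w : V) (Y Z : 'End(V)) (U : {vspace V}).

(** Restrict [Y] to [U]; the base field is algebraically closed. *)
Lemma eigenvector_in U Y : U != 0%VS -> (forall u, u \in U -> Y u \in U) ->
  exists c v, [/\ v \in U, v != 0 & Y v = c *: v].
Proof.
move=> U0 YU; pose W : vectType (Cplx R) := subvs_of U.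
have lin : linear (fun w : W => vsproj U (Y (vsval w)) : W).
  by move=> c w1 w2; rewrite !linearP.
have [f fE] := lfun_of_linear lin.
have dimW : (0 < dim W)%N by rewrite -/(dim (subvs_of U)) lt0n /dim /= dimv_eq0.
have [c /eigenvalueP[r rE r0]] := spectral.eigenvalue_closed (f2mx f) dimW.
pose w : W := r2v r; exists c, (vsval w); split; first exact: subvsP.
  apply: contraNneq r0 => w0; rewrite -(r2vK r) -/w.
  have -> : w = 0 by apply: val_inj; rewrite /= w0.
  by rewrite linear0.
have fw : f w = c *: w.
  by rewrite unlock /= /w r2vK rE linearZ.
have := congr1 val fw; rewrite fE /= vsprojK //.
by apply: YU; exact: subvsP.
Qed.

(** Commuting operators preserve each other's eigenspaces, so a nonzero common
    invariant subspace of least dimension consists of common eigenvectors. *)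
Lemma common_eigenvector (a : set 'End(V)) U : abelian_subset a -> U != 0%VS ->
  (forall Y, a Y -> forall u, u \in U -> Y u \in U) ->
  exists2 v, v \in U & v != 0 /\ forall Y, a Y -> exists c, Y v = c *: v.
Proof.
move=> ab; have [n] := ubnP (\dim U); elim: n U => // n ih U dU U0 aU.
have [scal|nscal] := pselect (forall Y, a Y -> exists c, forall u, u \in U -> Y u = c *: u).
  have pU := memv_pick U; exists (vpick U) => //; split; first by rewrite vpick0.
  by move=> Y /scal[c hc]; exists c; exact: hc.
have [Y [aY nY]] : exists Y, a Y /\ ~ exists c, forall u, u \in U -> Y u = c *: u.
  apply: contrapT => h; apply: nscal => Y aY; apply: contrapT => nc.
  by apply: h; exists Y.
have [c [v [vU v0 Yv]]] := eigenvector_in U0 (aU Y aY).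
pose U' := (U :&: lker (Y - c *: \1%VF))%VS.
have memU' u : u \in U' = (u \in U) && (Y u == c *: u).
  by rewrite memv_cap memv_ker add_lfunE opp_lfunE scale_lfunE id_lfunE subr_eq0.
have U'U : (U' <= U)%VS by exact: capvSl.
have [||Z aZ u|w wU' hw] := ih U'.
- apply: leq_trans (_ : \dim U' < \dim U)%N _; last by rewrite -ltnS.
  rewrite ltn_neqAle dimvS // andbT; apply/negP => /eqP dE; apply: nY; exists c => u uU.
  have /eqP U'E : U' == U by rewrite eqEdim U'U dE leqnn.
  by move: uU; rewrite -{1}U'E memU' => /andP[_ /eqP].
- by apply: contraNneq v0 => U'0; rewrite -memv0 -U'0 memU' vU Yv eqxx.
- rewrite !memU' => /andP[uU /eqP Yu]; rewrite (aU Z) //=.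
  have := ab Y Z aY aZ => /(congr1 (fun f : 'End(V) => f u)).
  rewrite /bracket add_lfunE opp_lfunE !comp_lfunE zero_lfunE Yu linearZ => /eqP.
  by rewrite subr_eq0.
by exists w => //; move: wU'; rewrite memU' => /andP[].
Qed.

Section Diagonalization.
Variable (a : set 'End(V)).
Hypothesis a_abelian : abelian_subset a.
Hypothesis a_selfadjoint : forall Y, a Y -> adjoint dot Y = Y.

Let common v := forall Y, a Y -> exists c, Y v = c *: v.

Lemma eigenvalue_real Y v c : a Y -> v != 0 -> Y v = c *: v -> c^* = c.
Proof.
move=> aY v0 Yv; have := adjointP dot Y v v.
rewrite a_selfadjoint // Yv dotZl dotZr => /eqP.
rewrite (inj_eq (mulIf _)) ?dnorm_eq0 // => /eqP <- //.
Qed.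

(** Selfadjoint operators preserve the orthogonal complement of common
    eigenvectors, and this complement contains a further one. *)
Lemma common_free_seq k : (k <= dim V)%N ->
  exists s : seq V, [/\ size s = k, free s & forall v, v \in s -> common v].
Proof.
elim: k => [|k ih] kV; first by exists [::]; rewrite nil_free.
have [s [sk sfree sc]] := ih (ltnW kV).
have lin : linear (fun v : V => \sum_(i < size s) dot v s`_i *: s`_i).
  move=> c u v; rewrite scaler_sumr -big_split; apply: eq_bigr => i _.
  by rewrite dotDl dotZl scalerDl scalerA.
have [K KE] := lfun_of_linear lin.
have memK v : v \in lker K -> forall w, w \in s -> dot v w = 0.
  rewrite memv_ker KE => /eqP Kv w ws.
  have /freeP fs : free (in_tuple s) by [].
  have iws : (index w s < size s)%N by rewrite index_mem.
  have := fs (fun i => dot v s`_i) Kv (Ordinal iws).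
  by rewrite /= nth_index.
have K_span v : v \in lker K -> v \in span s -> v = 0.
  move=> vK /(@coord_span _ _ _ (in_tuple s)) vE.
  apply/eqP; rewrite -(dnorm_eq0 dot) {2}vE dot_sumr big1 // => i _.
  by rewrite dotZr (memK v vK) ?mulr0 // mem_nth.
have [||v vK [v0 vc]] := @common_eigenvector a (lker K) a_abelian.
- have [u us] : exists u, u \notin span s.
    apply: contrapT => h; move: kV; rewrite ltnNge -dimvf -sk => /negP; apply.
    rewrite -(eqP sfree); apply: dimvS; apply/subvP => u _.
    by apply/negPn/negP => us; apply: h; exists u.
  have [X sX [Y [uE _ /orthoPl Ys]]] := orthogonal_split dot s u.
  have Y0 : Y != 0 by apply: contraNneq us => Y0; rewrite uE Y0 addr0.
  apply: contraNneq Y0 => K0; rewrite -memv0 -K0 memv_ker KE big1 // => i _.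
  by rewrite Ys ?scale0r // mem_nth.
- move=> Y aY u uK; rewrite memv_ker KE big1 // => i _.
  rewrite adjointP a_selfadjoint //; have [c ->] := sc s`_i (mem_nth _ (ltn_ord i)) Y aY.
  by rewrite dotZr (memK u uK) ?mulr0 ?scale0r // mem_nth.
exists (v :: s); split; first by rewrite /= sk.
  by rewrite free_cons sfree andbT; apply: contra v0 => /(K_span v vK) ->.
by move=> w; rewrite inE => /predU1P[->|/sc].
Qed.

Lemma weight_of_common v : v != 0 -> common v ->
  exists mu : a -> R, in_dual mu /\ weight_space mu v.
Proof.
move=> v0 vc; have /choice[mu muP] : forall Y : a, exists r : R, \val Y v = ofreal r *: v.
  move=> Y; have [c Yv] := vc _ (set_valP Y).
  have /CrealP/complex_realP[r rE] := eigenvalue_real (set_valP Y) v0 Yv.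
  by exists r; rewrite Yv rE.
exists mu; split => //; move=> s Y Z W WE.
have : ofreal (mu W) *: v = ofreal (s * mu Y + mu Z) *: v.
  rewrite -muP WE add_lfunE scale_lfunE !muP scalerA -scalerDl.
  by rewrite ofrealD ofrealM.
move/eqP; rewrite -subr_eq0 -scalerBl scaler_eq0 (negbTE v0) orbF subr_eq0.
by move/eqP/ofreal_inj.
Qed.

Lemma weight_basis : exists (e : (dim V).-tuple V) (mu : 'I_(dim V) -> a -> R),
  [/\ basis_of fullv e, forall i, weight (mu i) & forall i, weight_space (mu i) e`_i].
Proof.
have [s [sV sfree sc]] := common_free_seq (leqnn (dim V)).
have tP : size s == dim V by rewrite sV.
pose e : (dim V).-tuple V := Tuple tP.
have nz (i : 'I_(dim V)) : e`_i != 0.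
  by apply: (free_not0 sfree); rewrite mem_nth // sV.
have /choice[mu muP] : forall i : 'I_(dim V), exists mu : a -> R,
    in_dual mu /\ weight_space mu e`_i.
  by move=> i; apply: weight_of_common => //; apply: sc; rewrite mem_nth // sV.
exists e, mu; split.
- by rewrite basisEfree sfree subvf sV dimvf /=.
- move=> i; split; first exact: (muP i).1.
  by exists e`_i; [exact/eqP|exact: (muP i).2].
- by move=> i; exact: (muP i).2.
Qed.

End Diagonalization.
End WeightBasis.

(** * Isotypic components and matrix entries *)

(** Lagrange interpolation in the operators [T h] isolates the sum of the
    components on which they act through a given character. *)
Lemma isotypic_mem (C : fieldType) (W : lmodType C) (S : W -> Prop) (K : finType)
    (I : Type) (y : K -> W) (T : I -> W -> W) (chi : K -> I -> C) (k : K) :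
  S 0 -> (forall c u v, S u -> S v -> S (c *: u + v)) ->
  (forall h u, S u -> S (T h u)) ->
  (forall h (c : K -> C), T h (\sum_l c l *: y l) = \sum_l (c l * chi l h) *: y l) ->
  S (\sum_l y l) -> S (\sum_(l | `[< chi l = chi k >]) y l).
Proof.
move=> S0 SL ST TE Sy.
have [c [c1 [c0 Sc]]] : exists c : K -> C, (forall l, chi l = chi k -> c l = 1) /\
    (forall l, l \in [seq l <- enum K | ~~ `[< chi l = chi k >]] -> c l = 0) /\
    S (\sum_l c l *: y l).
  have : {in [seq l <- enum K | ~~ `[< chi l = chi k >]], forall l, chi l <> chi k}.
    by move=> l; rewrite mem_filter => /andP[/asboolPn].
  elim: [seq l <- _ | _] => [|l s ih] hs.
    exists (fun=> 1); split => //; split => //.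
    by under eq_bigr do rewrite scale1r.
  have [l' l's|c [c1 [c0 Sc]]] := ih; first by apply: hs; rewrite inE l's orbT.
  have [h hl] : exists h, chi l h <> chi k h.
    apply: contrapT => nh; apply: (hs l); first exact: mem_head.
    by apply/funext => h; apply: contrapT => hl; apply: nh; exists h.
  have d0 : chi k h - chi l h != 0 by rewrite subr_eq0 eq_sym; apply/eqP.
  exists (fun m => c m * ((chi m h - chi l h) / (chi k h - chi l h))); split.
    by move=> m mk; rewrite c1 // mk divff // mulr1.
  split=> [m|]; first by rewrite inE => /predU1P[->|/c0->]; rewrite ?subrr ?mul0r ?mulr0.
  have -> : \sum_m (c m * ((chi m h - chi l h) / (chi k h - chi l h))) *: y m =
    (chi k h - chi l h)^-1 *: (- chi l h *: (\sum_m c m *: y m) + T h (\sum_m c m *: y m)) + 0.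
    rewrite TE addr0 scaler_sumr -big_split scaler_sumr; apply: eq_bigr => m _ /=.
    by rewrite scalerA -scalerDl scalerA; congr (_ *: _); field.
  by apply: (SL) => //; apply: (SL) => //; exact: ST.
suff -> : \sum_(l | `[< chi l = chi k >]) y l = \sum_l c l *: y l by [].
rewrite big_mkcond; apply: eq_bigr => l _; case: asboolP => [/c1->|nl].
  by rewrite scale1r.
by rewrite c0 ?scale0r // mem_filter mem_enum andbT; exact/asboolPn.
Qed.

Section LieAlgebra.
Context {R : realType} {V : vectType (Cplx R)} (dot : {dot V for Num.conj}).
Variable (G : set 'End(V)).
Hypothesis G_group : subgroupGL G.
Hypothesis G_theta : theta_group dot @` G `<=` G.
Implicit Types (Y Z H : 'End(V)).

Lemma lie_algebra_expm Y : lie_algebra G Y -> G (expm Y).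
Proof. by move=> /(_ 1); rewrite ofreal1 scale1r. Qed.

Lemma lie_algebra_conj g Y : G g -> lie_algebra G Y -> lie_algebra G (g \o Y \o g^-1)%VF.
Proof.
move=> Gg gY s; have [sGL _ GM GV] := G_group.
have k0 : lker g == 0%VS by exact: sGL.
rewrite (_ : _ *: _ = g \o (ofreal s *: Y) \o g^-1)%VF; last first.
  by rewrite -comp_lfunZr -comp_lfunZl.
rewrite -expm_conj; [|exact: lker0_compVf|exact: lker0_compfV].
by apply: (GM); [apply: (GM)|exact: GV].
Qed.

Lemma lie_algebra_theta Y : lie_algebra G Y -> lie_algebra G (theta_lie dot Y).
Proof.
move=> gY s; apply: G_theta; exists (expm (ofreal s *: Y)); first exact: gY.
by rewrite theta_group_expm theta_lieZ conj_ofreal.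
Qed.

Lemma theta_bracket H Y : bracket (theta_lie dot H) (theta_lie dot Y) = theta_lie dot (bracket H Y).
Proof.
rewrite /bracket /theta_lie !comp_lfunNl !comp_lfunNr !opprK adjointD adjointN.
by rewrite !adjoint_comp opprD opprK addrC.
Qed.

End LieAlgebra.

Section Diagonal.
Context {R : realType} {V : vectType (Cplx R)}.
Context (n : nat) (e : n.-tuple V).
Hypothesis e_basis : basis_of fullv e.
Implicit Types (Y Z H : 'End(V)).

Let e_free : free e := basis_free e_basis.

Lemma basis_expansion v : v = \sum_i coord e i v *: e`_i.
Proof. by rewrite {1}(coord_basis e_basis (memvf v)). Qed.

Lemma lfun_basis_eq Y Z : (forall i : 'I_n, Y e`_i = Z e`_i) -> Y = Z.
Proof.
move=> h; apply/lfunP => v; rewrite (basis_expansion v) !linear_sum.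
by apply: eq_bigr => i _; rewrite !linearZ /= h.
Qed.

Lemma coord_diag H (d : 'I_n -> Cplx R) i v : (forall j : 'I_n, H e`_j = d j *: e`_j) ->
  coord e i (H v) = d i * coord e i v.
Proof.
move=> Hd; rewrite {1}(basis_expansion v) linear_sum.
under eq_bigr do rewrite linearZ /= Hd scalerA.
by rewrite coord_sum_free // mulrC.
Qed.

Lemma prj_ex (i : 'I_n) : exists P : 'End(V), forall v, P v = coord e i v *: e`_i.
Proof.
by apply: lfun_of_linear => c u v; rewrite linearD linearZ /= scalerDl scalerA.
Qed.

Definition prj i : 'End(V) := sval (cid (prj_ex i)).

Lemma prjE i v : prj i v = coord e i v *: e`_i.
Proof. by rewrite /prj; case: cid. Qed.

(** The matrix entry of [Y] at [(k.1, k.2)], as an endomorphism. *)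
Definition blk (Y : 'End(V)) (k : 'I_n * 'I_n) : 'End(V) := (prj k.1 \o Y \o prj k.2)%VF.

Lemma blkE Y k v : blk Y k v = (coord e k.2 v * coord e k.1 (Y e`_(k.2))) *: e`_(k.1).
Proof. by rewrite /blk !comp_lfunE !prjE linearZ /= linearZ. Qed.

Lemma sum_blk Y : \sum_k blk Y k = Y.
Proof.
apply/lfunP => v; rewrite sum_lfunE.
under eq_bigr do rewrite blkE -scalerA.
rewrite -(pair_bigA _ (fun i j => coord e j v *: (coord e i (Y e`_j) *: e`_i))) /=.
rewrite exchange_big /= {2}(basis_expansion v) linear_sum; apply: eq_bigr => j _.
by rewrite linearZ -scaler_sumr -basis_expansion.
Qed.

Lemma blk_linear k : linear (fun Y => blk Y k).
Proof.
move=> c Y Z; rewrite /blk comp_lfunDr comp_lfunDl -comp_lfunZr -comp_lfunZl //.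
Qed.

Lemma comp_blk_diag H H' (d d' : 'I_n -> Cplx R) Y k :
  (forall i : 'I_n, H e`_i = d i *: e`_i) -> (forall i : 'I_n, H' e`_i = d' i *: e`_i) ->
  (H \o blk Y k \o H')%VF = (d k.1 * d' k.2) *: blk Y k.
Proof.
move=> Hd Hd'; apply/lfunP => v; rewrite scale_lfunE comp_lfunE comp_lfunE !blkE linearZ /= Hd.
by rewrite (coord_diag _ _ Hd') !scalerA; congr (_ *: _); ring.
Qed.

Lemma bracket_blk H (d : 'I_n -> Cplx R) Y k : (forall i : 'I_n, H e`_i = d i *: e`_i) ->
  bracket H (blk Y k) = (d k.1 - d k.2) *: blk Y k.
Proof.
move=> Hd; have h1 := @comp_blk_diag H \1%VF d (fun=> 1) Y k Hd.
have h2 := @comp_blk_diag \1%VF H (fun=> 1) d Y k.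
rewrite /bracket -[(H \o _)%VF]comp_lfun1r h1; last by move=> i; rewrite id_lfunE scale1r.
rewrite -[(blk _ _ \o _)%VF]comp_lfun1l comp_lfunA h2 //; last first.
  by move=> i; rewrite id_lfunE scale1r.
by rewrite mulr1 mul1r scalerBl.
Qed.

(** Both sides agree on each [e_i], since [Y e_i] is an eigenvector of [X] for the
    eigenvalue [c i + r]. *)
Lemma expm_bracket (X Y : 'End(V)) (c : 'I_n -> R) (r t : R) :
  (forall i : 'I_n, X e`_i = ofreal (c i) *: e`_i) -> bracket X Y = ofreal r *: Y ->
  (expm (ofreal t *: X) \o Y \o expm (- (ofreal t *: X)))%VF = ofreal (expR (t * r)) *: Y.
Proof.
move=> Xc XY; apply: lfun_basis_eq => i; rewrite !comp_lfunE scale_lfunE.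
rewrite (@expm_eigen _ _ (- (t * c i)) (- (ofreal t *: X))); last first.
  by rewrite opp_lfunE scale_lfunE Xc scalerA -ofrealM ofrealN scaleNr.
rewrite [Y _]linearZ [expm _ _]linearZ /= (@expm_eigen _ _ (t * (c i + r))).
  rewrite scalerA -ofrealM -expRD; congr (ofreal (expR _) *: _); ring.
rewrite scale_lfunE ofrealM -scalerA; congr (_ *: _).
have /eqP := congr1 (fun f : 'End(V) => f e`_i) XY.
rewrite /bracket add_lfunE opp_lfunE !comp_lfunE scale_lfunE Xc linearZ /= subr_eq => /eqP ->.
by rewrite -scalerDl -ofrealD addrC.
Qed.

End Diagonal.

(** * The root decomposition *)

Lemma expR_decay {R : realType} (r M eps : R) : r < 0 -> 0 <= M -> 0 < eps ->
  exists T : R, forall t, T <= t -> expR (t * r) * M < eps.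
Proof.
move=> r0 M0 eps0; have M1 : 0 < M + 1 by rewrite ltr_wpDl.
exists ((M + 1) / eps / (- r)) => t; rewrite ler_pdivrMr ?oppr_gt0 // mulrN => tT.
have h : (M + 1) / eps < expR (- (t * r)).
  by apply: lt_le_trans (expR_ge1Dx _); apply: le_lt_trans tT _; rewrite ltrDr.
have -> : expR (t * r) = (expR (- (t * r)))^-1 by rewrite expRN invrK.
rewrite mulrC ltr_pdivrMr ?expR_gt0 //; move: h; rewrite ltr_pdivrMr // mulrC.
by apply: lt_trans; rewrite ltrDl.
Qed.

Definition Ad {R : realType} {V : vectType (Cplx R)} (X : 'End(V)) (t : R) (Y : 'End(V)) :=
  (expm (ofreal t *: X) \o Y \o expm (- (ofreal t *: X)))%VF.

Section RootDecomposition.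
Context {R : realType} {V : vectType (Cplx R)} (dot : {dot V for Num.conj}).
Context (G a : set 'End(V)).
Hypothesis G_group : subgroupGL G.
Hypothesis G_theta : theta_group dot @` G `<=` G.
Hypothesis g_complex : complex_subspace (lie_algebra G).
Hypothesis a_max : max_abelian_in_p dot G a.
Context (Xo X : a).
Hypothesis Xo_regular : forall alpha : a -> R, is_root G alpha -> alpha Xo <> 0.
Hypothesis X_neg : forall alpha : a -> R, pos_root G Xo alpha -> alpha X < 0.
Hypothesis X_generic : forall mu nu : a -> R,
  weight mu -> weight nu -> mu <> nu -> mu X <> nu X.
Implicit Types (Y Z : 'End(V)) (H : a) (alpha beta : a -> R).

Let g := lie_algebra G.

Lemma complex_subspaceD Y Z : g Y -> g Z -> g (Y + Z).
Proof. by move=> gY gZ; have := g_complex.2 1 Y Z gY gZ; rewrite scale1r. Qed.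

Lemma complex_subspaceZ c Y : g Y -> g (c *: Y).
Proof. by move=> gY; have := g_complex.2 c Y 0 gY g_complex.1; rewrite addr0. Qed.

Lemma complex_subspace_sum (I : Type) (r : seq I) (P : pred I) (F : I -> 'End(V)) :
  (forall i, P i -> g (F i)) -> g (\sum_(i <- r | P i) F i).
Proof.
move=> gF; elim/big_ind: _ => //; first exact: g_complex.1.
by move=> *; exact: complex_subspaceD.
Qed.

Lemma a_lie H : g (\val H).
Proof. by have [_ ap _ _] := a_max; case: (ap _ (set_valP H)). Qed.

Lemma a_theta Y : a Y -> theta_lie dot Y = - Y.
Proof. by have [_ ap _ _] := a_max => /ap[]. Qed.

Lemma a_adjoint Y : a Y -> adjoint dot Y = Y.
Proof. by move=> /a_theta /oppr_inj. Qed.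

Lemma a_abelian : abelian_subset a.
Proof. by case: a_max. Qed.

Lemma root_space_theta alpha Y : root_space G alpha Y ->
  root_space G (fun H => - alpha H) (theta_lie dot Y).
Proof.
move=> [gY aY]; split; first exact: (lie_algebra_theta G_theta).
move=> H; rewrite -[\val H]opprK -(a_theta (set_valP H)).
have -> : bracket (- theta_lie dot (\val H)) (theta_lie dot Y) =
  - bracket (theta_lie dot (\val H)) (theta_lie dot Y).
  by rewrite /bracket comp_lfunNl comp_lfunNr opprB opprK addrC.
by rewrite theta_bracket aY theta_lieZ conj_ofreal ofrealN scaleNr.
Qed.

Lemma theta_lie0 : theta_lie dot (0 : 'End(V)) = 0.
Proof. by apply: (@addrI _ (theta_lie dot 0)); rewrite -theta_lieD !addr0. Qed.

Lemma theta_lie_eq0 Y : theta_lie dot Y = 0 -> Y = 0.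
Proof. by move=> h; rewrite -(theta_lieK dot Y) h theta_lie0. Qed.

Lemma neg_root alpha : is_root G alpha -> is_root G (fun H => - alpha H).
Proof.
move=> [da a0 [Y Y0 rY]]; split.
- by move=> s Y1 Z W WE; rewrite (da _ _ _ _ WE); ring.
- move=> h; apply: a0; apply/funext => H.
  by have /eqP := congr1 (fun f => f H) h; rewrite oppr_eq0 => /eqP.
- by exists (theta_lie dot Y); [move=> /theta_lie_eq0|exact: root_space_theta].
Qed.

Lemma lie_n0 : lie_n G Xo 0.
Proof.
exists 0%N, (fun _ => fun _ => 0), (fun _ => 0); split; first by case.
by rewrite big_ord0.
Qed.

Lemma lie_nD Y Z : lie_n G Xo Y -> lie_n G Xo Z -> lie_n G Xo (Y + Z).
Proof.
move=> [k1 [a1 [Z1 [h1 ->]]]] [k2 [a2 [Z2 [h2 ->]]]].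
exists (k1 + k2)%N, (fun i => match fintype.split i with inl j => a1 j | inr j => a2 j end).
exists (fun i => match fintype.split i with inl j => Z1 j | inr j => Z2 j end).
split; first by move=> i; case: fintype.split.
rewrite big_split_ord; congr (_ + _); apply: eq_bigr => i _.
  by rewrite (unsplitK (inl i : 'I_k1 + 'I_k2)).
by rewrite (unsplitK (inr i : 'I_k1 + 'I_k2)).
Qed.

(** If [alpha] were not positive, [- alpha] would be, as [theta] exchanges the two
    root spaces; but then [X_neg] gives [alpha X > 0]. *)
Lemma lie_n_root alpha Y : in_dual alpha -> alpha X < 0 -> root_space G alpha Y ->
  lie_n G Xo Y.
Proof.
move=> da aX rY; have [->|/eqP Y0] := eqVneq Y 0; first exact: lie_n0.
have ra : is_root G alpha.
  split => //; last by exists Y.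
  by move=> a0; move: aX; rewrite a0 ltxx.
exists 1%N, (fun=> alpha), (fun=> Y); split; last by rewrite big_ord1.
move=> _; split => //; split => //.
rewrite lt_neqAle eq_sym; apply/andP; split; first by apply/eqP; exact: Xo_regular.
rewrite leNgt; apply/negP => aXo.
have := X_neg (conj (neg_root ra) _); rewrite oppr_gt0 oppr_lt0 => /(_ aXo).
by rewrite ltNge (ltW aX).
Qed.

Lemma lie_nN Y : lie_n G Xo Y -> lie_n G Xo (- Y).
Proof.
move=> [k [al [Z [h ->]]]]; exists k, al, (fun i => - Z i); split; last by rewrite sumrN.
move=> i; have [pa [gZ rZ]] := h i; split => //; split.
  by rewrite -scaleN1r; exact: complex_subspaceZ.
by move=> H; rewrite scalerN -rZ /bracket comp_lfunNl comp_lfunNr opprB opprK addrC.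
Qed.

Lemma lie_n_lie Y : lie_n G Xo Y -> g Y.
Proof.
by move=> [k [al [Z [h ->]]]]; apply: complex_subspace_sum => i _; case: (h i) => _ [].
Qed.

Let n := dim V.

Section Basis.
Variables (e : n.-tuple V) (mu : 'I_n -> a -> R).
Hypothesis e_basis : basis_of fullv e.
Hypothesis mu_weight : forall i, weight (mu i).
Hypothesis e_weight : forall i, weight_space (mu i) e`_i.

Let K := ('I_n * 'I_n)%type.
Let chi (k : K) : a -> R := fun H => mu k.1 H - mu k.2 H.
Let b := blk e.

Let aE H (i : 'I_n) : \val H e`_i = ofreal (mu i H) *: e`_i.
Proof. exact: e_weight. Qed.

Lemma chi_dual k : in_dual (chi k).
Proof.
move=> s Y Z W WE; rewrite /chi.
by rewrite ((mu_weight k.1).1 _ _ _ _ WE) ((mu_weight k.2).1 _ _ _ _ WE); ring.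
Qed.

(** The part of [Y] on which [a] acts through the character [chi k]. *)
Let component (k : K) Y := \sum_(l | `[< chi l = chi k >]) b Y l.

(** The group elements [exp H], for [H] in [a], conjugate the Lie algebra into
    itself and separate the characters; interpolate between them. *)
Lemma component_lie k Y : g Y -> g (component k Y).
Proof.
move=> gY; pose T (H : a) (Z : 'End(V)) := (expm (\val H) \o Z \o (expm (\val H))^-1)%VF.
pose c (l : K) (H : a) := ofreal (expR (chi l H)).
rewrite /component.
have -> : \sum_(l | `[< chi l = chi k >]) b Y l = \sum_(l | `[< c l = c k >]) b Y l.
  apply: eq_bigl => l; apply/asboolP/asboolP => h; apply/funext => H.
    by rewrite /c h.
  by have := congr1 (fun f => f H) h => /ofreal_inj/expR_inj.
apply: (@isotypic_mem _ _ g _ _ _ T).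
- exact: g_complex.1.
- exact: g_complex.2.
- by move=> H Z gZ; apply: lie_algebra_conj => //; apply: lie_algebra_expm; exact: a_lie.
- move=> H d; rewrite /T comp_lfun_sumr comp_lfun_suml; apply: eq_bigr => l _.
  rewrite -comp_lfunZr -comp_lfunZl expm_inv.
  rewrite (@comp_blk_diag _ _ _ _ e_basis _ _ (fun i => ofreal (expR (mu i H)))
    (fun i => ofreal (expR (- mu i H)))) ?scalerA.
  + by rewrite -ofrealM -expRD.
  + by move=> i; apply: expm_eigen; exact: aE.
  + by move=> i; apply: expm_eigen; rewrite opp_lfunE aE ofrealN scaleNr.
- by rewrite sum_blk.
Qed.

Lemma component_root k Y : g Y -> root_space G (chi k) (component k Y).
Proof.
move=> gY; split; first exact: component_lie.
move=> H; rewrite /bracket comp_lfun_sumr comp_lfun_suml -sumrB scaler_sumr.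
apply: eq_bigr => l /asboolP lk.
have := @bracket_blk _ _ _ _ e_basis _ (fun i => ofreal (mu i H)) Y l (aE H).
by rewrite /bracket => ->; rewrite -ofrealN -ofrealD -[_ + _]/(chi l H) lk.
Qed.

(** The condition depends on the character only, so the entries can be grouped
    by characters. *)
Lemma component_sum (P : pred K) (S : set 'End(V)) (F : 'End(V) -> 'End(V)) Y :
  (forall k l, chi k = chi l -> P k = P l) ->
  S 0 -> (forall Z Z', S Z -> S Z' -> S (Z + Z')) ->
  F 0 = 0 -> {morph F : Z Z' / Z + Z'} ->
  (forall k, P k -> S (F (component k Y))) -> S (F (\sum_(k | P k) b Y k)).
Proof.
move=> Pchi S0 SD F0 FD SF.
pose r (k : K) : K := odflt k [pick l | `[< chi l = chi k >]].
have rchi k : chi (r k) = chi k.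
  by rewrite /r; case: pickP => [l /asboolP|/(_ k)/asboolP].
have rE k l : (r k == r l) = `[< chi k = chi l >].
  apply/eqP/asboolP => [h|h]; first by rewrite -rchi h rchi.
  rewrite /r (eq_pick (_ : _ =1 (fun m => `[< chi m = chi l >]))); last by move=> m; rewrite h.
  by case: pickP => // /(_ l)/asboolP.
rewrite (partition_big r xpredT) //=.
elim/big_ind: _ => [|Z Z' SZ SZ'|j _]; first by rewrite F0.
  by rewrite FD; exact: SD.
have [[k /andP[Pk /eqP rk]]|nk] := pselect (exists k, P k && (r k == j)).
  rewrite (eq_bigl (fun l => `[< chi l = chi k >])); first exact: SF.
  move=> l; rewrite -rk rE; case: asboolP => [/Pchi->|]; last by rewrite andbF.
  by rewrite Pk.
rewrite big_pred0 ?F0 // => k; apply/negbTE/negP => h; apply: nk; by exists k.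
Qed.

Let neg_part Y := \sum_(k | chi k X < 0) b Y k.
Let pos_part Y := \sum_(k | 0 < chi k X) b Y k.
Let zero_part Y := \sum_(k | chi k X == 0) b Y k.

Lemma parts_sum Y : Y = neg_part Y + pos_part Y + zero_part Y.
Proof.
rewrite -{1}(sum_blk e_basis Y) (bigID (fun k => chi k X == 0)) /= addrC; congr (_ + _).
rewrite (bigID (fun k => chi k X < 0)) /=; congr (_ + _); apply: eq_bigl => k.
  by rewrite lt_def; case: (ltgtP (chi k X) 0).
by case: (ltgtP (chi k X) 0).
Qed.

Lemma neg_part_n Y : g Y -> lie_n G Xo (neg_part Y).
Proof.
move=> gY; apply: (@component_sum _ (lie_n G Xo) id) => //.
- by move=> k l ->.
- exact: lie_n0.
- exact: lie_nD.
- by move=> k kX; apply: lie_n_root kX _; [exact: chi_dual|exact: component_root].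
Qed.

Lemma pos_part_n Y : g Y -> lie_n G Xo (theta_lie dot (pos_part Y)).
Proof.
move=> gY; apply: (@component_sum _ (lie_n G Xo) (theta_lie dot)) => //.
- by move=> k l ->.
- exact: lie_n0.
- exact: lie_nD.
- exact: theta_lie0.
- by move=> Z Z'; exact: theta_lieD.
- move=> k kX; apply: (@lie_n_root (fun H => - chi k H)).
  + by move=> s Y1 Z W WE; rewrite (chi_dual k WE); ring.
  + by rewrite oppr_lt0.
  + by apply: root_space_theta; exact: component_root.
Qed.

Lemma zero_part_lie Y : g Y -> g (zero_part Y).
Proof.
move=> gY; apply: (@component_sum _ g id) => //.
- by move=> k l ->.
- exact: g_complex.1.
- exact: complex_subspaceD.
- by move=> k _; exact: component_lie.
Qed.

Lemma weight_eq i j : mu i X = mu j X -> mu i = mu j.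
Proof. by move=> h; apply: contrapT => /(X_generic (mu_weight i) (mu_weight j)). Qed.

Lemma zero_part_commute Y (H : a) : bracket (\val H) (zero_part Y) = 0.
Proof.
rewrite /bracket comp_lfun_sumr comp_lfun_suml -sumrB big1 // => k /eqP.
rewrite /chi => /eqP; rewrite subr_eq0 => /eqP/weight_eq kE.
have := @bracket_blk _ _ _ _ e_basis _ (fun i => ofreal (mu i H)) Y k (aE H).
by rewrite /bracket => ->; rewrite kE subrr scale0r.
Qed.

End Basis.

Lemma theta_commute Y : (forall H : a, bracket (\val H) Y = 0) ->
  forall H : a, bracket (\val H) (theta_lie dot Y) = 0.
Proof.
move=> hY H; have := theta_bracket dot (\val H) Y.
rewrite hY theta_lie0 (a_theta (set_valP H)) /bracket comp_lfunNl comp_lfunNr opprK addrC => h.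
by rewrite -opprB h oppr0.
Qed.

(** Otherwise adding [W] to [a] would contradict maximality. *)
Lemma selfadjoint_centralizer W : g W -> adjoint dot W = W ->
  (forall H : a, bracket (\val H) W = 0) -> a W.
Proof.
move=> gW sW cW; have [[a0 aL] ap aab amax] := a_max.
have cW' (A : 'End(V)) : a A -> bracket A W = 0.
  by move=> aA; have := cW (exist _ A (mem_set aA)).
pose a' : set 'End(V) := [set Y | exists2 H, a H & exists s : R, Y = H + ofreal s *: W].
have <- : a' = a.
  apply: amax.
  - split; first by exists 0 => //; exists 0; rewrite ofreal0 scale0r addr0.
    move=> s _ _ [H aH [r ->]] [H' aH' [r' ->]].
    exists (ofreal s *: H + H'); first exact: aL.
    exists (s * r + r'); rewrite scalerDr ofrealD ofrealM scalerDl -scalerA.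
    by rewrite addrACA.
  - move=> _ [H aH [r ->]]; have [gH tH] := ap _ aH; split.
      by apply: complex_subspaceD => //; exact: complex_subspaceZ.
    by rewrite theta_lieD theta_lieZ conj_ofreal tH opprD /theta_lie sW scalerN.
  - move=> _ _ [H aH [r ->]] [H' aH' [r' ->]].
    have := aab H H' aH aH'; have := cW' _ aH; have := cW' _ aH'.
    rewrite /bracket => /eqP; rewrite subr_eq0 => /eqP h1.
    move=> /eqP; rewrite subr_eq0 => /eqP h2 /eqP; rewrite subr_eq0 => /eqP h3.
    apply/eqP; rewrite subr_eq0; apply/eqP.
    rewrite !comp_lfunDl !comp_lfunDr -!comp_lfunZl -!comp_lfunZr h1 h2 h3.
    rewrite -!addrA; congr (_ + _); rewrite !addrA; congr (_ + _); last first.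
      by rewrite !scalerA mulrC.
    by rewrite addrC.
  - by move=> H aH; exists H => //; exists 0; rewrite ofreal0 scale0r addr0.
exists 0; first exact: a0.
by exists 1; rewrite ofreal1 scale1r add0r.
Qed.

(** [Z] is [S + i D] with [S] and [D] selfadjoint; both lie in the complex Lie
    algebra, hence in [a], which acts on weight vectors by scalars. *)
Lemma centralizer_scalar Z (mu : a -> R) v : g Z -> (forall H : a, bracket (\val H) Z = 0) ->
  weight_space mu v -> exists c, Z v = c *: v.
Proof.
move=> gZ cZ muv; set Z' := adjoint dot Z.
have tZ : theta_lie dot Z = - Z' by [].
have gZ' : g Z'.
  rewrite -[Z']opprK -tZ -scaleN1r; apply: complex_subspaceZ.
  exact: lie_algebra_theta.
have brD (H : a) A B : bracket (\val H) (A + B) = bracket (\val H) A + bracket (\val H) B.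
  by rewrite /bracket comp_lfunDl comp_lfunDr opprD addrACA.
have brZ (H : a) c A : bracket (\val H) (c *: A) = c *: bracket (\val H) A.
  by rewrite /bracket -comp_lfunZl -comp_lfunZr scalerBr.
have cZ' (H : a) : bracket (\val H) Z' = 0.
  by rewrite -[Z']opprK -tZ -scaleN1r brZ theta_commute // scaler0.
have conj2 : ((2^-1 : Cplx R)^* = 2^-1)%R by rewrite fmorphV rmorph_nat.
pose S := 2^-1 *: (Z + Z'); pose D := (- 'i / 2) *: (Z - Z').
have aS : a S.
  apply: selfadjoint_centralizer.
  - by apply: complex_subspaceZ; exact: complex_subspaceD.
  - by rewrite /S adjointZ adjointD conj2 adjointK addrC.
  - by move=> H; rewrite brZ brD cZ cZ' addr0 scaler0.
have aD : a D.
  apply: selfadjoint_centralizer.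
  - apply: complex_subspaceZ; apply: complex_subspaceD => //.
    by rewrite -scaleN1r; exact: complex_subspaceZ.
  - rewrite /D adjointZ adjointD adjointN adjointK rmorphM /= conj2 rmorphN /= conjCi opprK.
    by rewrite -opprB scalerN -scaleNr mulNr.
  - by move=> H; rewrite /D brZ brD -(scaleN1r Z') brZ cZ cZ' scaler0 addr0 scaler0.
have ZE : Z = S + 'i *: D.
  rewrite /S /D scalerA mulrA mulrN -expr2 sqrCi opprK mul1r -scalerDr addrACA subrr addr0.
  have -> : Z + Z = 2 *: Z by rewrite scaler_nat mulr2n.
  by rewrite scalerA mulVf ?scale1r // pnatr_eq0.
clearbody S D.
have Zv : Z v = S v + 'i *: D v by rewrite {1}ZE add_lfunE scale_lfunE.
have hS : S v = _ := muv (exist _ S (mem_set aS)).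
have hD : D v = _ := muv (exist _ D (mem_set aD)).
rewrite Zv hS hD scalerA -scalerDl.
by exists (ofreal (mu (exist _ S (mem_set aS))) + 'i * ofreal (mu (exist _ D (mem_set aD)))).
Qed.

Lemma weight_basis_a : exists (e : n.-tuple V) (mu : 'I_n -> a -> R),
  [/\ basis_of fullv e, forall i, weight (mu i) & forall i, weight_space (mu i) e`_i].
Proof. exact: (weight_basis a_abelian a_adjoint). Qed.

(** Entry [(i, j)] of a matrix in a weight basis is an eigenvector of [X] with
    eigenvalue [mu i X - mu j X]. Sort the entries by its sign: on the zero part
    [mu i = mu j], so this part centralizes [a]. *)
Lemma root_decomposition : exists p1 p2 p3 : 'Hom('End(V), 'End(V)),
  (forall Y, Y = p1 Y + p2 Y + p3 Y) /\
  forall Y, g Y -> [/\ lie_n G Xo (p1 Y),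
    exists2 Z, lie_n G Xo Z & p2 Y = theta_lie dot Z &
    forall (mu : a -> R) v, weight_space mu v -> exists c, p3 Y v = c *: v].
Proof.
have [e [mu [eb mw ew]]] := weight_basis_a.
have lin (P : pred ('I_n * 'I_n)) : linear (fun Y => \sum_(k | P k) blk e Y k).
  move=> c Y Z; rewrite scaler_sumr -big_split; apply: eq_bigr => k _.
  exact: blk_linear.
have [p1 p1E] := lfun_of_linear (lin (fun k => mu k.1 X - mu k.2 X < 0)).
have [p2 p2E] := lfun_of_linear (lin (fun k => 0 < mu k.1 X - mu k.2 X)).
have [p3 p3E] := lfun_of_linear (lin (fun k => mu k.1 X - mu k.2 X == 0)).
exists p1, p2, p3; split=> [Y|Y gY].
  by rewrite p1E p2E p3E; exact: (@parts_sum e mu eb Y).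
split.
- by rewrite p1E; exact: (@neg_part_n e mu eb mw ew Y gY).
- exists (theta_lie dot (p2 Y)); last by rewrite theta_lieK.
  by rewrite p2E; exact: (@pos_part_n e mu eb mw ew Y gY).
- move=> nu v nuv; rewrite p3E; apply: (centralizer_scalar _ _ nuv).
    exact: (@zero_part_lie e mu eb ew Y gY).
  by move=> H; exact: (@zero_part_commute e mu eb mw ew Y H).
Qed.

Lemma Ad_root t alpha Y : root_space G alpha Y ->
  Ad (\val X) t Y = ofreal (expR (t * alpha X)) *: Y.
Proof.
have [e [mu [eb mw ew]]] := weight_basis_a => -[_ rY].
by apply: (expm_bracket eb t (fun i => ew i X) (rY X)).
Qed.

Lemma Ad_sum (I : Type) (r : seq I) (F : I -> 'End(V)) t :
  Ad (\val X) t (\sum_(i <- r) F i) = \sum_(i <- r) Ad (\val X) t (F i).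
Proof. by rewrite /Ad comp_lfun_sumr comp_lfun_suml. Qed.

Lemma lie_n_Ad t Y : lie_n G Xo Y -> lie_n G Xo (Ad (\val X) t Y).
Proof.
move=> [k [al [Z [h ->]]]]; exists k, al, (fun i => ofreal (expR (t * al i X)) *: Z i); split.
  move=> i; have [pa [gZ rZ]] := h i; split => //; split; first exact: complex_subspaceZ.
  move=> H; rewrite /bracket -comp_lfunZl -comp_lfunZr -scalerBr -/(bracket _ _) rZ.
  by rewrite !scalerA mulrC.
by rewrite Ad_sum; apply: eq_bigr => i _; have [_ rZ] := h i; rewrite (Ad_root _ rZ).
Qed.

(** On the root space of [alpha], [Ad] is multiplication by
    [expR (t * alpha X)], where [alpha X < 0]. *)
Lemma Ad_contracts Y (eps : R) : lie_n G Xo Y -> 0 < eps ->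
  exists T : R, forall t, T <= t -> mnrm (Ad (\val X) t Y) < eps.
Proof.
move=> [k [al [Z [h ->]]]]; move: eps.
elim/big_ind: _ => [eps eps0|Y1 Y2 h1 h2 eps eps0|i _ eps eps0].
- by exists 0 => t _; rewrite /Ad comp_lfun0r comp_lfun0l mnrm0.
- have e20 : 0 < eps / 2 by rewrite divr_gt0.
  have [T1 hT1] := h1 _ e20; have [T2 hT2] := h2 _ e20.
  exists (Num.max T1 T2) => t; rewrite ge_max => /andP[t1 t2].
  rewrite /Ad comp_lfunDr comp_lfunDl; apply: le_lt_trans (mnrmD _ _) _.
  by rewrite (splitr eps) ltrD //; [exact: hT1|exact: hT2].
have [pa rZ] := h i; have [T hT] := expR_decay (X_neg pa) (mnrm_ge0 (Z i)) eps0.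
exists T => t /hT; rewrite (Ad_root _ rZ) mnrmZ cabs_ofreal ger0_norm ?expR_ge0 //.
Qed.

End RootDecomposition.

(** * Strict derivatives and local surjectivity *)

(** Adjoin elements of [S] to a subspace until none is left; the dimension bounds
    the number of steps. *)
Lemma complex_subspace_vspace (R : realType) (W : vectType (Cplx R)) (S : set W) :
  S 0 -> (forall c u v, S u -> S v -> S (c *: u + v)) ->
  exists U : {vspace W}, forall w, w \in U <-> S w.
Proof.
move=> S0 SL; have sub k : (exists2 U : {vspace W}, (forall w, w \in U -> S w) & (k <= \dim U)%N)
    \/ exists U : {vspace W}, forall w, w \in U <-> S w.
  elim: k => [|k [[U US kU]|]]; last by right.
    by left; exists 0%VS => // w; rewrite memv0 => /eqP->.
  have [h|h] := pselect (forall w, S w -> w \in U).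
    by right; exists U => w; split; [exact: US|exact: h].
  have [w [Sw wU]] : exists w, S w /\ w \notin U.
    apply: contrapT => nh; apply: h => w Sw; apply/negPn/negP => wU.
    by apply: nh; exists w.
  left; exists (U + <[w]>)%VS => [u /memv_addP[u1 u1U [_ /vlineP[c ->] ->]]|].
    by rewrite addrC; apply: SL => //; exact: US.
  rewrite dimv_disjoint_sum ?dim_vline.
    by rewrite (_ : w != 0) ?addn1 ?ltnS //; apply: contraNneq wU => ->; exact: mem0v.
  apply/eqP; rewrite -subv0; apply/subvP => u; rewrite memv_cap memv0 => /andP[uU /vlineP[c uE]].
  apply/eqP; rewrite uE; have [->|c0] := eqVneq c 0; first by rewrite scale0r.
  case/negP: wU; rewrite -(scale1r w) -(mulVf c0) -scalerA -uE; exact: memvZ.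
case: (sub (dim W).+1) => // -[U _]; rewrite -dimvf ltnNge dimvS ?subvf //.
Qed.

Section StrictDerivative.
Context {R : realType} {V : vectType (Cplx R)}.
Implicit Types (Y Z A B : 'End(V)) (f g : 'End(V) -> 'End(V)) (L M : 'Hom('End(V), 'End(V))).

(** The derivative at [0] in the strict sense, which compares any two nearby
    points; this is what makes the iteration below contract. *)
Definition strict_derivative f L : Prop := f 0 = \1%VF /\
  forall eps : R, 0 < eps -> exists2 r : R, 0 < r &
    forall Y Z, mnrm Y < r -> mnrm Z < r ->
      mnrm (f Y - f Z - L (Y - Z)) <= eps * mnrm (Y - Z).

Lemma expm_strict_derivative L : strict_derivative (fun Y => expm (L Y)) L.
Proof.
split=> [|eps eps0]; first by rewrite linear0 expm0.
have [C C0 hC] := hom_bounded L.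
pose kappa : R := mnrm (\1%VF : 'End(V)); have k0 : 0 <= kappa by exact: mnrm_ge0.
have [r r0 hr] : exists2 r : R, 0 < r & (kappa + 1) * (expR r - 1) <= eps / C.
  have ek : 0 < eps / C / (kappa + 1) by rewrite !divr_gt0 // ltr_wpDl.
  have : expR x @[x --> (0 : R)] --> expR (0 : R) by exact: continuous_expR.
  rewrite expR0 => /cvgrPdist_lt/(_ _ ek).
  move=> /nbhs_ballP[d /= d0 hd]; exists (d / 2); first by rewrite divr_gt0.
  have := hd (d / 2); rewrite -ball_normE /= sub0r normrN gtr0_norm ?divr_gt0 // => h.
  have dd : d / 2 < d by lra.
  have /ltW := h dd; rewrite distrC => h2.
  rewrite mulrC -ler_pdivlMr ?ltr_wpDl //; apply: le_trans h2; exact: ler_norm.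
exists (r / C); first by rewrite divr_gt0.
have small Y : mnrm Y < r / C -> mnrm (L Y) <= r.
  by rewrite ltr_pdivlMr // mulrC => h; apply: le_trans (hC _) _; exact: ltW.
move=> Y Z /small Yr /small Zr; rewrite linearB.
apply: le_trans (expm_lipschitz Yr Zr) _.
have e1 : 0 <= expR r - 1 by rewrite subr_ge0 -expR0 ler_expR ltW.
apply: le_trans (_ : (kappa + 1) * (expR r - 1) * (C * mnrm (Y - Z)) <= _).
  apply: ler_pM; rewrite ?mulr_ge0 ?mnrm_ge0 //; last by rewrite -linearB; exact: hC.
  by rewrite ler_wpM2r // lerDl.
rewrite mulrA ler_wpM2r ?mnrm_ge0 // -ler_pdivlMr //.
Qed.

Lemma strict_derivative_bound f L : strict_derivative f L ->
  exists2 C : R, 0 < C & exists2 r : R, 0 < r & forall Y, mnrm Y < r ->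
    mnrm (f Y - \1%VF) <= C * mnrm Y.
Proof.
move=> [f0 df]; have [C C0 hC] := hom_bounded L.
have [r r0 h] := df _ (@ltr01 R); exists (1 + C); first by rewrite addr_gt0.
exists r => // Y Yr; have := h Y 0 Yr; rewrite mnrm0 f0 subr0 => /(_ r0) h1.
have -> : f Y - \1%VF = (f Y - \1%VF - L Y) + L Y by rewrite subrK.
by apply: le_trans (mnrmD _ _) _; rewrite mulrDl lerD.
Qed.

Lemma strict_derivative_comp f g L M : strict_derivative f L -> strict_derivative g M ->
  strict_derivative (fun Y => (f Y \o g Y)%VF) (L + M).
Proof.
move=> df dg; split=> [|eps eps0]; first by rewrite df.1 dg.1 comp_lfun1l.
have [Cf Cf0 [rf rf0 hf]] := strict_derivative_bound df.
have [Cg Cg0 [rg rg0 hg]] := strict_derivative_bound dg.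
have [CL CL0 hL] := hom_bounded L; have [CM CM0 hM] := hom_bounded M.
pose kappa : R := mnrm (\1%VF : 'End(V)); have k0 : 0 <= kappa by exact: mnrm_ge0.
pose B := kappa + 1; have B0 : 0 < B by rewrite ltr_wpDl.
have e1 : 0 < eps / (4 * B) by rewrite divr_gt0 // mulr_gt0.
have [r1 r10 h1] := df.2 _ e1; have [r2 r20 h2] := dg.2 _ e1.
have q0 C D : 0 < C -> 0 < D -> 0 < eps / (4 * C * D) by move=> *; rewrite divr_gt0 // !mulr_gt0.
pose r := \big[Num.min/1]_(x <- [:: rf; rg; r1; r2; Cf^-1; Cg^-1;
  eps / (4 * CL * Cg); eps / (4 * CM * Cf)]) x.
have [r0 [l1 [l2 [l3 [l4 [l5 [l6 [l7 l8]]]]]]]] : 0 < r /\ r <= rf /\ r <= rg /\ r <= r1 /\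
    r <= r2 /\ r <= Cf^-1 /\ r <= Cg^-1 /\ r <= eps / (4 * CL * Cg) /\ r <= eps / (4 * CM * Cf).
  split; first by rewrite /r !big_cons big_nil !lt_min rf0 rg0 r10 r20 !invr_gt0
    Cf0 Cg0 !q0 // ltr01.
  by do 7 (split; first by rewrite /r !big_cons !ge_min lexx ?orbT);
    rewrite /r !big_cons !ge_min lexx ?orbT.
exists r => // Y Z Yr Zr; set d := Y - Z; set nd := mnrm d.
have nd0 : 0 <= nd by exact: mnrm_ge0.
have one (W : 'End(V)) : mnrm (W - \1%VF) <= 1 -> mnrm W <= B.
  by move=> h; have := mnrmD (W - \1%VF) \1%VF; rewrite subrK -/kappa /B; lra.
have gY : mnrm (g Y - \1%VF) <= Cg * mnrm Y by apply: hg; exact: lt_le_trans Yr l2.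
have fZ : mnrm (f Z - \1%VF) <= Cf * mnrm Z by apply: hf; exact: lt_le_trans Zr l1.
have gYB : mnrm (g Y) <= B.
  apply: one; apply: le_trans gY _; rewrite mulrC -ler_pdivlMr // div1r.
  exact: ltW (lt_le_trans Yr l6).
have fZB : mnrm (f Z) <= B.
  apply: one; apply: le_trans fZ _; rewrite mulrC -ler_pdivlMr // div1r.
  exact: ltW (lt_le_trans Zr l5).
rewrite -/d; have -> : (f Y \o g Y)%VF - (f Z \o g Z)%VF - (L + M) d =
  ((f Y - f Z - L d) \o g Y)%VF + (L d \o (g Y - \1))%VF +
  ((f Z \o (g Y - g Z - M d))%VF + ((f Z - \1) \o M d)%VF).
  rewrite add_lfunE !comp_lfunDl !comp_lfunDr !comp_lfunNl !comp_lfunNr comp_lfun1l comp_lfun1r.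
  set x := (f Y \o g Y)%VF; set y := (f Z \o g Y)%VF; set z := (f Z \o g Z)%VF.
  rewrite [X in _ = X + _]addrA subrK [X in _ = _ + X]addrA subrK.
  by rewrite addrACA [X in _ = X + _]addrA subrK opprD.
apply: le_trans (mnrmD _ _) _.
have -> : eps * nd = (eps / 4 * nd + eps / 4 * nd) + (eps / 4 * nd + eps / 4 * nd) by field.
apply: lerD; apply: le_trans (mnrmD _ _) _; apply: lerD; apply: le_trans (mnrmM _ _) _.
- rewrite (_ : eps / 4 * nd = eps / (4 * B) * nd * B); last by field; lra.
  apply: ler_pM; rewrite ?mnrm_ge0 //; apply: h1.
    exact: lt_le_trans Yr l3.
  exact: lt_le_trans Zr l3.
- have h : mnrm (g Y - \1%VF) <= Cg * (eps / (4 * CL * Cg)).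
    by apply: le_trans gY _; rewrite ler_pM2l // ltW // (lt_le_trans Yr l7).
  rewrite (_ : eps / 4 * nd = CL * nd * (Cg * (eps / (4 * CL * Cg)))); last by field; lra.
  by apply: ler_pM; rewrite ?mnrm_ge0 //; exact: hL.
- rewrite (_ : eps / 4 * nd = B * (eps / (4 * B) * nd)); last by field; lra.
  apply: ler_pM; rewrite ?mnrm_ge0 //; apply: h2.
    exact: lt_le_trans Yr l4.
  exact: lt_le_trans Zr l4.
- have h : mnrm (f Z - \1%VF) <= Cf * (eps / (4 * CM * Cf)).
    by apply: le_trans fZ _; rewrite ler_pM2l // ltW // (lt_le_trans Zr l8).
  rewrite (_ : eps / 4 * nd = Cf * (eps / (4 * CM * Cf)) * (CM * nd)); last by field; lra.
  by apply: ler_pM; rewrite ?mnrm_ge0 //; exact: hM.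
Qed.

(** A solution of [f Y = g] is a fixed point of [Y |-> Y + (g - f Y)], which is a
    contraction by one half near [0]. *)
Lemma local_surjectivity f : strict_derivative f \1%VF -> forall r : R, 0 < r ->
  exists2 d : R, 0 < d & forall g : 'End(V), mnrm (g - \1%VF) < d ->
    exists2 Y, mnrm Y < r & f Y = g.
Proof.
move=> [f0 df] r0 r00; have half : 0 < (1 / 2 : R) by [].
have [r1 r10 h1] := df _ half.
pose r := Num.min r0 r1; have rpos : 0 < r by rewrite lt_min r00.
have h Y Z : mnrm Y < r -> mnrm Z < r -> mnrm (f Y - f Z - (Y - Z)) <= 1 / 2 * mnrm (Y - Z).
  rewrite !lt_min => /andP[_ Yr] /andP[_ Zr]; have := h1 Y Z Yr Zr.
  by rewrite id_lfunE.
exists (r / 4); first by rewrite divr_gt0.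
move=> g; set m := mnrm (g - \1%VF) => gm; have m0 : 0 <= m by exact: mnrm_ge0.
pose u := fix u k : 'End(V) := if k is j.+1 then u j + (g - f (u j)) else 0.
pose s k : R := 2 * m - 2 * m * (1 / 2) ^+ k.
have s0 : s 0 = 0 by rewrite /s expr0; ring.
have sS k : s k.+1 - s k = m * (1 / 2) ^+ k by rewrite /s exprS; field.
have s_le k : s k <= 2 * m by rewrite /s gerBl mulr_ge0 ?mulr_ge0 ?exprn_ge0.
have step k : mnrm (u k) <= s k /\ mnrm (u k.+1 - u k) <= m * (1 / 2) ^+ k.
  elim: k => [|k [uk dk]].
    by rewrite /= s0 mnrm0 lexx f0 add0r subr0 expr0 mulr1 -/m lexx.
  have uk1 : mnrm (u k.+1) <= s k.+1.
    rewrite -(subrK (u k) (u k.+1)); apply: le_trans (mnrmD _ _) _.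
    by have := sS k; lra.
  split => //.
  have small j : mnrm (u j) <= s j -> mnrm (u j) < r.
    by move=> hj; apply: le_lt_trans hj _; have := s_le j; lra.
  have -> : u k.+2 - u k.+1 = - (f (u k.+1) - f (u k) - (u k.+1 - u k)).
    rewrite {1}[u k.+2]/= -/(u k.+1) addrAC subrr add0r.
    have -> : u k.+1 - u k = g - f (u k) by rewrite /= addrAC subrr add0r.
    by rewrite opprB opprB addrA subrK.
  rewrite mnrmN; apply: le_trans (h _ _ (small _ uk1) (small _ uk)) _.
  by rewrite exprS mulrCA ler_pM2l.
have cauchy i j : (i <= j)%N -> mnrm (u j - u i) <= s j - s i.
  move=> /subnK <-; elim: (j - i)%N => [|k ih]; first by rewrite !subrr mnrm0.
  rewrite addSn; apply: le_trans (mnrm_tri _ (u (k + i)%N) _) _.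
  have := sS (k + i)%N; have := (step (k + i)%N).2; lra.
have K0 := @opscale_gt0 R V.
have [Y hY] : exists Y : 'End(V), forall k, mnrm (Y - u k) <= 2 * m - s k.
  have [i j ij|i|Y hY] := @nrm_cauchy _ _ u
    (fun k => s k / (@opscale R V)) (2 * m / (@opscale R V)).
  - by rewrite -mulrBl -mnrm_le; exact: cauchy.
  - by rewrite ler_pM2r ?invr_gt0.
  by exists Y => k; rewrite mnrm_le mulrBl.
have Yr : mnrm Y < r.
  by have := hY 0%N; rewrite s0 /= !subr0 => hY0; apply: le_lt_trans hY0 _; lra.
exists Y; first by move: Yr; rewrite lt_min => /andP[].
apply/eqP; rewrite -subr_eq0 -mnrm_eq0 eq_le mnrm_ge0 andbT.
have bound k : mnrm (f Y - g) <= (5 * m) * (1 / 2) ^+ k.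
  have ur : mnrm (u k) < r by apply: le_lt_trans (step k).1 _; have := s_le k; lra.
  have h2 : mnrm (f (u k) - g) <= m * (1 / 2) ^+ k.
    by have := (step k).2; rewrite /= addrAC subrr add0r mnrmC.
  have h3 : mnrm (f Y - f (u k)) <= 2 * mnrm (Y - u k).
    have hh := h _ _ Yr ur.
    rewrite -(subrK (Y - u k) (f Y - f (u k))); apply: le_trans (mnrmD _ _) _.
    have := mnrm_ge0 (Y - u k); lra.
  have h4 := hY k; apply: le_trans (mnrm_tri _ (f (u k)) _) _.
  by move: h4; rewrite /s; lra.
rewrite leNgt; apply/negP => pos.
have h12 : `|1 / 2 : R| < 1 by rewrite ger0_norm //; lra.
have c0 : (5 * m) * (1 / 2) ^+ k @[k --> \oo] --> (5 * m) * 0.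
  by apply: cvgM; [exact: cvg_cst|exact: cvg_expr].
rewrite mulr0 in c0; have /cvgrPdist_lt/(_ _ pos)[N _ /(_ N (leqnn N))] := c0.
rewrite /= sub0r normrN => hN; have := le_lt_trans (bound N) (le_lt_trans (ler_norm _) hN).
by rewrite ltxx.
Qed.

End StrictDerivative.

(** * Factorization of a closed group near the identity *)

Section ClosedSubgroup.
Context {R : realType} {V : vectType (Cplx R)} (G : set 'End(V)).
Hypothesis G_closed : closed_subgroupGL G.
Implicit Types (Y Z W g h : 'End(V)).

Let G_group : subgroupGL G := G_closed.1.

Lemma expm_continuous Y (eps : R) : 0 < eps -> exists2 d : R, 0 < d &
  forall Z, mnrm (Y - Z) < d -> mnrm (expm Y - expm Z) < eps.
Proof.
move=> eps0; pose y := mnrm Y + 1.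
pose C := mnrm (\1%VF : 'End(V)) * (expR y - 1) + 1.
have y0 : 0 <= y by rewrite addr_ge0 ?mnrm_ge0.
have C0 : 0 < C.
  by rewrite ltr_wpDl // mulr_ge0 ?mnrm_ge0 // subr_ge0 -expR0 ler_expR.
exists (Num.min 1 (eps / C)); first by rewrite lt_min ltr01 divr_gt0.
move=> Z; rewrite lt_min ltr_pdivlMr // => /andP[YZ1 YZ].
have Yy : mnrm Y <= y by rewrite /y lerDl.
have Zy : mnrm Z <= y.
  have := mnrmD (Z - Y) Y; rewrite subrK (mnrmC Z) /y; lra.
have := expm_lipschitz Yy Zy => h; apply: le_lt_trans YZ.
rewrite -(subrK (Y - Z) (expm Y - expm Z)); apply: le_trans (mnrmD _ _) _.
by rewrite /C mulrDr mulr1 lerD // mulrC.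
Qed.

Lemma group_endo_pow g k : G g -> G (endo_pow g k).
Proof.
have [_ G1 GM _] := G_group.
by move=> Gg; elim: k => [|k ih] //=; exact: GM.
Qed.

Lemma group_expmN Y : G (expm Y) -> G (expm (- Y)).
Proof. by have [_ _ _ GV] := G_group => /GV; rewrite expm_inv. Qed.

(** The exponential of an element outside the Lie algebra leaves [G] at some time,
    and then so do those of all nearby elements, since [G] is closed. *)
Lemma leaves_group W : ~ lie_algebra G W -> exists2 t : R, 0 <= t & exists2 eps : R, 0 < eps &
  forall Z, mnrm (ofreal t *: W - Z) < eps -> ~ G (expm Z).
Proof.
move=> nW.
have [t t0 nt] : exists2 t : R, 0 <= t & ~ G (expm (ofreal t *: W)).
  apply: contrapT => h; apply: nW => s; have [s0|s0] := leP 0 s.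
    by apply: contrapT => nG; apply: h; exists s.
  rewrite -[_ *: W]opprK -scaleNr -ofrealN; apply: group_expmN.
  by apply: contrapT => nG; apply: h; exists (- s) => //; rewrite oppr_ge0 ltW.
exists t => //; have nc : ~ closure (G : set (vtop 'End(V))) (expm (ofreal t *: W)).
  by move=> cG; apply: nt; apply: G_closed.2; split => //; exact: expm_GL.
have [eps eps0 he] : exists2 eps : R, 0 < eps &
    forall g, G g -> eps <= mnrm (g - expm (ofreal t *: W)).
  apply: contrapT => h; apply: nc; apply/closure_mnrmP => eps eps0.
  apply: contrapT => h2; apply: h; exists eps => // g Gg.
  by rewrite leNgt; apply/negP => lt; apply: h2; exists g.
have [d d0 hd] := expm_continuous (ofreal t *: W) eps0; exists d => // Z /hd.
by rewrite mnrmC => lt /he; rewrite leNgt lt.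
Qed.

Lemma nat_multiple (t d : R) : 0 <= t -> 0 < d ->
  exists k : nat, `|t - k%:R * d| <= d.
Proof.
move=> t0 d0; have td : 0 <= t / d by rewrite divr_ge0 // ltW.
exists (Num.truncn (t / d)); have /andP[] := truncn_itv td.
rewrite ler_pdivlMr // ltr_pdivrMr // -natr1 mulrDl mul1r => h1 h2.
by rewrite ger0_norm; lra.
Qed.

(** Normalizing elements of a complement of the Lie algebra whose exponentials
    lie in [G] and tend to [1] would give in the limit a unit vector whose whole
    one-parameter group lies in [G]. *)
Lemma transverse_trivial (U : {vspace 'End(V)}) : (forall Y, Y \in U <-> lie_algebra G Y) ->
  exists2 d : R, 0 < d & forall Z, Z \in (U^C)%VS -> mnrm Z < d -> G (expm Z) -> Z = 0.
Proof.
move=> UE; pose S := [set W : vtop 'End(V) | (W : 'End(V)) \in (U^C)%VS /\ mnrm (W : 'End(V)) = 1].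
have SK : compact S.
  apply: (@compact_mnrm _ _ _ 1) => [|W [_ ->]//]; apply: closed_mnrmP => W h; split.
    apply: vspace_closed => eps eps0; have [Z [ZU _] ZW] := h _ eps0.
    by exists Z => //; apply: le_lt_trans ZW; rewrite mnrmC; exact: nrm_le_mnrm.
  apply/eqP; rewrite -subr_eq0 -normr_eq0 eq_le normr_ge0 andbT.
  apply/ler_addgt0Pr => eps eps0; rewrite add0r.
  have [Z [_ Z1] ZW] := h _ eps0; rewrite -Z1 ler_norml.
  have := mnrmD (W - Z) Z; have := mnrmD (Z - W) W; rewrite !subrK (mnrmC W Z).
  by move=> h1 h2; apply/andP; split; lra.
have /compact_near_coveringP cov := SK.
pose P (d : R) (W : vtop 'End(V)) :=
  forall s : R, 0 < s < d -> ~ G (expm (ofreal s *: (W : 'End(V)))).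
have := cov R (0 : R)^'+ P (at_right_proper_filter 0).
have h (W : vtop 'End(V)) : S W -> \forall W' \near W & d \near (0 : R)^'+, P d W'.
  move=> [WU W1]; have nW : ~ lie_algebra G W.
    move=> /UE WinU; have : (W : 'End(V)) \in (U :&: U^C)%VS by rewrite memv_cap WinU.
    by rewrite capv_compl memv0 -mnrm_eq0 W1 oner_eq0.
  have [t t0 [eps eps0 ht]] := leaves_group nW.
  pose e1 := eps / (2 * (t + 1)); have t1 : 0 < t + 1 by rewrite ltr_wpDl.
  have e10 : 0 < e1 by rewrite divr_gt0 // mulr_gt0.
  have m20 : 0 < 1 + e1 by rewrite addr_gt0.
  exists ([set W' : vtop 'End(V) | mnrm ((W' : 'End(V)) - (W : 'End(V))) < e1],
          [set d | d < eps / (2 * (1 + e1))]).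
    split => /=; first by apply/nbhs_mnrmP; exists e1.
    by apply: nbhs_right_lt; rewrite divr_gt0 // mulr_gt0.
  move=> [W' d] /= [W'W dlt] s /andP[s0 sd] Gs.
  have [k hk] := nat_multiple t0 s0.
  apply: (ht (ofreal k%:R *: (ofreal s *: (W' : 'End(V))))); last first.
    by rewrite expm_natmul; exact: group_endo_pow.
  rewrite scalerA -ofrealM.
  have W'1 : mnrm (W' : 'End(V)) <= 1 + e1.
    have := mnrmD ((W' : 'End(V)) - (W : 'End(V))) (W : 'End(V)); rewrite subrK W1; lra.
  apply: le_lt_trans (mnrm_tri _ (ofreal t *: (W' : 'End(V))) _) _.
  rewrite -scalerBr -scalerBl -ofrealN -ofrealD !mnrmZ !cabs_ofreal (ger0_norm t0) mnrmC.
  have b1 : t * mnrm ((W' : 'End(V)) - (W : 'End(V))) <= t * e1 by rewrite ler_wpM2l // ltW.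
  have b2 : `|t - k%:R * s| * mnrm (W' : 'End(V)) <= s * (1 + e1).
    by apply: ler_pM => //; exact: mnrm_ge0.
  have b3 : s * (1 + e1) < eps / 2.
    rewrite -ltr_pdivlMr //; apply: lt_trans sd _; apply: lt_le_trans dlt _.
    by rewrite invfM mulrA.
  have b4 : t * e1 <= eps / 2.
    have -> : t * e1 = eps / 2 * (t / (t + 1)) by rewrite /e1; field; lra.
    rewrite ler_piMr ?divr_ge0 ?(ltW eps0) // ler_pdivrMr // mul1r; lra.
  by rewrite (splitr eps); apply: le_lt_trans (lerD b1 b2) _; lra.
move=> /(_ h) /nbhs_ballP[d /= d0 hd].
exists (d / 4); first by rewrite divr_gt0.
move=> Z ZU Zd GZ; apply/eqP/negPn/negP => Z0.
have m0 : 0 < mnrm Z by rewrite mnrm_gt0.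
pose W : 'End(V) := ofreal (mnrm Z)^-1 *: Z.
have SW : S W.
  split; first exact: memvZ.
  by rewrite mnrmZ cabs_ofreal ger0_norm ?invr_ge0 ?(ltW m0) // mulVf // gt_eqF.
have bd : ball (0 : R) d (d / 2).
  by rewrite -ball_normE /= sub0r normrN gtr0_norm ?divr_gt0 //; lra.
have d20 : 0 < d / 2 by rewrite divr_gt0.
apply: (hd _ bd d20 W SW (mnrm Z)); first by rewrite m0 /=; lra.
by rewrite scalerA -ofrealM mulfV ?gt_eqF // ofreal1 scale1r.
Qed.

(** Append the exponential of the component of [Y] in a complement of the Lie
    algebra. The resulting map has derivative [1] at [0], so it reaches all [g]
    near [1]; when [g] is in [G], so is the appended factor, which is then
    trivial. *)
Lemma local_factorization (p1 p2 p3 : 'Hom('End(V), 'End(V))) :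
  complex_subspace (lie_algebra G) ->
  (forall Y, Y = p1 Y + p2 Y + p3 Y) ->
  (forall Y, lie_algebra G Y ->
    [/\ lie_algebra G (p1 Y), lie_algebra G (p2 Y) & lie_algebra G (p3 Y)]) ->
  exists2 d : R, 0 < d & forall g, G g -> mnrm (g - \1%VF) < d ->
    exists2 Y, lie_algebra G Y & g = (expm (p1 Y) \o expm (p2 Y) \o expm (p3 Y))%VF.
Proof.
move=> [g0 gL] pE pg; have [U UE] := complex_subspace_vspace g0 gL.
pose q := projv U.
have qU Y : q Y \in U by exact: memv_proj.
have [s s0 hs] := transverse_trivial UE.
pose L4 : 'Hom('End(V), 'End(V)) := \1%VF - q.
have L4E Y : L4 Y = Y - q Y by rewrite /L4 add_lfunE opp_lfunE id_lfunE.
pose f Y := (expm ((p1 \o q)%VF Y) \o expm ((p2 \o q)%VF Y) \o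
  expm ((p3 \o q)%VF Y) \o expm (L4 Y))%VF.
have df : strict_derivative f \1%VF.
  have -> : \1%VF = (p1 \o q)%VF + (p2 \o q)%VF + (p3 \o q)%VF + L4.
    apply/lfunP => Y; rewrite add_lfunE add_lfunE add_lfunE !comp_lfunE -pE L4E.
    by rewrite id_lfunE addrC subrK.
  by do 3?apply: strict_derivative_comp; exact: expm_strict_derivative.
have [C C0 hC] := hom_bounded L4.
have [d d0 hd] := local_surjectivity df (divr_gt0 s0 C0).
exists d => // g Gg /hd[Y]; rewrite ltr_pdivlMr // mulrC => Ys fY.
have gqY : lie_algebra G (q Y) by apply/UE.
have [g1 g2 g3] := pg _ gqY.
have [_ _ GM GV] := G_group.
have G123 : G (expm (p1 (q Y)) \o expm (p2 (q Y)) \o expm (p3 (q Y)))%VF.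
  by apply: (GM); [apply: (GM)|]; apply: lie_algebra_expm.
have fE : f Y = (expm (p1 (q Y)) \o expm (p2 (q Y)) \o expm (p3 (q Y)) \o expm (L4 Y))%VF.
  by rewrite /f !comp_lfunE.
have L40 : L4 Y = 0.
  apply: hs.
  - by rewrite L4E; exact: memv_projC.
  - by apply: le_lt_trans Ys; exact: hC.
  - set E := (_ \o _ \o _)%VF in G123 fE.
    have k0 : lker E == 0%VS by case: G_group => sGL _ _ _; exact: sGL.
    rewrite (_ : expm (L4 Y) = (E^-1 \o g)%VF); last by rewrite -fY fE lker0_compKf.
    by apply: (GM) => //; exact: GV.
exists (q Y) => //; rewrite -fY fE L40 expm0 comp_lfun1r //.
Qed.

End ClosedSubgroup.

(** * Baire category *)

Section Baire.
Context {T : topologicalType}.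
Implicit Types (A B C : set T).

Definition nowhere_dense A : Prop := forall B, open B -> B `<=` closure A -> B = set0.

Lemma nowhere_dense_sub A B : A `<=` B -> nowhere_dense B -> nowhere_dense A.
Proof. by move=> AB nB C oC CA; apply: nB => //; apply: subset_trans CA _; exact: closureS. Qed.

Lemma nowhere_denseU A B : nowhere_dense A -> nowhere_dense B -> nowhere_dense (A `|` B).
Proof.
move=> nA nB C oC; rewrite closureU => CAB.
apply: nA => // x Cx; apply: contrapT => nAx.
have : (C `&` ~` closure A) = set0.
  apply: nB; first by apply: openI => //; exact/closed_openC/closed_closure.
  by move=> y [/CAB[]].
by move=> e; have : (C `&` ~` closure A) x by []; rewrite e.
Qed.

Lemma nowhere_dense_homeo (h h' : T -> T) A : continuous h -> continuous h' ->
  cancel h h' -> cancel h' h -> nowhere_dense A -> nowhere_dense (h @` A).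
Proof.
move=> ch ch' hK h'K nA B oB BA.
have : h @^-1` B = set0.
  apply: nA; first by apply: open_comp => // x _; exact: ch.
  move=> y /= By W nW.
  have nW' : nbhs (h y) (h' @^-1` W) by apply: ch'; rewrite hK.
  have [z [[a Aa <-] /=]] := BA _ By _ nW'; rewrite hK => Wa.
  by exists a.
move=> e; apply/seteqP; split=> // x Bx.
have : (h @^-1` B) (h' x) by rewrite /= h'K.
by rewrite e.
Qed.

(** Were all the [C k] nowhere dense, one could choose nonempty open sets [D k]
    with [closure (D k.+1)] inside [D k] and off [C k]. Compactness provides a
    point of all these closures, which no [C k] covers. *)
Lemma baire_cover (C : nat -> set T) (x0 : T) : compact [set: T] -> hausdorff_space T ->
  (forall k, closed (C k)) -> (forall x, exists k, C k x) ->
  exists k, ~ nowhere_dense (C k).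
Proof.
move=> cT hT cC cov; apply: contrapT => nk.
have nC k : nowhere_dense (C k) by apply: contrapT => h; apply: nk; exists k.
have /choice[F FP] : forall kB : nat * set T, exists B' : set T,
    open kB.2 -> kB.2 !=set0 -> [/\ open B', B' !=set0 & closure B' `<=` kB.2 `\` C kB.1].
  move=> [k B] /=; have [oB|noB] := pselect (open B); last by exists set0.
  have [B0|nB0] := pselect (B !=set0); last by exists set0.
  have [x [Bx nCx]] : exists x, B x /\ ~ C k x.
    apply: contrapT => h; have B0' : B = set0.
      apply: (nC k) => // x Bx; apply: subset_closure.
      by apply: contrapT => nCx; apply: h; exists x.
    by case: B0; rewrite B0'.
  have oBC : open (B `\` C k) by apply: openI => //; exact: closed_openC.
  have nx : nbhs x (B `\` C k) by apply: open_nbhs_nbhs; split.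
  have [D nD DB] := @compact_regular _ x setT hT cT filterT _ nx.
  exists (D°) => _ _; split; first exact: open_interior.
    by exists x; exact: nbhs_singleton (nbhs_interior nD).
  by apply: subset_trans DB; apply: closureS; exact: interior_subset.
pose D := fix D n := if n is j.+1 then F (j, D j) else setT.
have DP n : open (D n) /\ D n !=set0.
  elim: n => [|n [oD D0]] /=; first by split; [exact: openT|exists x0].
  by have [] := FP (n, D n) oD D0.
have Dsub n : closure (D n.+1) `<=` D n `\` C n.
  by have [oD D0] := DP n; have [] := FP (n, D n) oD D0.
have Dmono n m : (n <= m)%N -> D m `<=` D n.
  move=> /subnK <-; elim: (m - n)%N => [//|k ih]; rewrite addSn.
  apply: subset_trans ih => x Dx.
  by have /Dsub[] : closure (D (k + n).+1) x by exact: subset_closure.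
have PF : ProperFilter (filter_from [set: nat] D).
  apply: filter_from_proper; last by move=> n _; exact: (DP n).2.
  apply: filter_from_filter; first by exists 0%N.
  move=> i j _ _; exists (maxn i j) => // x Dx.
  by split; apply: (Dmono _ (maxn i j)); rewrite ?leq_maxl ?leq_maxr.
have [x [_ xcl]] := cT _ PF filterT.
have [k Ckx] := cov x.
have : closure (D k.+1) x.
  by move=> W nW; apply: xcl => //; exists k.+1.
by move=> /Dsub[].
Qed.

End Baire.

(** Otherwise the sets [A] with [I (K `\` A)] form a proper filter on [K]; a
    cluster point of it has no neighbourhood in [I]. *)
Lemma compact_ideal {X : topologicalType} (K : set X) (I : set X -> Prop) : compact K ->
  I set0 -> (forall A B, A `<=` B -> I B -> I A) -> (forall A B, I A -> I B -> I (A `|` B)) ->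
  (forall x, K x -> exists2 N, nbhs x N & I N) -> I K.
Proof.
move=> cK I0 IS IU loc; apply: contrapT => nIK.
pose F : set_system X := [set A | I (K `\` A)].
have PF : ProperFilter F.
  split; first by rewrite /F /= setD0.
  split; first by rewrite /F /= setDT.
    by move=> A B FA FB; rewrite /F /= setDIr; exact: IU.
  by move=> A B AB; apply: IS; exact: setDS.
have [|x [Kx xcl]] := cK F PF; first by rewrite /F /= setDv.
have [N nN IN] := loc x Kx.
have [|y [/= nNy Ny]] := xcl (~` N) N _ nN; last exact: nNy.
by apply: IS IN => y [_ /contrapT].
Qed.

(** * The group action on a closed orbit *)

Section ActionOnOrbit.
Context {R : realType} {V : vectType (Cplx R)} (G : set 'End(V)).
Hypothesis G_closed : closed_subgroupGL G.
Context (M : set (projspace V)).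
Hypothesis M_orbit : exists x : projspace V, M = proj_orbit G x.
Hypothesis M_closed : closed M.
Implicit Types (Y Z g h u : 'End(V)) (x y z : M) (v w : V).

Let GGL g : G g -> GL g. Proof. by have [[+ _ _ _] _] := G_closed; apply. Qed.
Let G1 : G \1%VF. Proof. by have [[]] := G_closed. Qed.
Let GM g h : G g -> G h -> G (g \o h)%VF.
Proof. by have [[_ _ + _] _] := G_closed; apply. Qed.
Let GV g : G g -> G (g^-1)%VF.
Proof. by have [[_ _ _ +] _] := G_closed; apply. Qed.

(** The default value [x] covers the [g] that do not preserve [M]; with it,
    [flow X t] is [act (expm (t X))] by definition. *)
Definition act g (x : M) : M := insubd x (proj_act g (\val x)).

Lemma proj_actM (p : projspace V) g h : G g -> G h ->
  proj_act g (proj_act h p) = proj_act (g \o h)%VF p.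
Proof.
move=> Gg Gh; have [v pv] := rep_ex p.
apply: (@rep_inj _ _ _ _ (g (h v))).
  by apply: (rep_act (GGL Gg)); exact: (rep_act (GGL Gh)).
by rewrite -comp_lfunE; apply: rep_act => //; apply: GGL; exact: GM.
Qed.

Lemma orbit_stable g (p : projspace V) : G g -> M p -> M (proj_act g p).
Proof.
move=> Gg; have [x0 ->] := M_orbit => -[h Gh <-].
by exists (g \o h)%VF; [exact: GM|rewrite proj_actM].
Qed.

Lemma val_act g x : G g -> \val (act g x) = proj_act g (\val x).
Proof.
move=> Gg; rewrite /act val_insubd ifT //; apply/mem_set.
by apply: orbit_stable => //; exact: set_valP.
Qed.

Lemma rep_actM g x v : G g -> rep (\val x) v -> rep (\val (act g x)) (g v).
Proof. by move=> Gg xv; rewrite val_act //; apply: rep_act => //; exact: GGL. Qed.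

Lemma repM_inj x y v : rep (\val x) v -> rep (\val y) v -> x = y.
Proof. by move=> xv yv; apply: val_inj; exact: rep_inj xv yv. Qed.

Lemma actM g h x : G g -> G h -> act g (act h x) = act (g \o h)%VF x.
Proof.
by move=> Gg Gh; apply: val_inj; rewrite !val_act ?proj_actM //; exact: GM.
Qed.

Lemma act1 x : act \1%VF x = x.
Proof.
have [v xv] := rep_ex (\val x); apply: (repM_inj _ xv).
by have := rep_actM G1 xv; rewrite id_lfunE.
Qed.

Lemma actK g : G g -> cancel (act g) (act (g^-1)%VF).
Proof. by move=> Gg x; rewrite actM ?lker0_compVf ?act1 //; [exact: GGL|exact: GV]. Qed.

Lemma actVK g : G g -> cancel (act (g^-1)%VF) (act g).
Proof. by move=> Gg x; rewrite actM ?lker0_compfV ?act1 //; [exact: GGL|exact: GV]. Qed.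

Lemma act_transitive x y : exists2 g, G g & y = act g x.
Proof.
have [x0 ME] := M_orbit.
have : proj_orbit G x0 (\val x) by rewrite -ME; exact: set_valP.
have : proj_orbit G x0 (\val y) by rewrite -ME; exact: set_valP.
move=> [h Gh hy] [g Gg gx]; exists (h \o g^-1)%VF; first by apply: GM => //; exact: GV.
apply: val_inj; rewrite val_act; last by apply: GM => //; exact: GV.
rewrite -gx -hy proj_actM //; last by apply: GM => //; exact: GV.
by rewrite -comp_lfunA lker0_compVf ?comp_lfun1r //; exact: GGL.
Qed.

Lemma nbhs_MP x v (B : set M) : rep (\val x) v ->
  (nbhs x B <-> exists2 e : R, 0 < e &
    forall w y, nrm (w - v) < e -> rep (\val y) w -> B y).
Proof.
move=> xv; split.
  move=> /nbhs_setval[W /(nbhs_projP _ xv)[e e0 eW] WB].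
  by exists e => // w y wv yw; apply: WB; exact: eW wv yw.
move=> [e e0 eB]; apply/nbhs_setval.
exists [set p | exists2 w, rep p w & nrm (w - v) < e]; last first.
  by move=> y [w yw wv]; exact: eB wv yw.
by apply/(nbhs_projP _ xv); exists e => // w p wv pw; exists w.
Qed.

Lemma hausdorff_M : hausdorff_space M.
Proof.
move=> x y xy; apply: val_inj; apply: hausdorff_projspace => A B nA nB.
have pre (z : M) (W : set (projspace V)) : nbhs (\val z) W -> nbhs z (\val @^-1` W).
  by move=> nW; apply/nbhs_setval; exists W.
by have [z [Az Bz]] := xy _ _ (pre _ _ nA) (pre _ _ nB); exists (\val z).
Qed.

Lemma compact_M : compact [set: M].
Proof.
have cM : compact M by apply: (subclosed_compact M_closed (@compact_projspace R V)).
move=> F PF _.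
have [|p [Mp pcl]] := cM ((\val : M -> projspace V) @ F) (fmap_proper_filter _ PF).
  by apply: (@filterS _ F _ setT) filterT => x _; exact: set_valP.
exists (exist _ p (mem_set Mp)); split => // A B FA /nbhs_setval[W nW WB].
have n1 : ((\val : M -> projspace V) @ F) ((\val : M -> projspace V) @` A).
  by apply: (@filterS _ F _ A _ _ FA) => y Ay; exists y.
have [_ [[y Ay <-] Wy]] := pcl _ _ n1 nW.
by exists y; split => //; exact: WB.
Qed.

(** Joint continuity of the action, in terms of representatives. *)
Lemma act_near g x v (B : set M) : G g -> rep (\val x) v -> nbhs (act g x) B ->
  exists2 d : R, 0 < d & forall h w y, G h -> mnrm (h - g) < d -> nrm (w - v) < d ->
    rep (\val y) w -> B (act h y).
Proof.
move=> Gg xv /(nbhs_MP _ (rep_actM Gg xv))[e e0 eB].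
pose C := nrm v + 1 + mnrm g; have C0 : 0 < C.
  by rewrite /C -addrA ltr_wpDl ?nrm_ge0 // ltr_pwDl ?mnrm_ge0.
exists (Num.min 1 (e / C)); first by rewrite lt_min ltr01 divr_gt0.
move=> h w y Gh; rewrite !lt_min !ltr_pdivlMr // => /andP[_ hg] /andP[w1 wv] yw.
apply: (eB (h w)); last exact: rep_actM.
have -> : h w - g v = (h - g) w + g (w - v).
  by rewrite add_lfunE opp_lfunE linearB /= addrA subrK.
have nw : nrm w <= nrm v + 1.
  by have := nrmD (w - v) v; rewrite subrK; lra.
apply: le_lt_trans (nrmD _ _) _.
have b1 : nrm ((h - g) w) <= mnrm (h - g) * (nrm v + 1).
  by apply: le_trans (nrm_lfun _ _) _; rewrite ler_wpM2l ?mnrm_ge0.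
have b2 : nrm (g (w - v)) <= mnrm g * nrm (w - v) by exact: nrm_lfun.
have [v0 g0] : 0 <= nrm v /\ 0 <= mnrm g by split; [exact: nrm_ge0|exact: mnrm_ge0].
pose m := Num.max (mnrm (h - g)) (nrm (w - v)).
have [m1 m2] : mnrm (h - g) <= m /\ nrm (w - v) <= m by rewrite !le_max !lexx orbT.
have mC : m * C < e by rewrite /m maxEle; case: ifP.
apply: le_lt_trans mC; rewrite /C mulrDr [X in _ <= _ + X]mulrC.
apply: lerD; first by apply: le_trans b1 _; rewrite ler_wpM2r //; lra.
by apply: le_trans b2 _; rewrite ler_wpM2l.
Qed.

Lemma act_continuous g : G g -> continuous (act g).
Proof.
move=> Gg x B nB; have [v xv] := rep_ex (\val x).
have [d d0 hd] := act_near Gg xv nB.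
apply/(nbhs_MP _ xv); exists d => // w y wv yw; apply: (hd g w y) => //.
by rewrite subrr mnrm0.
Qed.

Lemma near_identity_GL g : mnrm (g - \1%VF) < 1 -> GL g.
Proof.
move=> g1; apply/lker0P => v w gvw; apply/eqP; rewrite -subr_eq0 -nrm_eq0.
have e : nrm (v - w) = nrm ((g - \1%VF) (v - w)).
  by rewrite add_lfunE opp_lfunE id_lfunE linearB /= gvw subrr sub0r nrmN.
apply/negPn/negP => n0; have pos : 0 < nrm (v - w) by rewrite lt_neqAle eq_sym n0 nrm_ge0.
have := nrm_lfun (g - \1%VF) (v - w); rewrite -e leNgt => /negP; apply.
by rewrite gtr_pMl.
Qed.

Let ballG (eps : R) : set 'End(V) := [set g | G g /\ mnrm (g - \1%VF) <= eps].

Let orbmap (x : M) (S : set 'End(V)) : set M := [set act g x | g in S `&` G].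

Lemma compact_orbmap x (S : set (vtop 'End(V))) : compact S -> S `<=` G ->
  compact (orbmap x S).
Proof.
move=> cS SG; rewrite /orbmap (_ : S `&` G = S); last by apply/setIidl.
have : {within S, continuous (fun g : vtop 'End(V) => act (g : 'End(V)) x)}.
  apply/subspace_continuousP => g Sg B nB; have [v xv] := rep_ex (\val x).
  have [d d0 hd] := act_near (SG _ Sg) xv nB.
  rewrite /= /within /=; apply/nbhs_mnrmP; exists d => // h hg Sh.
  by apply: (hd h v x) => //; [exact: SG|rewrite subrr nrm0].
by move=> /continuous_compact /(_ cS).
Qed.

Lemma compact_ballG (eps : R) : eps < 1 -> compact (ballG eps : set (vtop 'End(V))).
Proof.
move=> eps1; apply: (@compact_mnrm _ _ _ (eps + mnrm (\1%VF : 'End(V)))) => [|g [_ ge]].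
  apply: closed_mnrmP => g h.
  have ge : mnrm (g - \1%VF) <= eps.
    apply/ler_addgt0Pr => e e0; have [g' [_ g'e] g'g] := h _ e0.
    by apply: le_trans (mnrm_tri _ g' _) _; rewrite addrC lerD // mnrmC ltW.
  split => //; apply: G_closed.2; split.
    by apply/closure_mnrmP => e /h[g' [Gg' _] g'g]; exists g'.
  by apply: near_identity_GL; exact: le_lt_trans ge eps1.
by have := mnrmD (g - \1%VF) \1%VF; rewrite subrK; lra.
Qed.

(* [G] is the union of these sets: the bounds are on [g] and on its inverse. *)
Let bigG (k : nat) : set 'End(V) :=
  [set g | [/\ G g, mnrm g <= k%:R & forall v, nrm v <= k%:R * nrm (g v)]].

Lemma compact_bigG k : compact (bigG k : set (vtop 'End(V))).
Proof.
apply: (@compact_mnrm _ _ _ k%:R) => [|g []//]; apply: closed_mnrmP => g h.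
have gk : mnrm g <= k%:R.
  apply/ler_addgt0Pr => e e0; have [g' [_ g'k _] g'g] := h _ e0.
  have := mnrmD (g - g') g'; rewrite subrK (mnrmC g) => hh; lra.
have gv v : nrm v <= k%:R * nrm (g v).
  apply/ler_addgt0Pr => e e0.
  have C0 : 0 < k%:R * nrm v + 1 by rewrite ltr_wpDl // mulr_ge0 ?nrm_ge0.
  have [g' [_ _ g'v] g'g] := h _ (divr_gt0 e0 C0).
  move: g'g; rewrite ltr_pdivlMr // => g'g.
  apply: le_trans (g'v v) _.
  have b : nrm (g' v) <= nrm (g v) + mnrm (g' - g) * nrm v.
    have := nrmD ((g' - g) v) (g v); have := nrm_lfun (g' - g) v.
    by rewrite add_lfunE opp_lfunE subrK; lra.
  apply: le_trans (_ : k%:R * (nrm (g v) + mnrm (g' - g) * nrm v) <= _).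
    by rewrite ler_wpM2l.
  rewrite mulrDr lerD2l mulrCA; apply: le_trans (ltW g'g).
  by rewrite ler_wpM2l ?mnrm_ge0 // lerDl.
split => //; apply: G_closed.2; split.
  by apply/closure_mnrmP => e /h[g' [Gg' _] _]; exists g'.
apply/lker0P => v w gvw; apply/eqP; rewrite -subr_eq0 -nrm_eq0 eq_le nrm_ge0 andbT.
by apply: le_trans (gv _) _; rewrite linearB /= gvw subrr nrm0 mulr0.
Qed.

Lemma bigG_cover g : G g -> exists k, bigG k g.
Proof.
move=> Gg; pose c := Num.max (mnrm g) (mnrm (g^-1)%VF).
have c0 : 0 <= c by rewrite le_max mnrm_ge0.
have [k ck] : exists k : nat, c <= k%:R.
  by exists (Num.bound c); apply: ltW; exact: archi_boundP.
exists k; split => //; first by apply: le_trans ck; rewrite le_max lexx.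
move=> v; rewrite -{1}(lker0_lfunK (GGL Gg) v); apply: le_trans (nrm_lfun _ _) _.
by rewrite ler_wpM2r ?nrm_ge0 //; apply: le_trans ck; rewrite le_max lexx orbT.
Qed.

(** The orbit map is open at the identity: [M] is a countable union of compact
    sets, each covered by finitely many translates of the orbit of a small ball. *)
Lemma ball_orbit_not_nowhere_dense x (eps : R) : 0 < eps -> eps < 1 ->
  ~ nowhere_dense (orbmap x (ballG eps)).
Proof.
move=> eps0 eps1 nd.
have cov z : exists k, orbmap x (bigG k) z.
  have [g Gg ->] := act_transitive x z; have [k gk] := bigG_cover Gg.
  by exists k; exists g.
have cl k : closed (orbmap x (bigG k)).
  apply: compact_closed; first exact: hausdorff_M.
  by apply: compact_orbmap; [exact: compact_bigG|move=> g []].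
have [k nk] := baire_cover x compact_M hausdorff_M cl cov; apply: nk.
pose I := fun S : set (vtop 'End(V)) => nowhere_dense (orbmap x S).
change (I (bigG k)); apply: (compact_ideal (@compact_bigG k)).
- move=> B oB; rewrite /I /orbmap set0I image_set0 closure0 => B0.
  by apply/seteqP; split.
- by move=> A B AB; apply: nowhere_dense_sub; apply: image_subset; exact: setSI.
- move=> A B nA nB; rewrite /I /orbmap setIUl image_setU; exact: nowhere_denseU.
move=> g [Gg _ _].
have C0 : 0 < mnrm (g^-1)%VF + 1 by rewrite ltr_wpDl ?mnrm_ge0.
exists [set h : vtop 'End(V) | mnrm ((h : 'End(V)) - g) < eps / (mnrm (g^-1)%VF + 1)].
  by apply/nbhs_mnrmP; exists (eps / (mnrm (g^-1)%VF + 1)) => //; rewrite divr_gt0.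
apply: (nowhere_dense_sub (B := act g @` orbmap x (ballG eps))).
  move=> _ [h [/= hg Gh] <-]; exists (act (g^-1 \o h)%VF x).
    exists (g^-1 \o h)%VF => //; have GVh : G (g^-1 \o h)%VF by apply: GM => //; exact: GV.
    split => //; split => //.
    have -> : (g^-1 \o h)%VF - \1%VF = (g^-1 \o (h - g))%VF.
      by rewrite comp_lfunDr comp_lfunNr lker0_compVf //; exact: GGL.
    apply: le_trans (mnrmM _ _) _; move: hg; rewrite ltr_pdivlMr // => hg.
    by apply: ltW; apply: le_lt_trans hg; rewrite mulrC ler_wpM2l ?mnrm_ge0 // lerDl.
  rewrite actM //; last by apply: GM => //; exact: GV.
  by rewrite comp_lfunA lker0_compfV ?comp_lfun1l //; exact: GGL.
apply: (nowhere_dense_homeo (h' := act (g^-1)%VF)) => //.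
- exact: act_continuous.
- by apply: act_continuous; exact: GV.
- exact: actK.
- exact: actVK.
Qed.

(** The closed orbit of a ball of radius [eps] has an interior point [act u x].
    Applying the inverse of [u] moves it to [x], at the cost of doubling the
    radius and of a factor that bounds that inverse. *)
Lemma orbit_nbhs x (d : R) : 0 < d ->
  nbhs x [set act g x | g in [set g | G g /\ mnrm (g - \1%VF) < d]].
Proof.
move=> d0; pose kappa : R := mnrm (\1%VF : 'End(V)).
have k0 : 0 <= kappa by exact: mnrm_ge0.
have K0 : 0 < 4 * kappa + 1 by rewrite ltr_wpDl // mulr_ge0.
pose eps := Num.min (1 / 2) (d / (2 * (4 * kappa + 1))).
have eps0 : 0 < eps by rewrite lt_min; apply/andP; split; [lra|rewrite divr_gt0 // mulr_gt0].
have eps2 : eps <= 1 / 2 by rewrite ge_min lexx.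
have epsd : eps * (4 * kappa + 1) < d.
  have : eps <= d / (2 * (4 * kappa + 1)) by rewrite ge_min lexx orbT.
  rewrite ler_pdivlMr ?mulr_gt0 // (mulrCA eps) => h.
  have := mulr_gt0 eps0 K0; lra.
have eps1 : eps < 1 by lra.
have := @ball_orbit_not_nowhere_dense x _ eps0 eps1.
move=> /existsNP[B /not_implyP[oB /not_implyP[Bcl /eqP/set0P[y By]]]].
have clE : closure (orbmap x (ballG eps)) = orbmap x (ballG eps).
  apply/esym/closure_id; apply: compact_closed; first exact: hausdorff_M.
  by apply: compact_orbmap; [exact: compact_ballG|move=> g []].
rewrite clE in Bcl; have [u [[Gu ue] _] yE] := Bcl _ By.
have nB : nbhs (act u x) B by rewrite yE; apply: open_nbhs_nbhs.
have nx : nbhs x (act u @^-1` B) by exact: (act_continuous Gu (x := x) nB).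
apply: filterS nx => z /= /Bcl[u' [[Gu' u'e] _] u'x].
have GVu : G (u^-1)%VF by exact: GV.
exists (u^-1 \o u')%VF; last by rewrite -actM // u'x actK.
split; first exact: GM.
have uV : mnrm (u^-1)%VF <= 2 * kappa.
  have e : (u^-1)%VF = \1%VF - (u^-1 \o (u - \1))%VF.
    rewrite comp_lfunDr comp_lfunNr comp_lfun1r lker0_compVf; last exact: GGL.
    by rewrite subKr.
  have b1 : mnrm (u^-1 \o (u - \1))%VF <= mnrm (u^-1)%VF * (1 / 2).
    apply: le_trans (mnrmM _ _) _; rewrite ler_wpM2l ?mnrm_ge0 //; exact: le_trans ue eps2.
  have b3 := mnrmB \1%VF (u^-1 \o (u - \1))%VF.
  move: b3; rewrite -[X in mnrm X <= _]e -/kappa => b3; lra.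
have -> : (u^-1 \o u')%VF - \1%VF = (u^-1 \o (u' - u))%VF.
  by rewrite comp_lfunDr comp_lfunNr lker0_compVf //; exact: GGL.
apply: le_lt_trans (mnrmM _ _) _.
have b2 : mnrm (u' - u) <= 2 * eps.
  have := mnrm_tri u' \1%VF u; rewrite (mnrmC \1%VF u); lra.
apply: le_lt_trans (_ : 2 * kappa * (2 * eps) < d);
  first exact: (ler_pM (mnrm_ge0 _) (mnrm_ge0 _) uV b2).
by apply: le_lt_trans epsd; rewrite mulrDr mulr1 mulrCA; lra.
Qed.

End ActionOnOrbit.

(** * Weighted means of eigenvalues *)

Section WeightedMean.
Context {R : realType} (n : nat).
Implicit Types (c p W : 'I_n -> R).

(** Chebyshev: increasing weights raise the mean, because the difference of the
    cross products is half of
    [\sum_i \sum_j p i * p j * (W j - W i) * (c j - c i)]. *)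
Lemma weighted_mean_lt c p W : (forall i, 0 <= p i) -> (forall i, 0 < W i) ->
  (forall i j, c i < c j -> W i < W j) ->
  (exists i j, [/\ 0 < p i, 0 < p j & c i < c j]) ->
  (\sum_i c i * p i) / (\sum_i p i) < (\sum_i c i * (W i * p i)) / (\sum_i W i * p i).
Proof.
move=> p0 W0 cW [i0 [j0 [pi0 pj0 cij]]].
have sp : 0 < \sum_i p i.
  by rewrite (bigD1 i0) //= ltr_wpDr // sumr_ge0.
have sW : 0 < \sum_i W i * p i.
  rewrite (bigD1 i0) //= ltr_wpDr ?mulr_gt0 // sumr_ge0 // => i _.
  by rewrite mulr_ge0 // ltW.
rewrite ltr_pdivrMr // mulrAC ltr_pdivlMr // -subr_gt0.
pose T i j := p i * p j * ((W j - W i) * (c j - c i)).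
have T0 i j : 0 <= T i j.
  apply: mulr_ge0; first exact: mulr_ge0.
  have [lt|lt|->] := ltgtP (c i) (c j); last by rewrite subrr mulr0.
    by rewrite mulr_ge0 // subr_ge0 ltW // cW.
  by rewrite mulr_le0 // subr_le0 ltW // cW.
have TE : \sum_i \sum_j T i j = 2 * ((\sum_i c i * (W i * p i)) * (\sum_i p i) -
   (\sum_i c i * p i) * (\sum_i W i * p i)).
  pose S F H := \sum_(i < n) \sum_(j < n) (F i * H j) : R.
  have SE F H : S F H = (\sum_i F i) * (\sum_j H j) by rewrite /S big_distrlr.
  have -> : \sum_i \sum_j T i j = S p (fun j => c j * (W j * p j)) -
     S (fun i => c i * p i) (fun j => W j * p j) - S (fun i => W i * p i) (fun j => c j * p j)
     + S (fun i => c i * (W i * p i)) p.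
    rewrite /S -!sumrB -big_split; apply: eq_bigr => i _ /=.
    by rewrite -!sumrB -big_split; apply: eq_bigr => j _; rewrite /T /=; ring.
  by rewrite !SE; ring.
have : 0 < \sum_i \sum_j T i j.
  rewrite (bigD1 i0) //= ltr_wpDr //; first by apply: sumr_ge0 => i _; exact: sumr_ge0.
  rewrite (bigD1 j0) //= ltr_wpDr //; first exact: sumr_ge0.
  by rewrite !mulr_gt0 // subr_gt0 // cW.
by rewrite TE pmulr_rgt0.
Qed.

End WeightedMean.

Section Rayleigh.
Context {R : realType} {V : vectType (Cplx R)} (n : nat) (e : n.-tuple V).
Hypothesis e_basis : basis_of fullv e.
Variable c : 'I_n -> R.
Implicit Types (v w : V).

(** The Rayleigh quotient of the diagonal operator with entries [c]. *)
Definition rayleigh v : R :=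
  (\sum_i c i * cabs (coord e i v) ^+ 2) / (\sum_i cabs (coord e i v) ^+ 2).

Lemma coord_neq0 v : v != 0 -> exists i, coord e i v != 0.
Proof.
move=> v0; apply: contrapT => h; move/eqP: v0; apply.
rewrite (basis_expansion e_basis v) big1 // => i _.
have [->|ci] := eqVneq (coord e i v) 0; first by rewrite scale0r.
by case: h; exists i.
Qed.

Lemma sqnorm_gt0 v : v != 0 -> 0 < \sum_i cabs (coord e i v) ^+ 2.
Proof.
move=> /coord_neq0[i ci]; rewrite (bigD1 i) //= ltr_wpDr //.
  by apply: sumr_ge0 => j _; rewrite exprn_ge0 ?cabs_ge0.
by rewrite exprn_gt0 // cabs_gt0.
Qed.

Lemma rayleighZ k v : k != 0 -> rayleigh (k *: v) = rayleigh v.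
Proof.
move=> k0; have K0 : cabs k ^+ 2 != 0 by rewrite sqrf_eq0 cabs_eq0.
have E i : cabs (coord e i (k *: v)) ^+ 2 = cabs k ^+ 2 * cabs (coord e i v) ^+ 2.
  by rewrite linearZ /= cabsM exprMn.
have S1 : \sum_i cabs (coord e i (k *: v)) ^+ 2 = cabs k ^+ 2 * \sum_i cabs (coord e i v) ^+ 2.
  by rewrite mulr_sumr; apply: eq_bigr => i _.
have S2 : \sum_i c i * cabs (coord e i (k *: v)) ^+ 2 =
    cabs k ^+ 2 * \sum_i c i * cabs (coord e i v) ^+ 2.
  by rewrite mulr_sumr; apply: eq_bigr => i _; rewrite E mulrCA.
by rewrite /rayleigh S1 S2 -mulf_div divff // mul1r.
Qed.

Lemma sqcoord_continuous i :
  continuous (fun v : vtop V => cabs (coord e i (v : V)) ^+ 2).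
Proof.
have cc : continuous (fun v : vtop V => cabs (coord e i (v : V)) : R).
  move=> v; apply/(@cvgrPdist_lt _ _ _ _ (nbhs_filter (v : vtop V))) => eps eps0.
  have [|k u|d d0 hd] := @seminorm_continuous _ _ (fun v => cabs (coord e i v)) _ _ v _ eps0.
  - by move=> u w /=; rewrite linearD; exact: cabsD.
  - by rewrite linearZ /= cabsM.
  by apply: filterS (nrm_near v d0) => u /hd; rewrite distrC.
by move=> v; apply: (@cvg_comp _ _ _ _ (fun r : R => r ^+ 2) _ _ _ (cc v)); exact: exprn_continuous.
Qed.

Lemma rayleigh_continuous (v : vtop V) : (v : V) != 0 ->
  {for v, continuous (rayleigh : vtop V -> R)}.
Proof.
move=> v0; have s0 := sqnorm_gt0 v0;
have sum_cvg (g : 'I_n -> vtop V -> R) : (forall i, g i u @[u --> v] --> g i v) ->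
    \sum_i g i u @[u --> v] --> \sum_i g i v.
  move=> gv; have FF := nbhs_filter (v : vtop V).
  by apply: (@cvg_big _ _ _ _ xpredT (@add_continuous R)) => i _; exact: gv.
rewrite /prop_for /continuous_at; have FF := nbhs_filter (v : vtop V); apply: cvgM.
  by apply: sum_cvg => i; apply: cvgM; [exact: cvg_cst|exact: sqcoord_continuous].
by apply: cvgV; [rewrite gt_eqF|apply: sum_cvg => i; exact: sqcoord_continuous].
Qed.

End Rayleigh.

(** * The flow of a diagonalizable element *)

Section DiagonalFlow.
Context {R : realType} {V : vectType (Cplx R)} (G : set 'End(V)).
Hypothesis G_closed : closed_subgroupGL G.
Context (M : set (projspace V)).
Hypothesis M_orbit : exists x : projspace V, M = proj_orbit G x.
Hypothesis M_closed : closed M.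
Context (n : nat) (e : n.-tuple V).
Hypothesis e_basis : basis_of fullv e.
Implicit Types (Y g h : 'End(V)) (x y z : M) (v w : V) (c : 'I_n -> R).

Let e_free : free e := basis_free e_basis.

Definition rayleighM c x : R := rayleigh e c (sval (cid (rep_ex (\val x)))).

Lemma rayleighME c x v : rep (\val x) v -> rayleighM c x = rayleigh e c v.
Proof.
rewrite /rayleighM; case: cid => /= w xw xv.
by have [k k0 ->] := rep_colinear xw xv; rewrite rayleighZ.
Qed.

Lemma rayleighM_continuous c : continuous (rayleighM c).
Proof.
move=> x B; have [v xv] := rep_ex (\val x); rewrite (rayleighME c xv).
move=> nB; have /nbhs_nrmP[d d0 dB] := rayleigh_continuous e_basis (c := c) xv.1 nB.
apply/(nbhs_MP _ xv); exists d => // w y wv yw.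
by rewrite /= (rayleighME c yw); exact: dB.
Qed.

Section Generator.
Variables (X : 'End(V)) (c : 'I_n -> R).
Hypothesis GX : lie_algebra G X.
Hypothesis X_diag : forall i : 'I_n, X e`_i = ofreal (c i) *: e`_i.

Lemma coord_flow t i v :
  coord e i (expm (ofreal t *: X) v) = ofreal (expR (t * c i)) * coord e i v.
Proof.
have Ed (j : 'I_n) : expm (ofreal t *: X) e`_j = ofreal (expR (t * c j)) *: e`_j.
  by apply: expm_eigen; rewrite scale_lfunE X_diag scalerA ofrealM.
exact: (coord_diag e_basis (d := fun j => ofreal (expR (t * c j))) i v Ed).
Qed.

Lemma rep_flow t x v : rep (\val x) v -> rep (\val (flow X t x)) (expm (ofreal t *: X) v).
Proof. exact: (rep_actM G_closed M_orbit (GX t)). Qed.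

Lemma flow0 x : flow X 0 x = x.
Proof.
have -> : flow X 0 x = act (expm (ofreal 0 *: X)) x by [].
by rewrite ofreal0 scale0r expm0 (act1 G_closed M_orbit).
Qed.

Lemma flowD s t x : flow X (s + t) x = flow X s (flow X t x).
Proof.
by have := actM G_closed M_orbit x (GX s) (GX t); rewrite -expm_scaleD => /esym.
Qed.

Lemma flow_jointly_continuous : continuous (fun u : R * M => flow X u.1 u.2).
Proof.
move=> [t x] B /= nB; have [v xv] := rep_ex (\val x).
have [d d0 hd] := act_near G_closed M_orbit (GX t) xv nB.
have [d1 d10 hd1] := expm_continuous (ofreal t *: X) d0.
have C0 : 0 < mnrm X + 1 by rewrite ltr_wpDl ?mnrm_ge0.
exists (ball t (d1 / (mnrm X + 1)), [set y : M | exists2 w, nrm (w - v) < d & rep (\val y) w]).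
  split; first by apply: nbhsx_ballx; rewrite divr_gt0.
  by apply/(nbhs_MP _ xv); exists d => // w y wv yw; exists w.
move=> [s y] [/= st [w wv yw]]; apply: (hd _ w y (GX s) _ wv yw).
rewrite mnrmC; apply: hd1; rewrite -scalerBl -ofrealN -ofrealD mnrmZ cabs_ofreal.
move: st; rewrite /ball /= ltr_pdivlMr //; apply: le_lt_trans.
by rewrite ler_wpM2l // lerDl.
Qed.

Lemma flow_rest_diag x v k : rep (\val x) v ->
  (forall i, coord e i v != 0 -> c i = k) -> restset (flow X) x.
Proof.
move=> xv ck t; apply: (repM_inj (v := expm (ofreal t *: X) v)); first exact: rep_flow.
have -> : expm (ofreal t *: X) v = ofreal (expR (t * k)) *: v.
  rewrite (basis_expansion e_basis (expm _ v)) {2}(basis_expansion e_basis v) scaler_sumr.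
  apply: eq_bigr => i _; rewrite coord_flow scalerA.
  by have [->|/ck ->] := eqVneq (coord e i v) 0; rewrite ?mulr0.
by apply: rep_scale => //; rewrite ofreal_eq0 gt_eqF // expR_gt0.
Qed.

Lemma rayleighM_increasing x v t i j : rep (\val x) v -> 0 < t ->
  coord e i v != 0 -> coord e j v != 0 -> c i < c j ->
  rayleighM c x < rayleighM c (flow X t x).
Proof.
move=> xv t0 vi vj cij; rewrite (rayleighME c xv) (rayleighME c (rep_flow t xv)) /rayleigh.
have E k : cabs (coord e k (expm (ofreal t *: X) v)) ^+ 2 =
    expR (t * c k) ^+ 2 * cabs (coord e k v) ^+ 2.
  by rewrite coord_flow cabsM cabs_ofreal ger0_norm ?expR_ge0 // exprMn.
under [X in _ < X / _]eq_bigr do rewrite E.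
under [X in _ < _ / X]eq_bigr do rewrite E.
apply: weighted_mean_lt.
- by move=> k; rewrite exprn_ge0 ?cabs_ge0.
- by move=> k; rewrite exprn_gt0 ?expR_gt0.
- by move=> k l kl; rewrite ltr_pXn2r ?nnegrE ?expR_ge0 // ltr_expR ltr_pM2l.
by exists i, j; rewrite !exprn_gt0 ?cabs_gt0.
Qed.

(** Two distinct eigenvalues in [v] would make the Rayleigh quotient increase. *)
Lemma flow_rest_eigen x v : rep (\val x) v -> restset (flow X) x ->
  exists k, forall i, coord e i v != 0 -> c i = k.
Proof.
move=> xv fx; have [i vi] := coord_neq0 e_basis xv.1; exists (c i) => j vj.
have lt k l : coord e k v != 0 -> coord e l v != 0 -> ~ c k < c l.
  by move=> vk vl /(rayleighM_increasing xv ltr01 vk vl); rewrite fx ltxx.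
by have [/(lt _ _ vj vi)|/(lt _ _ vi vj)|] := ltgtP (c j) (c i).
Qed.

Lemma flow_lyapunov x t : 0 < t -> ~ restset (flow X) x ->
  rayleighM c x < rayleighM c (flow X t x).
Proof.
move=> t0 nx; have [v xv] := rep_ex (\val x).
have [i vi] := coord_neq0 e_basis xv.1.
have [j /not_implyP[vj cj]] : exists j, ~ (coord e j v != 0 -> c j = c i).
  by apply/existsNP => h; apply: nx; exact: (flow_rest_diag xv h).
have [lt|lt|//] := ltgtP (c j) (c i).
  exact: (rayleighM_increasing xv t0 vj vi).
exact: (rayleighM_increasing xv t0 vi vj).
Qed.

Lemma vanishing_sum (I : Type) (r : seq I) (F : I -> R -> V) :
  (forall i (eps : R), 0 < eps -> exists T : R, forall t, T <= t -> nrm (F i t) < eps) ->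
  forall eps : R, 0 < eps -> exists T : R, forall t, T <= t -> nrm (\sum_(i <- r) F i t) < eps.
Proof.
move=> h; elim: r => [|i r ih] eps eps0.
  by exists 0 => t _; rewrite big_nil nrm0.
have e20 : 0 < eps / 2 by rewrite divr_gt0.
have [T1 h1] := h i _ e20; have [T2 h2] := ih _ e20.
exists (Num.max T1 T2) => t; rewrite ge_max big_cons => /andP[t1 t2].
apply: le_lt_trans (nrmD _ _) _; rewrite (splitr eps).
by apply: ltrD; [exact: h1|exact: h2].
Qed.

(** Rescaled by the largest exponential, [expm (t X) v] tends to the component
    of [v] on the eigenspace of the largest eigenvalue that occurs in [v]. *)
Lemma flow_forward x : exists2 p, restset (flow X) p & stable (flow X) p x.
Proof.
have [v xv] := rep_ex (\val x); have [i0 vi0] := coord_neq0 e_basis xv.1.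
have [i vi imax] : exists2 i, coord e i v != 0 & forall j, coord e j v != 0 -> c j <= c i.
  by case: (@arg_maxP _ _ _ i0 (fun i => coord e i v != 0) c vi0) => i; exists i.
pose m := c i; pose w := \sum_(j | c j == m) coord e j v *: e`_j.
have cw j : coord e j w = if c j == m then coord e j v else 0.
  rewrite /w big_mkcond (eq_bigr (fun k : 'I_n => (if c k == m then coord e k v else 0) *: e`_k)).
    by rewrite coord_sum_free.
  by move=> k _; case: ifP; rewrite ?scale0r.
have w0 : w != 0.
  by apply: contraNneq vi => w0; have := cw i; rewrite w0 linear0 eqxx => <-.
pose u t := ofreal (expR (- (t * m))) *: expm (ofreal t *: X) v.
have ux t : rep (\val (flow X t x)) (u t).
  by apply: rep_scale; [exact: rep_flow|rewrite ofreal_eq0 gt_eqF // expR_gt0].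
have uw eps : 0 < eps -> exists T : R, forall t, T <= t -> nrm (u t - w) < eps.
  move=> eps0.
  suff [T hT] : exists T : R, forall t, T <= t ->
      nrm (\sum_j (coord e j (u t) - coord e j w) *: e`_j) < eps.
    exists T => t /hT; rewrite [X in nrm X < _ -> _](_ : _ = u t - w) //.
    by under eq_bigr do rewrite -linearB; rewrite -(basis_expansion e_basis).
  apply: (@vanishing_sum _ _ (fun (j : 'I_n) t =>
    (coord e j (u t) - coord e j w) *: e`_j) _ _ eps0) => j del del0; rewrite cw.
  have cu t : coord e j (u t) = ofreal (expR (t * (c j - m))) * coord e j v.
    by rewrite linearZ /= coord_flow mulrA -ofrealM -expRD mulrBr addrC.
  have [cj|cj] := eqVneq (c j) m.
    exists 0 => t _; rewrite cu cj subrr mulr0 expR0 ofreal1 mul1r subrr scale0r.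
    by rewrite nrm0.
  have [vj|vj] := eqVneq (coord e j v) 0.
    by exists 0 => t _; rewrite cu vj mulr0 subr0 scale0r nrm0.
  have jm : c j - m < 0 by rewrite subr_lt0 lt_neqAle cj imax.
  have K0 : 0 <= cabs (coord e j v) * nrm e`_j by rewrite mulr_ge0 ?cabs_ge0 ?nrm_ge0.
  have [T hT] := expR_decay jm K0 del0; exists T => t /hT.
  by rewrite cu subr0 nrmZ cabsM cabs_ofreal ger0_norm ?expR_ge0 // mulrA.
have [p0 pw] := point_ex w0.
have Mp : M p0.
  apply: M_closed => B /(nbhs_projP _ pw)[eps eps0 eB].
  have [T hT] := uw _ eps0; exists (\val (flow X T x)); split; first exact: set_valP.
  by apply: eB (ux T); exact: hT.
pose p : M := exist _ p0 (mem_set Mp).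
exists p.
  apply: (@flow_rest_diag p w m pw) => j; rewrite cw.
  by case: (eqVneq (c j) m) => // _; rewrite eqxx.
move=> B /(nbhs_MP _ (pw : rep (\val p) w))[eps eps0 eB]; have [T hT] := uw _ eps0.
exists T; split => [|t Tt]; first exact: num_real.
by apply: eB (ux t); apply: hT; exact: ltW.
Qed.

End Generator.

Lemma flow_reversed X : flow (M := M) (- X) = reversed (flow X).
Proof.
apply/funext => t; apply/funext => x.
by rewrite /reversed /flow ofrealN scaleNr scalerN.
Qed.

(** The backward limits are forward limits for [- X]. *)
Lemma flow_gradient_like X c : lie_algebra G X ->
  (forall i : 'I_n, X e`_i = ofreal (c i) *: e`_i) ->
  gradient_like (flow (M := M) X) (rayleighM c).
Proof.
move=> GX Xc; split.
- exact: compact_M.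
- exact: hausdorff_M.
- exact: flow0.
- exact: flowD.
- exact: flow_jointly_continuous.
- exact: rayleighM_continuous.
- by move=> x t; exact: flow_lyapunov.
- exact: flow_forward Xc.
have GX' : lie_algebra G (- X).
  by move=> s; rewrite scalerN -scaleNr -ofrealN; exact: GX.
have Xc' i : (- X) e`_(nat_of_ord i) = ofreal (- c i) *: e`_i.
  by rewrite opp_lfunE Xc ofrealN scaleNr.
move=> x; have [p] := flow_forward GX' Xc' x.
by rewrite flow_reversed restset_reversed; exists p.
Qed.

End DiagonalFlow.

(** * Contracted exponentials *)

Section ContractedExponentials.
Context {R : realType} {V : vectType (Cplx R)} (G : set 'End(V)).
Hypothesis G_closed : closed_subgroupGL G.
Context (M : set (projspace V)).
Hypothesis M_orbit : exists x : projspace V, M = proj_orbit G x.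
Implicit Types (Y Z : 'End(V)) (s : set 'End(V)) (x y z p : M) (B : set M).

Lemma flow_Ad X t Y x : lie_algebra G X -> lie_algebra G Y ->
  lie_algebra G (Ad X t Y) ->
  flow X t (act (expm Y) x) = act (expm (Ad X t Y)) (flow X t x).
Proof.
move=> GX /lie_algebra_expm GY /lie_algebra_expm GY'.
have -> : flow X t (act (expm Y) x) = act (expm (ofreal t *: X)) (act (expm Y) x) by [].
have -> : flow X t x = act (expm (ofreal t *: X)) x by [].
rewrite (actM G_closed M_orbit x (GX t) GY) (actM G_closed M_orbit x GY' (GX t)).
congr (act _ x); rewrite /Ad -(expm_conj Y (expmVl _) (expmVr _)).
by rewrite -[RHS]comp_lfunA expmVl comp_lfun1r.
Qed.

(** Conjugation by the flow shrinks the elements of [s] to zero, so that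
    [expm Y] displaces a trajectory less and less as time goes on. *)
Lemma contracting_expm X s : lie_algebra G X -> s `<=` lie_algebra G ->
  (forall Y, s Y -> s (- Y)) ->
  (forall t Y, s Y -> s (Ad X t Y)) ->
  (forall Y (eps : R), s Y -> 0 < eps ->
     exists T : R, forall t, T <= t -> mnrm (Ad X t Y) < eps) ->
  contracting (flow (M := M) X) [set act (expm Y) | Y in s].
Proof.
move=> GX sG sN sAd sctr; split.
- move=> _ [Y sY <-]; have GY := lie_algebra_expm (sG _ sY).
  exists (act (expm (- Y))); first by exists (- Y) => //; exact: sN.
  rewrite -expm_inv; split; [exact: (actK G_closed M_orbit GY)|].
  exact: (actVK G_closed M_orbit GY).
- move=> _ [Y sY <-]; apply: (act_continuous G_closed M_orbit).
  by apply: lie_algebra_expm; exact: sG.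
- move=> _ p z [Y sY <-] Fp zp B nB; have [v pv] := rep_ex (\val p).
  have G1 : G \1%VF by have [[]] := G_closed.
  have nB1 : nbhs (act \1%VF p) B by rewrite (act1 G_closed M_orbit).
  have [d d0 hd] := act_near G_closed M_orbit G1 pv nB1.
  have [d1 d10 hd1] := expm_continuous (0 : 'End(V)) d0.
  have [T hT] := sctr Y d1 sY d10.
  have nW : nbhs p [set y : M | exists2 w, nrm (w - v) < d & rep (\val y) w].
    by apply/(nbhs_MP _ pv); exists d => // w y wv yw; exists w.
  have [t0 _ ht0] := stable_near zp nW.
  exists (Num.max T t0); split => [|t]; first exact: num_real.
  rewrite gt_max => /andP[/ltW Tt /ltW t0t].
  have sY' := sAd t Y sY; have [w wv yw] := ht0 _ t0t.
  rewrite /= flow_Ad; [|exact: GX|exact: sG|exact: sG].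
  apply: (hd _ w) => //; first by apply: lie_algebra_expm; exact: sG.
  by rewrite -expm0 mnrmC; apply: hd1; rewrite sub0r mnrmN; exact: hT.
move=> _ t [Y sY <-]; have sY' := sAd t Y sY.
exists (act (expm (Ad X t Y))); first by exists (Ad X t Y).
move=> x; rewrite flow_Ad; [|exact: GX|exact: sG|exact: sG].
by rewrite -(flowD G_closed M_orbit GX) subrr (flow0 G_closed M_orbit).
Qed.

End ContractedExponentials.

(** * The special flow *)

Section SpecialFlow.
Context {R : realType} {V : vectType (Cplx R)} (dot : {dot V for Num.conj}).
Context (G : set 'End(V)).
Hypothesis G_closed : closed_subgroupGL G.
Hypothesis G_theta : theta_group dot @` G `<=` G.
Hypothesis g_complex : complex_subspace (lie_algebra G).
Context (a : set 'End(V)).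
Hypothesis a_max : max_abelian_in_p dot G a.
Context (Xo X : a).
Hypothesis Xo_regular : forall alpha : a -> R, is_root G alpha -> alpha Xo <> 0.
Hypothesis X_neg : forall alpha : a -> R, pos_root G Xo alpha -> alpha X < 0.
Hypothesis X_generic : forall mu nu : a -> R,
  weight mu -> weight nu -> mu <> nu -> mu X <> nu X.
Context (M : set (projspace V)).
Hypothesis M_orbit : exists x : projspace V, M = proj_orbit G x.
Hypothesis M_closed : closed M.
Implicit Types (Y Z : 'End(V)) (x y z p : M) (v w : V).

Let phi : R -> M -> M := flow (val X).
Let GX : lie_algebra G (val X) := a_lie a_max X.

Lemma special_flow_gradient_like : exists f, gradient_like phi f.
Proof.
have [e [mu [eb _ ew]]] := weight_basis_a a_max.
exists (rayleighM (M := M) e (fun i => mu i X)).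
exact: (flow_gradient_like G_closed M_orbit M_closed eb GX (fun i => ew i X)).
Qed.

(** As the values [mu X] separate the weights, a fixed line lies in one weight
    space. *)
Lemma rest_weight p v : restset phi p -> rep (\val p) v ->
  exists mu : a -> R, weight_space mu v.
Proof.
move=> Fp pv; have [e [mu [eb mw ew]]] := weight_basis_a a_max.
have [k hk] := flow_rest_eigen G_closed M_orbit eb GX (fun i => ew i X) pv Fp.
have [i0 vi0] := coord_neq0 eb pv.1; exists (mu i0) => Y.
rewrite {1}(basis_expansion eb v) {2}(basis_expansion eb v) linear_sum scaler_sumr.
apply: eq_bigr => i _; rewrite linearZ /= ew !scalerA mulrC.
have [->|vi] := eqVneq (coord e i v) 0; first by rewrite !mulr0.
suff -> : mu i = mu i0 by [].
by apply: contrapT => /(X_generic (mw i) (mw i0)); rewrite (hk _ vi) (hk _ vi0).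
Qed.

Definition actN : set (M -> M) := [set act (expm Y) | Y in lie_n G Xo].

Definition act_thetaN : set (M -> M) :=
  [set act (expm Y) | Y in theta_lie dot @` lie_n G Xo].

Let n_lie Y : lie_n G Xo Y -> lie_algebra G Y := lie_n_lie g_complex (Y := Y).

Let theta_n_lie : theta_lie dot @` lie_n G Xo `<=` lie_algebra G.
Proof. by move=> _ [Z nZ <-]; apply: (lie_algebra_theta G_theta); exact: n_lie. Qed.

Lemma contracting_N : contracting phi actN.
Proof.
apply: (contracting_expm G_closed M_orbit GX).
- exact: n_lie.
- by move=> Y; exact: lie_nN.
- by move=> t Y; exact: (lie_n_Ad g_complex a_max).
- by move=> Y eps; exact: (Ad_contracts a_max X_neg).
Qed.

Lemma theta_Ad t Z : Ad (- val X) t (theta_lie dot Z) = theta_lie dot (Ad (val X) t Z).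
Proof.
have aX s : adjoint dot (ofreal s *: val X) = ofreal s *: val X.
  by rewrite adjointZ conj_ofreal (a_adjoint a_max (set_valP X)).
rewrite /Ad /theta_lie !adjoint_comp !adjoint_expm adjointN aX comp_lfunNr comp_lfunNl.
by rewrite scalerN opprK comp_lfunA.
Qed.

(** The involution [theta] reverses the flow, as [theta X = - X]. *)
Lemma contracting_thetaN : contracting (reversed phi) act_thetaN.
Proof.
have GX' : lie_algebra G (- val X).
  by move=> s; rewrite scalerN -scaleNr -ofrealN; exact: GX.
rewrite /phi -flow_reversed; apply: (contracting_expm G_closed M_orbit GX') => //.
- move=> _ [Z nZ <-]; exists (- Z); first exact: lie_nN.
  by rewrite /theta_lie adjointN.
- move=> t _ [Z nZ <-]; exists (Ad (val X) t Z); last by rewrite theta_Ad.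
  exact: (lie_n_Ad g_complex a_max).
move=> _ eps [Z nZ <-] eps0.
have [C C0 hC] := adjoint_bounded dot.
have [T hT] := Ad_contracts a_max X_neg nZ (divr_gt0 eps0 C0); exists T => t /hT.
by rewrite theta_Ad ltr_pdivlMr // mulrC mnrmN; apply: le_lt_trans; exact: hC.
Qed.

(** An element of [G] near [1] is a product of exponentials of its parts in
    [n], in [theta n], and in the subalgebra that acts on weight vectors by
    scalars; the last factor fixes [p]. *)
Lemma nbhs_orb2 p : restset phi p ->
  nbhs p (orb2 actN act_thetaN p) /\ nbhs p (orb2 act_thetaN actN p).
Proof.
move=> Fp; have [v pv] := rep_ex (\val p); have [mu vmu] := rest_weight Fp pv.
have [p1 [p2 [p3 [pE hp]]]] :=
  root_decomposition G_closed.1 G_theta g_complex a_max Xo_regular X_neg X_generic.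
have hg Y : lie_algebra G Y ->
    [/\ lie_algebra G (p1 Y), lie_algebra G (p2 Y) & lie_algebra G (p3 Y)].
  move=> gY; have [n1 [Z nZ e2] _] := hp Y gY.
  have g1 := n_lie n1; have g2 : lie_algebra G (p2 Y) by rewrite e2; apply: theta_n_lie; exists Z.
  split => //; have -> : p3 Y = - 1 *: (p1 Y + p2 Y) + Y.
    by apply: (addrI (p1 Y + p2 Y)); rewrite scaleN1r addNKr -pE.
  apply: g_complex.2 => //.
  by have := g_complex.2 1 _ _ g1 g2; rewrite scale1r.
have fix3 Y : lie_algebra G Y -> act (expm (p3 Y)) p = p.
  move=> gY; have [_ _ /(_ mu v vmu)[c vc]] := hp Y gY; have [_ _ g3] := hg Y gY.
  have re := rep_actM G_closed M_orbit (lie_algebra_expm g3) pv.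
  have /vlineP[k ek] : expm (p3 Y) v \in <[v]>%VS.
    apply: expm_stable; last exact: memv_line.
    by move=> u /vlineP[k ->]; rewrite linearZ /= vc scalerA memvZ // memv_line.
  apply: (repM_inj re); rewrite ek; apply: rep_scale => //.
  by apply: contraNneq re.1 => k0; rewrite ek k0 scale0r.
have split2 Y q1 q2 : lie_algebra G Y -> lie_algebra G q1 -> lie_algebra G q2 ->
    act (expm q1 \o expm q2 \o expm (p3 Y))%VF p = act (expm q1) (act (expm q2) p).
  move=> gY /lie_algebra_expm g1 /lie_algebra_expm g2.
  have [_ _ /lie_algebra_expm g3] := hg Y gY.
  have g12 : G (expm q1 \o expm q2)%VF by have [[_ _ + _] _] := G_closed; apply.
  by rewrite -(actM G_closed M_orbit _ g12 g3) fix3 // (actM G_closed M_orbit _ g1 g2).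
split.
  have [d d0 hd] := local_factorization G_closed g_complex pE hg.
  apply: filterS (orbit_nbhs G_closed M_orbit M_closed p d0) => _ [g [Gg gd] <-].
  have [Y gY ->] := hd g Gg gd; have [n1 [Z nZ e2] _] := hp Y gY; have [g1 g2 _] := hg Y gY.
  exists (act (expm (p1 Y))); first by exists (p1 Y).
  exists (act (expm (p2 Y))); last exact: split2.
  by exists (p2 Y) => //; exists Z.
have pE' Y : Y = p2 Y + p1 Y + p3 Y by rewrite [p2 Y + _]addrC.
have [|d d0 hd] := local_factorization G_closed g_complex pE'.
  by move=> Y /hg[].
apply: filterS (orbit_nbhs G_closed M_orbit M_closed p d0) => _ [g [Gg gd] <-].
have [Y gY ->] := hd g Gg gd; have [n1 [Z nZ e2] _] := hp Y gY; have [g1 g2 _] := hg Y gY.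
exists (act (expm (p2 Y))); first by exists (p2 Y) => //; exists Z.
by exists (act (expm (p1 Y))); [exists (p1 Y)|exact: split2].
Qed.

Let nbhs_NN' p : restset phi p -> nbhs p (orb2 actN act_thetaN p).
Proof. by move=> /nbhs_orb2[]. Qed.

Let nbhs_N'N p : restset phi p -> nbhs p (orb2 act_thetaN actN p).
Proof. by move=> /nbhs_orb2[]. Qed.

Lemma special_flow_locally_linked : locally_linked phi.
Proof.
have [f glf] := special_flow_gradient_like.
exact: (product_locally_linked glf contracting_N contracting_thetaN nbhs_NN' nbhs_N'N).
Qed.

Let orbit_in_orb (S : set 'End(V)) x : S `<=` lie_algebra G ->
  orbit_in (expm @` S) x = orb [set act (expm Y) | Y in S] x.
Proof.
move=> SG; apply/seteqP; split => y.
  move=> [_ [Y SY <-] e]; exists (act (expm Y)); first by exists Y.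
  apply: val_inj; rewrite -[RHS]e; apply: (val_act G_closed M_orbit).
  by apply: lie_algebra_expm; exact: SG.
move=> [_ [Y SY <-] <-]; exists (expm Y); first by exists Y.
apply/esym; apply: (val_act G_closed M_orbit).
by apply: lie_algebra_expm; exact: SG.
Qed.

Lemma orbit_N_stable p : restset phi p -> orbit_in (groupN G Xo) p = stable phi p.
Proof.
have [f glf] := special_flow_gradient_like => Fp; rewrite /groupN orbit_in_orb //.
by rewrite (stable_orb glf contracting_N contracting_thetaN nbhs_NN').
Qed.

Lemma orbit_thetaN_unstable p : restset phi p ->
  orbit_in (thetaN dot G Xo) p = unstable phi p.
Proof.
have [f glf] := special_flow_gradient_like => Fp.
have -> : thetaN dot G Xo = expm @` (theta_lie dot @` lie_n G Xo).
  by rewrite /thetaN /groupN !image_comp; apply: eq_imagel => Y _; exact: theta_group_expm.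
rewrite orbit_in_orb //.
by rewrite (unstable_orb glf contracting_N contracting_thetaN nbhs_N'N).
Qed.

Lemma bruhat_linked p q : restset phi p -> restset phi q ->
  (bruhat (groupN G Xo) p q <-> linked phi p q).
Proof.
have [f glf] := special_flow_gradient_like => Fp Fq.
rewrite /bruhat /groupN !orbit_in_orb //.
exact: (orb_closure_linked glf contracting_N contracting_thetaN nbhs_NN' nbhs_N'N).
Qed.

End SpecialFlow.

Section Transport.
Context {T T' : Type} (F : set T).
Implicit Types (U : set T) (P : set (set T)) (Q : set (set T')).

Lemma eq_upper_set le le' : (forall x y, F x -> F y -> (le x y <-> le' x y)) ->
  upper_set F le = upper_set F le'.
Proof.
move=> h; apply/funext => U; apply/propext; split=> -[UF up]; split => // x y Ux Fy.
  by move=> /(h _ _ (UF _ Ux) Fy); exact: up.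
by move=> /(h _ _ (UF _ Ux) Fy); exact: up.
Qed.

Lemma eq_set_lattice_iso P Q (f f' : set T -> set T') :
  (forall U, P U -> U `<=` F) -> (forall U, U `<=` F -> f U = f' U) ->
  set_lattice_iso P Q f -> set_lattice_iso P Q f'.
Proof.
move=> PF ff' [[fun_f inj_f surj_f] lat]; split; first split.
- by move=> U PU; rewrite -ff'; [exact: fun_f|exact: PF].
- move=> U U' /[dup] PU /set_mem/PF UF /[dup] PU' /set_mem/PF UF'.
  by rewrite -!ff' //; exact: inj_f.
- move=> A /surj_f[U PU <-]; exists U => //; rewrite ff' //; exact: PF.
move=> A B PA PB; have [AF BF] := (PF _ PA, PF _ PB).
have UF : A `|` B `<=` F by move=> x [/AF|/BF].
have IF : A `&` B `<=` F by move=> x [/AF].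
rewrite -(ff' _ AF) -(ff' _ BF) -(ff' _ UF) -(ff' _ IF); exact: lat.
Qed.

End Transport.

Theorem theorem8p2 (R : realType) (V : vectType (Cplx R))
  (dot : {dot V for Num.conj})
  (G : set 'End(V))
  (G_closed : closed_subgroupGL G)
  (G_connected : connected (G : set (vtop 'End(V))))
  (G_theta : theta_group dot @` G `<=` G)
  (g_complex : complex_subspace (lie_algebra G))
  (a : set 'End(V)) (a_max : max_abelian_in_p dot G a)
  (Xo : a) (Xo_regular : forall alpha : a -> R, is_root G alpha -> alpha Xo <> 0)
  (M : set (projspace V))
  (M_orbit : exists x : projspace V, M = proj_orbit G x)
  (M_closed : closed M)
  (xc : M)
  (xc_fixed : forall b, groupB dot G Xo b -> proj_act b (val xc) = val xc)
  (X : a)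
  (X_neg : forall alpha : a -> R, pos_root G Xo alpha -> alpha X < 0)
  (X_generic : forall mu nu : a -> R,
     weight mu -> weight nu -> mu <> nu -> mu X <> nu X) :
  let Phi : R -> M -> M := flow (val X) in
  let F : set M := fixed_points (val X) in
  let N := groupN G Xo in
  let le : M -> M -> Prop := bruhat N in
  let AU : set M -> set M := saturation (thetaN dot G Xo) in
  let RL : set M -> set M := saturation N in
  [/\ set_lattice_iso (upper_set F le) (attractor Phi) AU,
      set_lattice_iso (lower_set F le) (attractor (reversed Phi)) RL
    & forall d : M -> M -> R, compatible_metric d ->
        forall L, lower_set F le L ->
          RL L = dual_repellor d Phi (AU (F `\` L))].
Proof.
move=> Phi F N le AU RL.
have [f glf] : exists f, gradient_like Phi f.
  exact: (special_flow_gradient_like G_closed a_max X M_orbit M_closed).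
have loc : locally_linked Phi.
  exact: (special_flow_locally_linked G_closed G_theta g_complex a_max Xo_regular X_neg
    X_generic M_orbit M_closed).
have leE x y : F x -> F y -> (linked Phi x y <-> le x y).
  move=> Fx Fy; apply: iff_sym.
  exact: (bruhat_linked G_closed G_theta g_complex a_max Xo_regular X_neg
    X_generic M_orbit M_closed Fx Fy).
have AUE U : U `<=` F -> unstable_hull Phi U = AU U.
  move=> UF; apply: eq_bigcupr => x /UF Fx; apply/esym.
  exact: (orbit_thetaN_unstable G_closed G_theta g_complex a_max Xo_regular X_neg
    X_generic M_orbit M_closed Fx).
have RLE L : L `<=` F -> stable_hull Phi L = RL L.
  move=> LF; apply: eq_bigcupr => x /LF Fx; apply/esym.
  exact: (orbit_N_stable G_closed G_theta g_complex a_max Xo_regular X_neg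
    X_generic M_orbit M_closed Fx).
split.
- rewrite -(eq_upper_set leE); apply: (eq_set_lattice_iso _ AUE).
    by move=> U [].
  exact: (upper_set_attractor_iso glf loc).
- have -> : lower_set F le = upper_set (restset (reversed Phi)) (linked (reversed Phi)).
    rewrite restset_reversed; apply: (eq_upper_set (le := fun x y => le y x)) => x y Fx Fy.
    by rewrite linked_reversed; apply: iff_sym; exact: leE.
  apply: (eq_set_lattice_iso (F := F) (f := unstable_hull (reversed Phi))).
  + by move=> U []; rewrite restset_reversed.
  + by move=> U UF; rewrite unstable_hull_reversed; exact: RLE.
  exact: (upper_set_attractor_iso (gradient_like_reversed glf) (locally_linked_reversed loc)).
move=> d dM L [LF low].
have upU : upper_set F (linked Phi) (F `\` L).
  split=> [x []//|x y [Fx nLx] Fy xy]; split => // Ly; apply: nLx.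
  by apply: (low y x Ly Fx); apply/leE.
have := stable_hull_dual_repellor glf loc dM upU.
by rewrite AUE => [|x []//]; rewrite setDD (setIidr LF) RLE.
Qed.
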